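(* Let $a$ be a compact operator of infinite rank on a Hilbert space $\mathcal H$. Then the set of exponents of singular traceability of $a$, i.e. the set of all $\alpha>0$ such that $|a|^{\alpha}$ is singularly traceable, is $$[\underline{\delta}(a),\overline{\delta}(a)]\cap(0,\infty).$$ In particular, if $\overline{d}(a)$ is finite and nonzero, then $\overline{d}(a)$ is an exponent of singular traceability of $a$.
   Context: For a compact operator $a$, $\{\mu_n(a)\}_{n\ge 0}$ is the sequence of eigenvalues of $|a|$ in non-increasing order counted with multiplicity, and the eigenvalue function $\mu_a:[0,\infty)\to[0,\infty)$ is $\mu_a(x)=\mu_n(a)$ for $x\in[n,n+1)$. Put $f(t)=-\log\mu_a(e^t)$, $t\in\mathbb R$. With the conventions $1/0=\infty$, $1/\infty=0$, define the following elements of $[0,\infty]$: $$\underline{\delta}(a)=\Big(\lim_{h\to\infty}\limsup_{t\to\infty}\tfrac{f(t+h)-f(t)}{h}\Big)^{-1},\qquad \overline{\delta}(a)=\Big(\lim_{h\to\infty}\liminf_{t\to\infty}\tfrac{f(t+h)-f(t)}{h}\Big)^{-1},\qquad \overline{d}(a)=\Big(\liminf_{t\to\infty}\tfrac{f(t)}{t}\Big)^{-1}$$ (the limits in $h$ exist). A singular trace on $\mathcal B(\mathcal H)$ is a positive tracial weight $\tau:\mathcal B(\mathcal H)_+\to[0,\infty]$ (additive, positively homogeneous, $\tau(x^*x)=\tau(xx^* )$) which vanishes on finite rank projections. A compact operator $a$ is singularly traceable if there is a singular trace $\tau$ with $0<\tau(|a|)<\infty$. *)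

(* Defs.v *)
From HB Require Import structures.
From mathcomp Require Import all_boot all_order all_algebra.
From mathcomp Require Import sesquilinear complex.
From mathcomp Require Import all_classical all_reals all_analysis.

Set Implicit Arguments.
Unset Strict Implicit.
Unset Printing Implicit Defensive.

Import Order.TTheory GRing.Theory Num.Theory.
Import numFieldNormedType.Exports.

Local Open Scope classical_set_scope.
Local Open Scope card_scope.
Local Open Scope complex_scope.
Local Open Scope ring_scope.

(* A Hilbert space is a complete normed space H over R[i] with an inner
   product dot (linear in the first argument) inducing the norm.
   Operators are plain functions H -> H; objects that exist uniquely (adjoint,
   modulus, power, eigenvalue sequence) are picked by xget, whose default value
   is irrelevant whenever they exist. *)
Section Operators.
Context {R : realType} {H : completeNormedModType R[i]}.
Variable dot : {dot H for Num.conj}.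
Implicit Types (a b p T : H -> H).

Definition induces_norm := forall x : H, dot x x = `|x| ^+ 2.

Definition bounded_op T := linear T /\ continuous T.

Definition positive_op T := bounded_op T /\ forall x, 0 <= dot (T x) x.

Definition compact_op T :=
  linear T /\ compact (closure (T @` [set x | `|x| <= 1])).

Definition finite_rank T := exists (n : nat) (e : 'I_n -> H),
  forall x, exists c : 'I_n -> R[i], T x = \sum_i c i *: e i.

Definition adjoint T : H -> H :=
  xget (fun=> 0) [set b | bounded_op b /\ forall x y, dot (T x) y = dot x (b y)].

Definition modulus T : H -> H :=
  xget (fun=> 0) [set p | positive_op p /\ p \o p = adjoint T \o T].

(* For T positive and compact, hence diagonalizable: T ^ alpha acts as the
   scalar lambda ^ alpha on the eigenspace of T for lambda (including 0), and
   these eigenspaces span a dense subspace. *)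
Definition op_power T (alpha : R) : H -> H :=
  xget (fun=> 0) [set b | bounded_op b /\
    forall (lambda : R) v, T v = lambda%:C *: v ->
      b v = (lambda `^ alpha)%:C *: v].

Definition lin_indep k (v : 'I_k -> H) :=
  forall c : 'I_k -> R[i], \sum_i c i *: v i = 0 -> forall i, c i = 0.

(* Each lambda > 0 occurs in u exactly dim (ker (T - lambda)) times; for T of
   finite rank, u is eventually 0. *)
Definition eigenvalue_sequence T (u : nat -> R) :=
  [/\ nonincreasing_seq u,
      forall n, 0 <= u n
    & forall (lambda : R) (k : nat), 0 < lambda ->
        (exists v : 'I_k -> H,
           lin_indep v /\ forall i, T (v i) = lambda%:C *: v i)
        <-> `I_k #<= [set n | u n = lambda]].

Definition mu_seq a : nat -> R :=
  xget (fun=> 0) [set u | eigenvalue_sequence (modulus a) u].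

Definition mu_fun a (x : R) : R := mu_seq a (Num.truncn x).

Definition logmu a (t : R) : R := - ln (mu_fun a (expR t)).

Definition slope a (h t : R) : \bar R := ((logmu a (t + h) - logmu a t) / h)%:E.

Definition delta_lower a : \bar R :=
  ((lim (limf_esup (slope a h) (+oo%R : set_system R) @[h --> +oo%R]))^-1)%E.

Definition delta_upper a : \bar R :=
  ((lim (limf_einf (slope a h) (+oo%R : set_system R) @[h --> +oo%R]))^-1)%E.

Definition d_upper a : \bar R :=
  ((limf_einf (fun t : R => (logmu a t / t)%:E) (+oo%R : set_system R))^-1)%E.

Definition projection p := positive_op p /\ p \o p = p.

(* A weight is only meaningful on the positive bounded operators. In \bar R,
   0 * +oo = 0. *)
Record singular_trace (tau : (H -> H) -> \bar R) : Prop := SingularTrace {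
  trace_ge0 : forall p, positive_op p -> (0 <= tau p)%E ;
  trace_add : forall p q, positive_op p -> positive_op q ->
    tau (p \+ q) = (tau p + tau q)%E ;
  trace_scale : forall (c : R) p, 0 <= c -> positive_op p ->
    tau (fun x => c%:C *: p x) = (c%:E * tau p)%E ;
  trace_tracial : forall x, bounded_op x ->
    tau (adjoint x \o x) = tau (x \o adjoint x) ;
  trace_singular : forall p, projection p -> finite_rank p -> tau p = 0%E }.

Definition singularly_traceable a := compact_op a /\
  exists tau, singular_trace tau /\ (0 < tau (modulus a) < +oo)%E.

Definition traceability_exponents a : set R :=
  [set alpha | 0 < alpha /\ singularly_traceable (op_power (modulus a) alpha)].

End Operators.

(* Main.v *)
(* Write f for the log profile of mu = mu(a) and g = alpha f for that of
   |a|^alpha.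

   By the singular value decomposition (obtained directly: a maximizing
   sequence of |a x| over the unit ball of a subspace converges, by
   compactness and the parallelogram identity), |a|^alpha is diagonal with
   entries v_n = mu_n^alpha in an orthonormal sequence.  A singular trace
   ignores finitely many entries, and N copies of |a|^alpha are equivalent to
   the diagonal operator with entries v_(n/N).  If the upper index of g is
   < 1, then v_(n/N) <= q v_n eventually for some N and q < N, so that
   N tau <= q tau; dually if the lower index of g is > 1.  Hence a finite
   nonzero value is impossible outside of the stated interval.

   Conversely let S_n(p) be the Ky Fan sums of p.  They satisfy
   S_n(p + q) <= S_n(p) + S_n(q) <= S_2n(p + q) and S_n(x* x) = S_n(x x* ).
   If v is not summable and the upper index of g is >= 1, there are m_k with
   S_(4^k m_k) <= 2 S_(m_k) for |a|^alpha; the averages over i < k of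
   S_(2^i m_k)(p) / S_(m_k)(|a|^alpha) then have an additive limit along an
   ultrafilter.  If v is summable and the lower index is <= 1, the tails
   Tr(p) - S_n(p) are used instead. *)

Require Import Defs.
From HB Require Import structures.
From mathcomp Require Import all_boot all_order all_algebra.
From mathcomp Require Import sesquilinear complex.
From mathcomp Require Import all_classical all_reals all_analysis.
From mathcomp Require Import ring lra.

Import Order.TTheory GRing.Theory Num.Theory.
Import numFieldNormedType.Exports.

Local Open Scope classical_set_scope.
Local Open Scope card_scope.
Local Open Scope complex_scope.
Local Open Scope ring_scope.

Set Implicit Arguments.
Unset Strict Implicit.
Unset Printing Implicit Defensive.

Local Notation Re := complex.Re.
Local Notation Im := complex.Im.

(** * Inner product geometry *)

Section InnerProduct.
Context {R : realType} {H : completeNormedModType R[i]}.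
Variable dot : {dot H for Num.conj}.
Hypothesis hdot : induces_norm dot.

(** A trace has to be defined on all bounded positive operators, which need not have eigenvalues; so
    the Ky Fan sums are suprema over finite orthonormal families, and Gram-Schmidt and Bessel yield
    their properties. The only loss is the doubled index in S_n(p) + S_n(q) <= S_2n(p + q). On the
    scales 2^i m it is one step in i, so an average over k consecutive scales is additive up to
    boundary terms of order 1/k. Control up to 4^k m_k instead of 2^k m_k leaves room for such steps
    beyond the averaged range. Such m_k exist by contradiction. Let N = 2^j and suppose S_(N m) > 2
    S_m for all large m. Iteration and the monotonicity of v give 2^l v_m <= N^(l+1) v_(N^l m), and
    for large l this forces the upper index of g below 1. If tails shrink by a factor 2 from m to N
    m, the same argument forces the lower index above 1. The split by summability serves
    singularity: on a finite rank projection Ky Fan sums are bounded, so dividing by S_(m_k) kills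
    them only if S is unbounded, whereas tails vanish there outright. *)

Definition csq (z : R[i]) : R := Re z ^+ 2 + Im z ^+ 2.

Definition sqnorm (x : H) : R := Re (dot x x).

Local Notation sqn := sqnorm.

(** The norms of [R[i]] and [H] are valued in [R[i]]; with [csq], [sqnorm] and [nr] all estimates
    live in the ordered field [R]. *)
Definition nr (x : H) : R := Re `|x|.

Lemma normE x : `|x| = (nr x)%:C.
Proof. by rewrite /nr RRe_real// normr_real. Qed.

Lemma nr_ge0 x : 0 <= nr x.
Proof. by rewrite -ler0c -normE. Qed.

Lemma dotxx x : dot x x = (sqn x)%:C.
Proof. by rewrite /sqnorm RRe_real// hdot rpredX// normr_real. Qed.

Lemma sqnE x : sqn x = nr x ^+ 2.
Proof. by apply: complexI; rewrite -dotxx hdot normE rmorphXn. Qed.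

Lemma sqn_ge0 x : 0 <= sqn x.
Proof. by rewrite sqnE sqr_ge0. Qed.

Lemma nrE x : nr x = Num.sqrt (sqn x).
Proof. by rewrite sqnE sqrtr_sqr ger0_norm// nr_ge0. Qed.

Lemma sqn_eq0 x : (sqn x = 0) <-> (x = 0).
Proof.
rewrite sqnE; split => [/eqP|->]; last by rewrite /nr normr0 expr0n.
by rewrite sqrf_eq0 => /eqP h; apply/eqP; rewrite -normr_eq0 normE h.
Qed.

Lemma csq_ge0 z : 0 <= csq z.
Proof. by rewrite addr_ge0// sqr_ge0. Qed.

Lemma csqE z : (csq z)%:C = z * z^*%C.
Proof. by case: z => a b; rewrite /csq; simpc; congr (_ +i* _); ring. Qed.

Lemma csqM z w : csq (z * w) = csq z * csq w.
Proof. by case: z w => [a b] [c d]; rewrite /csq /=; ring. Qed.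

Lemma csqJ z : csq z^*%C = csq z.
Proof. by case: z => [a b]; rewrite /csq /=; ring. Qed.

Lemma csqr (r : R) : csq r%:C = r ^+ 2.
Proof. by rewrite /csq/=; ring. Qed.

Lemma csq_eq0 z : csq z = 0 -> z = 0.
Proof.
case: z => [a b]; rewrite /csq/= => /eqP.
by rewrite paddr_eq0 ?sqr_ge0// !sqrf_eq0 => /andP[/eqP-> /eqP->].
Qed.

Lemma conjcM (z w : R[i]) : (z * w)^*%C = z^*%C * w^*%C.
Proof. exact: rmorphM. Qed.

Lemma dotC x y : dot x y = (dot y x)^*%C.
Proof. by rewrite hermC/= expr0 mul1r. Qed.

Lemma dotDl x y z : dot (x + y) z = dot x z + dot y z.
Proof. exact: linearDl. Qed.

Lemma dotDr x y z : dot x (y + z) = dot x y + dot x z.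
Proof. exact: linearDr. Qed.

Lemma dotNl x z : dot (- x) z = - dot x z.
Proof. exact: linearNl. Qed.

Lemma dotNr x z : dot x (- z) = - dot x z.
Proof. exact: linearNr. Qed.

Lemma dotBl x y z : dot (x - y) z = dot x z - dot y z.
Proof. by rewrite dotDl dotNl. Qed.

Lemma dotBr x y z : dot x (y - z) = dot x y - dot x z.
Proof. by rewrite dotDr dotNr. Qed.

Lemma dotZl c x z : dot (c *: x) z = c * dot x z.
Proof. exact: linearZl_LR. Qed.

Lemma dotZr c x z : dot x (c *: z) = c^*%C * dot x z.
Proof. exact: linearZr_LR. Qed.

Lemma dot0l z : dot 0 z = 0.
Proof. exact: linear0l. Qed.

Lemma dot0r z : dot z 0 = 0.
Proof. exact: linear0r. Qed.

Lemma dot_suml (I : Type) (r : seq I) (P : pred I) (F : I -> H) z :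
  dot (\sum_(i <- r | P i) F i) z = \sum_(i <- r | P i) dot (F i) z.
Proof. exact: linear_sumlz. Qed.

Lemma dot_sumr (I : Type) (r : seq I) (P : pred I) (F : I -> H) z :
  dot z (\sum_(i <- r | P i) F i) = \sum_(i <- r | P i) dot z (F i).
Proof. exact: linear_sumr. Qed.

Lemma sqnZ c x : sqn (c *: x) = csq c * sqn x.
Proof.
by apply: complexI; rewrite -dotxx dotZl dotZr mulrA -csqE dotxx rmorphM.
Qed.

Lemma sqnD x y : sqn (x + y) = sqn x + sqn y + 2 * Re (dot x y).
Proof.
rewrite /sqnorm dotDl !dotDr !raddfD/= (dotC y x).
by case: (dot x y) => a b /=; ring.
Qed.

Lemma sqnN x : sqn (- x) = sqn x.
Proof. by rewrite /sqnorm dotNl dotNr opprK. Qed.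

Lemma sqnB x y : sqn (x - y) = sqn x + sqn y - 2 * Re (dot x y).
Proof. by rewrite sqnD sqnN dotNr raddfN/=; ring. Qed.

Lemma parallelogram x y : sqn (x + y) + sqn (x - y) = 2 * sqn x + 2 * sqn y.
Proof. by rewrite sqnB sqnD; ring. Qed.

Lemma sqnD_orth x y : dot x y = 0 -> sqn (x + y) = sqn x + sqn y.
Proof. by move=> h; rewrite sqnD h/= mulr0 addr0. Qed.

(** The square norm of [(sqn y) x - <x, y> y] equals [sqn y * (sqn x * sqn y - csq (dot x y))] and
    is non-negative. *)
Lemma cauchy_schwarz x y : csq (dot x y) <= sqn x * sqn y.
Proof.
have [->|/eqP y0] := eqVneq y 0.
  by rewrite dot0r /csq /= expr0n addr0 mulr_ge0// sqn_ge0.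
have s0 : 0 < sqn y.
  by rewrite lt_def sqn_ge0 andbT; apply/eqP => /sqn_eq0.
have := sqn_ge0 ((sqn y)%:C *: x - dot x y *: y).
rewrite sqnB !sqnZ dotZl dotZr csqr.
have -> : Re ((sqn y)%:C * ((dot x y)^*%C * dot x y)) = sqn y * csq (dot x y).
  by rewrite [_ * dot x y]mulrC -csqE -rmorphM.
move=> h.
have : 0 <= sqn y * (sqn x * sqn y - csq (dot x y)) by lra.
by rewrite pmulr_rge0// subr_ge0.
Qed.

Lemma nrD x y : nr (x + y) <= nr x + nr y.
Proof. by rewrite -lecR rmorphD/= -!normE ler_normD. Qed.

Lemma nrN x : nr (- x) = nr x.
Proof. by rewrite /nr normrN. Qed.

Lemma nrB x y : nr (x - y) = nr (y - x).
Proof. by rewrite -nrN opprB. Qed.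

Lemma nrZ c x : nr (c *: x) = Num.sqrt (csq c) * nr x.
Proof. by rewrite !nrE sqnZ sqrtrM// csq_ge0. Qed.

Lemma nr0 : nr 0 = 0.
Proof. by rewrite /nr normr0. Qed.

Lemma nr_eq0 x : nr x = 0 -> x = 0.
Proof. by move=> h; apply/sqn_eq0; rewrite sqnE h expr0n. Qed.

Lemma dot_ext x y : (forall z, dot x z = dot y z) -> x = y.
Proof.
move=> h; apply/eqP; rewrite -subr_eq0; apply/eqP/sqn_eq0.
by apply: complexI; rewrite -dotxx dotBl h subrr.
Qed.

Lemma sqn_le x (r : R) : 0 <= r -> (sqn x <= r ^+ 2) = (nr x <= r).
Proof. by move=> r0; rewrite sqnE ler_sqr// nnegrE ?nr_ge0. Qed.

Lemma cvg_nrP (F : set_system H) {FF : Filter F} (x : H) :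
  F --> x <-> forall e : R, 0 < e -> \forall y \near F, nr (x - y) < e.
Proof.
split.
  move=> /cvgrPdist_lt h e e0; have := h e%:C; rewrite ltcR => /(_ e0).
  by apply: filterS => y; rewrite normE ltcR.
move=> h; apply/cvgrPdist_lt => e; rewrite ltcE/= => /andP[/eqP ie e0].
have -> : e = (Re e)%:C by case: e ie e0 => a b /= ->.
by apply: filterS (h _ e0) => y hy; rewrite normE ltcR.
Qed.

Lemma cauchy_nr (F : set_system H) {FF : ProperFilter F} :
  (forall e : R, 0 < e -> exists x : H, \forall y \near F, nr (x - y) < e) ->
  exists x : H, F --> x.
Proof.
move=> h; suff : cvg F by move=> c; exists (lim F).
apply: cauchy_cvg; apply: cauchy_exP => e; rewrite ltcE/= => /andP[/eqP ie e0].
have -> : e = (Re e)%:C by case: e ie e0 => a b /= ->.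
have [x hx] := h _ e0; exists x; apply: filterS hx => y hy.
by rewrite -ball_normE/= normE ltcR.
Qed.

Definition bounded_by (T : H -> H) (M : R) := forall x, nr (T x) <= M * nr x.

Lemma lin_add (T : H -> H) x y : linear T -> T (x + y) = T x + T y.
Proof. by move=> lT; have := lT 1 x y; rewrite !scale1r. Qed.

Lemma lin_zero (T : H -> H) : linear T -> T 0 = 0.
Proof. by move=> lT; apply: (addIr (T 0)); rewrite -lin_add// !add0r. Qed.

Lemma lin_scale (T : H -> H) c x : linear T -> T (c *: x) = c *: T x.
Proof. by move=> lT; have := lT c x 0; rewrite !addr0 lin_zero// addr0. Qed.

Lemma lin_sub (T : H -> H) x y : linear T -> T (x - y) = T x - T y.
Proof. by move=> lT; rewrite lin_add// -scaleN1r lin_scale// scaleN1r. Qed.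

Lemma lin_sum (I : Type) (r : seq I) (P : pred I) (F : I -> H) (T : H -> H) :
  linear T -> T (\sum_(i <- r | P i) F i) = \sum_(i <- r | P i) T (F i).
Proof.
move=> lT; elim/big_rec2 : _ => [|i y z _ <-]; first exact: lin_zero.
exact: lin_add.
Qed.

Lemma linear_bounded_continuous (T : H -> H) M :
  linear T -> bounded_by T M -> bounded_op T.
Proof.
move=> lT bT; split=> // x; apply/cvg_nrP => e e0.
have M0 : 0 < `|M| + 1 by rewrite ltr_wpDl.
have /cvg_nrP /(_ (e / (`|M| + 1))) : nbhs x --> x by exact: cvg_id.
rewrite divr_gt0// => /(_ isT).
apply: filterS => y hy /=; rewrite -lin_sub//.
apply: (le_lt_trans (y := (`|M| + 1) * nr (x - y))).
  apply: (le_trans (bT _)); apply: ler_wpM2r; first exact: nr_ge0.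
  by apply: (le_trans (ler_norm _)); rewrite lerDl.
by rewrite mulrC -ltr_pdivlMr.
Qed.

End InnerProduct.

(** * Orthogonal families *)

Section OrthogonalFamilies.
Context {R : realType} {H : completeNormedModType R[i]}.
Variable dot : {dot H for Num.conj}.
Hypothesis hdot : induces_norm dot.
Local Notation sqn := (sqnorm dot).

(* Zero vectors are allowed, so that every finite family spans the same
   subspace as such a family of the same length. *)
Definition orthosys (e : nat -> H) :=
  (forall i j, i != j -> dot (e i) (e j) = 0) /\
  (forall i, e i = 0 \/ dot (e i) (e i) = 1).

Definition proj (e : nat -> H) n x := \sum_(i < n) dot x (e i) *: e i.

(** For an [orthosys] this is membership in the span of the first [n] vectors, put as an equation
    that can be rewritten with. *)
Definition inspan e n x := proj e n x = x.

Lemma proj_linear e n : linear (proj e n).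
Proof.
move=> a x y; rewrite /proj scaler_sumr -big_split; apply: eq_bigr => i _ /=.
by rewrite dotDl dotZl scalerDl scalerA.
Qed.

Lemma dot_proj e n x i : orthosys e -> (i < n)%N ->
  dot (proj e n x) (e i) = dot x (e i).
Proof.
move=> [eo en] ilt; rewrite dot_suml (bigD1 (Ordinal ilt))//= big1 ?addr0.
  by rewrite dotZl; case: (en i) => [->|->]; rewrite ?dot0r ?mulr0 ?mulr1.
by move=> j ji; rewrite dotZl eo ?mulr0.
Qed.

Lemma proj_orth e n x y : orthosys e -> dot (x - proj e n x) (proj e n y) = 0.
Proof.
move=> eo; rewrite [in X in dot _ X]/proj dot_sumr big1// => i _.
by rewrite dotZr dotBl dot_proj// subrr mulr0.
Qed.

Lemma dot_proj_sym e n x y : dot (proj e n x) y = dot x (proj e n y).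
Proof.
rewrite dot_suml dot_sumr; apply: eq_bigr => i _.
by rewrite dotZl dotZr -(dotC dot) mulrC.
Qed.

Lemma sqn_proj e n x : orthosys e ->
  sqn (proj e n x) = \sum_(i < n) csq (dot x (e i)).
Proof.
move=> eo; rewrite /sqnorm {2}/proj dot_sumr raddf_sum; apply: eq_bigr => i _ /=.
by rewrite dotZr dot_proj// mulrC -csqE.
Qed.

Lemma sqn_proj_split e n x : orthosys e ->
  sqn x = sqn (proj e n x) + sqn (x - proj e n x).
Proof.
move=> eo; rewrite -{1}(subrK (proj e n x) x) sqnD_orth ?proj_orth//.
exact: addrC.
Qed.

Lemma bessel e n x : orthosys e ->
  \sum_(i < n) csq (dot x (e i)) <= sqn x.
Proof.
by move=> eo; rewrite -sqn_proj// (sqn_proj_split n x eo) lerDl sqn_ge0.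
Qed.

Lemma inspan_sqn e n x : orthosys e -> inspan e n x ->
  sqn x = \sum_(i < n) csq (dot x (e i)).
Proof. by move=> eo h; rewrite -sqn_proj// h. Qed.

Lemma inspan_base e n k : orthosys e -> (k < n)%N -> inspan e n (e k).
Proof.
move=> [eo en] kn; rewrite /inspan /proj (bigD1 (Ordinal kn))//= big1 ?addr0.
  by case: (en k) => [->|->]; rewrite ?scaler0 ?scale1r.
by move=> j jk; rewrite eo ?scale0r// eq_sym.
Qed.

Lemma inspan_comb e n m (c : nat -> R[i]) x :
  (forall k, (k < m)%N -> inspan e n (x k)) ->
  inspan e n (\sum_(k < m) c k *: x k).
Proof.
move=> h; rewrite /inspan lin_sum; last exact: proj_linear.
by apply: eq_bigr => k _; rewrite lin_scale ?h//; exact: proj_linear.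
Qed.

Definition normalize (v : H) := (nr v)^-1%:C *: v.

Lemma normalizeP v : normalize v = 0 \/ dot (normalize v) (normalize v) = 1.
Proof.
have [v0|v0] := eqVneq (nr v) 0; [left|right].
  by rewrite /normalize v0 invr0 scale0r.
by rewrite dotxx// sqnZ// csqr (sqnE hdot) -exprMn mulVf// expr1n.
Qed.

Lemma normalizeK v : v = (nr v)%:C *: normalize v.
Proof.
have [v0|v0] := eqVneq (nr v) 0.
  by rewrite v0 scale0r; exact: (nr_eq0 hdot).
by rewrite scalerA -rmorphM mulfV// scale1r.
Qed.

Lemma normalize_id v : v = 0 \/ dot v v = 1 -> normalize v = v.
Proof.
case=> [->|v1]; first by rewrite /normalize scaler0.
have : nr v = 1 by rewrite (nrE hdot) /sqnorm v1 sqrtr1.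
by rewrite /normalize => ->; rewrite invr1 scale1r.
Qed.

(** The normalized residual of [x n] goes into slot [n], which held 0 so far; a zero residual stays
    a zero vector, so the length never changes. The last clause, by which an initial segment that is
    already orthonormal survives, lets one family be completed by another. *)
Lemma gram_schmidt (x : nat -> H) n : exists g,
  [/\ orthosys g,
      forall k, (n <= k)%N -> g k = 0,
      forall k, (k < n)%N -> inspan g n (x k),
      forall k, exists c : nat -> R[i], g k = \sum_(j < n) c j *: x j &
      forall m, (m <= n)%N ->
        (forall i j, (i < m)%N -> (j < m)%N -> i != j -> dot (x i) (x j) = 0) ->
        (forall i, (i < m)%N -> x i = 0 \/ dot (x i) (x i) = 1) ->
        forall i, (i < m)%N -> g i = x i].
Proof.
elim: n => [|n [g [go g0 gs gc gp]]].
  exists (fun=> 0); split=> //; last by move=> [].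
    by split=> [i j _|i]; [rewrite dot0l|left].
  by move=> k; exists (fun=> 0); rewrite big_ord0.
pose r := x n - proj g n (x n).
pose g' k := if k == n then normalize r else g k.
have g'E k : (k < n)%N -> g' k = g k by move=> kn; rewrite /g' ltn_eqF.
have rg j : (j < n)%N -> dot r (g j) = 0.
  by move=> jn; rewrite dotBl dot_proj// subrr.
have rg' j : j != n -> dot (normalize r) (g j) = 0.
  move=> jn; rewrite dotZl; have [jn'|jn'] := ltnP j n; first by rewrite rg ?mulr0.
  by rewrite g0// dot0r mulr0.
have g'o : orthosys g'.
  split=> [i j|i]; rewrite /g'.
    have [ni'|ni] := eqVneq i n; have [nj'|nj] := eqVneq j n; move=> ij.
    - by rewrite ni' nj' eqxx in ij.
    - exact: rg'.
    - by rewrite (dotC dot) rg'// conjc0.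
    - by apply: go.1.
  by case: eqP => _; [exact: normalizeP|exact: go.2].
have xr : x n = proj g n (x n) + (nr r)%:C *: g' n.
  by rewrite /g' eqxx -normalizeK addrC subrK.
have projg' v : proj g' n v = proj g n v.
  by apply: eq_bigr => i _; rewrite g'E.
exists g'; split=> //.
- by move=> k nk; rewrite /g' gtn_eqF// g0// ltnW.
- have base k : (k < n)%N -> inspan g' n.+1 (g k).
    by move=> kn; rewrite -g'E//; apply: inspan_base => //; exact: ltnW.
  move=> k; rewrite ltnS leq_eqVlt => /orP[/eqP->|kn].
    rewrite xr /inspan lin_add; last exact: proj_linear.
    rewrite lin_scale; last exact: proj_linear.
    congr (_ + _ *: _); last by apply: inspan_base.
    by apply: (inspan_comb (fun i => dot (x n) (g i))).
  by rewrite -(gs _ kn); apply: (inspan_comb (fun i => dot (x k) (g i))).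
- move=> k; rewrite /g'; case: (eqVneq k n) => [kn|kn]; last first.
    have [c ->] := gc k; exists (fun j => if (j < n)%N then c j else 0).
    rewrite big_ord_recr/= ltnn scale0r addr0.
    by apply: eq_bigr => i _; rewrite ltn_ord.
  pose cc i := sval (cid (gc i)).
  have ccP i : g i = \sum_(j < n) cc i j *: x j by rewrite /cc; case: cid.
  exists (fun j => (nr r)^-1%:C *
    (if (j < n)%N then - \sum_(i < n) dot (x n) (g i) * cc i j else 1)).
  rewrite big_ord_recr/= ltnn mulr1 /normalize {2}/r scalerBr addrC.
  congr (_ + _); rewrite /proj -scalerN.
  under [RHS]eq_bigr do rewrite ltn_ord -scalerA.
  rewrite -!scaler_sumr; congr (_ *: _).
  under eq_bigr => i _ do rewrite ccP scaler_sumr.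
  rewrite exchange_big -sumrN; apply: eq_bigr => j _ /=.
  rewrite scaleNr scaler_suml; congr (- _); apply: eq_bigr => i _ /=.
  by rewrite scalerA -ccP.
- move=> m; rewrite leq_eqVlt => /orP[/eqP->|]; last first.
    rewrite ltnS => mn xo xn i im; rewrite g'E; last exact: leq_trans mn.
    exact: (gp m).
  move=> xo xn i; rewrite ltnS leq_eqVlt => /orP[/eqP->|i_n]; last first.
    rewrite g'E//; apply: (gp n) => //.
      by move=> a b an bn; apply: xo; exact: ltnW.
    by move=> a an; apply: xn; exact: ltnW.
  rewrite /g' eqxx; suff -> : r = x n by apply: normalize_id; exact: xn.
  rewrite /r /proj big1 ?subr0// => j _; rewrite (gp n)//.
  + have jn := ltn_ord j; rewrite xo ?scale0r//; first exact: ltnW.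
    by rewrite gtn_eqF.
  + by move=> a b an bn; apply: xo; exact: ltnW.
  + by move=> a an; apply: xn; exact: ltnW.
Qed.

(** Basis independence of the trace of a compression of [p]: expand [g j] along [h] in the second
    slot, exchange the sums, and collect [h k] from its expansion along [g] in the first slot. *)
Lemma trace_indep (p : H -> H) g h n m : linear p ->
  (forall j, (j < n)%N -> inspan h m (g j)) ->
  (forall k, (k < m)%N -> inspan g n (h k)) ->
  \sum_(j < n) dot (p (g j)) (g j) = \sum_(k < m) dot (p (h k)) (h k).
Proof.
move=> lp gh hg.
transitivity (\sum_(j < n) \sum_(k < m) dot (h k) (g j) * dot (p (g j)) (h k)).
  apply: eq_bigr => j _; rewrite -{2}(gh j)// dot_sumr; apply: eq_bigr => k _.
  by rewrite dotZr -(dotC dot).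
rewrite exchange_big; apply: eq_bigr => k _ /=.
have -> : p (h k) = p (proj g n (h k)) by rewrite hg.
rewrite (lin_sum _ _ _ lp) dot_suml; apply: eq_bigr => j _.
by rewrite (lin_scale _ _ lp) dotZl.
Qed.

Lemma bounded_op_bound (T : H -> H) : bounded_op T ->
  exists2 M, 0 < M & bounded_by T M.
Proof.
move=> [lT cT]; have /cvg_nrP /(_ 1 ltr01) := cT 0; rewrite lin_zero//.
move=> /nbhs_ballP [d /=]; rewrite ltcE/= => /andP[/eqP id d0] hd.
exists (2 / Re d); first by rewrite divr_gt0.
move=> x; have [x0|x0] := eqVneq (nr x) 0.
  by rewrite (nr_eq0 hdot x0) lin_zero// nr0 mulr0.
have xp : 0 < nr x by rewrite lt_def x0 nr_ge0.
pose k := Re d / (2 * nr x); have k0 : 0 < k by rewrite divr_gt0// mulr_gt0.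
have := hd (k%:C *: x).
have nk (y : H) : nr (k%:C *: y) = k * nr y.
  by rewrite (nrZ hdot) csqr sqrtr_sqr gtr0_norm.
rewrite /= -ball_normE /= sub0r normrN normE nk.
have -> : k * nr x = Re d / 2 by rewrite /k; field.
have -> : d = (Re d)%:C by case: d id d0 hd @k k0 nk => a b /= ->.
rewrite /= ltcR => /(_ _); have h : Re d / 2 < Re d by lra.
move=> /(_ h); rewrite sub0r nrN lin_scale// nk mulrC -ltr_pdivlMr// => /ltW.
move=> /le_trans; apply; rewrite /k invfM invrK; apply/eqP/eqP; rewrite le_eqVlt.
by apply/orP; left; apply/eqP; field; rewrite gt_eqF.
Qed.

End OrthogonalFamilies.

(** * Ky Fan sums *)

Section KyFan.
Context {R : realType} {H : completeNormedModType R[i]}.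
Variable dot : {dot H for Num.conj}.
Hypothesis hdot : induces_norm dot.
Local Notation sqn := (sqnorm dot).
Local Notation orthosys := (orthosys dot).

Definition quad (p : H -> H) x : R := Re (dot (p x) x).

Definition family_sum (p : H -> H) n (e : nat -> H) : R :=
  \sum_(i < n) quad p (e i).

(* For compact p this is the sum of the n largest eigenvalues. *)
Definition kyfan (p : H -> H) (n : nat) : R :=
  sup [set family_sum p n e | e in [set e | orthosys e]].

Lemma quad_ge0 p x : positive_op dot p -> 0 <= quad p x.
Proof. by move=> [_ /(_ x)]; rewrite lecE /= => /andP[]. Qed.

Lemma quad_le p x : positive_op dot p -> dot (p x) x = (quad p x)%:C.
Proof. by move=> [_ /(_ x)]; rewrite lecE /quad; case: (dot (p x) x) => a b /= /andP[/eqP->]. Qed.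

Lemma quadD p q x : quad (p \+ q) x = quad p x + quad q x.
Proof. by rewrite /quad /= dotDl raddfD. Qed.

Lemma quadZ (c : R) p x : quad (fun x => c%:C *: p x) x = c * quad p x.
Proof. by rewrite /quad dotZl; case: (dot (p x) x) => a b /=; rewrite mul0r subr0. Qed.

Lemma quad_bound p M x : 0 <= M -> bounded_by p M -> quad p x <= M * sqn x.
Proof.
move=> M0 hp; apply: (le_trans (ler_norm _)); rewrite -ler_sqr; last 2 first.
- by rewrite nnegrE.
- by rewrite nnegrE mulr_ge0// sqn_ge0.
rewrite -normrX ger0_norm ?sqr_ge0//.
apply: (le_trans (y := csq (dot (p x) x))); first by rewrite lerDl sqr_ge0.
apply: (le_trans (cauchy_schwarz hdot _ _)).
have -> : (M * sqn x) ^+ 2 = (M * nr x) ^+ 2 * sqn x.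
  by rewrite (sqnE hdot); ring.
apply: ler_wpM2r; first exact: sqn_ge0.
by rewrite (sqn_le hdot) // mulr_ge0// nr_ge0.
Qed.

Lemma orthosys_sqn_le1 e i : orthosys e -> sqn (e i) <= 1.
Proof.
by move=> [_ /(_ i)]; rewrite /sqnorm; case=> ->; rewrite ?dot0l/= ?ler01.
Qed.

Lemma orthosys0 : orthosys (fun=> 0).
Proof. by split=> [i j _|i]; [rewrite dot0l|left]. Qed.

Lemma kyfan_has_sup p n : positive_op dot p ->
  has_sup [set family_sum p n e | e in [set e | orthosys e]].
Proof.
move=> [bp _]; have [M M0 hM] := bounded_op_bound hdot bp.
split; first by exists (family_sum p n (fun=> 0)), (fun=> 0); [exact: orthosys0|].
exists (M *+ n) => _ [e he <-].
apply: (le_trans (y := \sum_(i < n) M)); last first.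
  by rewrite sumr_const card_ord.
apply: ler_sum => i _; apply: (le_trans (quad_bound _ (ltW M0) hM)).
by rewrite ger_pMr// (orthosys_sqn_le1 _ he).
Qed.

Lemma family_sum_le_kyfan p n e : positive_op dot p -> orthosys e ->
  family_sum p n e <= kyfan p n.
Proof.
move=> pp he; apply: ub_le_sup; last by exists e.
exact: (kyfan_has_sup n pp).2.
Qed.

Lemma kyfan_le p n c : (forall e, orthosys e -> family_sum p n e <= c) ->
  kyfan p n <= c.
Proof.
move=> h; apply: ge_sup; last by move=> _ [e he <-]; exact: h.
by exists (family_sum p n (fun=> 0)), (fun=> 0); [exact: orthosys0|].
Qed.

Lemma kyfan_ge0 p n : positive_op dot p -> 0 <= kyfan p n.
Proof.
move=> pp; apply: (le_trans _ (family_sum_le_kyfan n pp orthosys0)).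
by apply: sumr_ge0 => i _; exact: quad_ge0.
Qed.

Lemma family_sum_mono p m n e : positive_op dot p -> (m <= n)%N ->
  family_sum p m e <= family_sum p n e.
Proof.
move=> pp /subnK <-; rewrite addnC /family_sum big_split_ord/= lerDl.
by apply: sumr_ge0 => i _; exact: quad_ge0.
Qed.

Lemma kyfan_mono p m n : positive_op dot p -> (m <= n)%N ->
  kyfan p m <= kyfan p n.
Proof.
move=> pp mn; apply: kyfan_le => e he.
exact: (le_trans (family_sum_mono _ pp mn) (family_sum_le_kyfan _ pp he)).
Qed.

Lemma family_sumD p q n e :
  family_sum (p \+ q) n e = family_sum p n e + family_sum q n e.
Proof. by rewrite -big_split; apply: eq_bigr => i _; exact: quadD. Qed.

Lemma positive_opD p q : positive_op dot p -> positive_op dot q ->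
  positive_op dot (p \+ q).
Proof.
move=> [[lp cp] pp] [[lq cq] pq]; split; last first.
  by move=> x; rewrite /= dotDl addr_ge0.
split; last by move=> x; apply: cvgD; [exact: cp|exact: cq].
move=> a x y /=; rewrite lp lq scalerDr !addrA; congr (_ + _).
by rewrite -!addrA; congr (_ + _); rewrite addrC.
Qed.

Lemma positive_opZ (c : R) p : 0 <= c -> positive_op dot p ->
  positive_op dot (fun x => c%:C *: p x).
Proof.
move=> c0 [[lp cp] pp]; split; last by move=> x; rewrite dotZl mulr_ge0// ler0c.
split; last by move=> x; apply: cvgZr; exact: cp.
by move=> a x y; rewrite lp scalerDr !scalerA mulrC.
Qed.

Lemma kyfanD_le p q n : positive_op dot p -> positive_op dot q ->
  kyfan (p \+ q) n <= kyfan p n + kyfan q n.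
Proof.
move=> pp pq; apply: kyfan_le => e he.
by rewrite family_sumD lerD// family_sum_le_kyfan.
Qed.

Lemma kyfanZ (c : R) p n : 0 <= c -> positive_op dot p ->
  kyfan (fun x => c%:C *: p x) n = c * kyfan p n.
Proof.
have sumZ b q e : family_sum (fun x => b%:C *: q x) n e = b * family_sum q n e.
  by rewrite /family_sum mulr_sumr; apply: eq_bigr => i _; rewrite quadZ.
rewrite le_eqVlt => /orP[/eqP<- pp|c0 pp].
  apply/eqP; rewrite eq_le mul0r kyfan_ge0 ?andbT; last exact: positive_opZ.
  by apply: kyfan_le => e he; rewrite sumZ mul0r.
apply/eqP; rewrite eq_le; apply/andP; split.
  by apply: kyfan_le => e he; rewrite sumZ ler_pM2l// family_sum_le_kyfan.
rewrite mulrC -ler_pdivlMr//; apply: kyfan_le => e he; rewrite ler_pdivlMr//.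
rewrite mulrC -sumZ; apply: family_sum_le_kyfan => //.
by apply: positive_opZ => //; exact: ltW.
Qed.

(** Orthonormalize [e] followed by [f] into [g], and [f] followed by [e] into [h]. Both span the
    same space, so [q] has the same trace along either; [g] starts with [e], which serves [p], and
    [h] starts with [f], which serves [q]. *)
Lemma family_sum_pair p q n e f : positive_op dot p -> positive_op dot q ->
  orthosys e -> orthosys f ->
  family_sum p n e + family_sum q n f <= kyfan (p \+ q) n.*2.
Proof.
move=> pp pq he hf.
pose cat (a b : nat -> H) i := if (i < n)%N then a i else
  if (i < n.*2)%N then b (i - n)%N else 0.
have key (a b : nat -> H) : orthosys a -> exists g,
    [/\ orthosys g, (forall k, (k < n.*2)%N -> inspan dot g n.*2 (cat a b k)),
     (forall k, exists c : nat -> R[i], g k = \sum_(j < n.*2) c j *: cat a b j) &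
     forall i, (i < n)%N -> g i = a i].
  move=> ha.
  have [g [g1 g2 g3 g4 g5]] := gram_schmidt hdot (cat a b) n.*2.
  exists g; split=> // i i_n; have nn : (n <= n.*2)%N by rewrite -addnn leq_addr.
  rewrite (g5 n)//; first by rewrite /cat i_n.
    by move=> u v un vn; rewrite /cat un vn; exact: ha.1.
  by move=> u un; rewrite /cat un; exact: ha.2.
have [g [go gs gc ge]] := key e f he.
have [h [ho hs hc hf']] := key f e hf.
(* The two concatenations list the same vectors in a different order; hence the equality of the
   spans. *)
have swap a b k : (k < n.*2)%N -> exists2 l, (l < n.*2)%N & cat a b k = cat b a l.
  move=> k2; have [kn|kn] := ltnP k n.
    exists (k + n)%N; first by rewrite -addnn ltn_add2r.
    by rewrite /cat kn ltnNge leq_addl/= -addnn ltn_add2r kn addnK.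
  have kn2 : (k - n < n)%N by rewrite ltn_subLR// addnn.
  exists (k - n)%N; first by apply: (leq_trans kn2); rewrite -addnn leq_addr.
  by rewrite /cat kn2 ltnNge kn/= k2.
have gh k : (k < n.*2)%N -> inspan dot h n.*2 (g k).
  move=> _; have [c ->] := gc k; apply: inspan_comb => j j2.
  by have [l l2 ->] := swap e f j j2; exact: hs.
have hg k : (k < n.*2)%N -> inspan dot g n.*2 (h k).
  move=> _; have [c ->] := hc k; apply: inspan_comb => j j2.
  by have [l l2 ->] := swap f e j j2; exact: gs.
have qgh : family_sum q n.*2 g = family_sum q n.*2 h.
  rewrite /family_sum -!raddf_sum; congr (Re _).
  by apply: trace_indep => //; exact: pq.1.1.
have nn : (n <= n.*2)%N by rewrite -addnn leq_addr.
apply: le_trans (family_sum_le_kyfan _ (positive_opD pp pq) go).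
rewrite family_sumD qgh; apply: lerD.
  apply: le_trans (family_sum_mono _ pp nn); rewrite le_eqVlt; apply/orP; left.
  by apply/eqP; apply: eq_bigr => i _; rewrite ge.
apply: le_trans (family_sum_mono _ pq nn); rewrite le_eqVlt; apply/orP; left.
by apply/eqP; apply: eq_bigr => i _; rewrite hf'.
Qed.

Lemma kyfanD_ge p q n : positive_op dot p -> positive_op dot q ->
  kyfan p n + kyfan q n <= kyfan (p \+ q) n.*2.
Proof.
move=> pp pq; rewrite -lerBrDr; apply: kyfan_le => e he.
rewrite lerBrDr addrC -lerBrDr; apply: kyfan_le => f hf.
by rewrite lerBrDr addrC; exact: family_sum_pair.
Qed.

(* If x maps e_0, ..., e_(n-1) into the span of g_0, ..., g_(m-1), then
   sum |x e_i|^2 = sum |<e_i, y g_j>|^2 <= sum |y g_j|^2 by Bessel. *)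
Lemma sum_sqn_adjoint (x y : H -> H) n m e g :
  (forall u v, dot (x u) v = dot u (y v)) -> orthosys e -> orthosys g ->
  (forall i, (i < n)%N -> inspan dot g m (x (e i))) ->
  \sum_(i < n) sqn (x (e i)) <= \sum_(j < m) sqn (y (g j)).
Proof.
move=> xy he hg sp.
under eq_bigr => i _ do rewrite (inspan_sqn hg (sp _ (ltn_ord i))).
rewrite exchange_big; apply: ler_sum => j _ /=.
apply: le_trans (bessel hdot n (y (g j)) he).
rewrite le_eqVlt; apply/orP; left; apply/eqP; apply: eq_bigr => i _.
by rewrite xy (dotC dot) csqJ.
Qed.

(** Here [<y x u, u>] is the square norm of [x u] and [<x y u, u>] that of [y u]; orthonormalizing
    the images [x (e i)] provides the family required by [sum_sqn_adjoint]. *)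
Lemma kyfan_adjoint_le (x y : H -> H) n :
  (forall u v, dot (x u) v = dot u (y v)) -> positive_op dot (x \o y) ->
  kyfan (y \o x) n <= kyfan (x \o y) n.
Proof.
move=> xy pp; apply: kyfan_le => e he.
have [g [go _ gs _ _]] := gram_schmidt hdot (fun i => x (e i)) n.
apply: le_trans (family_sum_le_kyfan n pp go).
have -> : family_sum (y \o x) n e = \sum_(i < n) sqn (x (e i)).
  apply: eq_bigr => i _; rewrite /sqnorm xy /quad (dotC dot).
  by case: (dot _ _).
apply: (le_trans (sum_sqn_adjoint xy he go gs)).
rewrite le_eqVlt; apply/orP; left; apply/eqP; apply: eq_bigr => i _.
by rewrite /sqnorm /quad/= xy.
Qed.

Lemma positive_op_self_adjoint_prod (x y : H -> H) : linear x -> linear y ->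
  continuous x -> continuous y ->
  (forall u v, dot (x u) v = dot u (y v)) -> positive_op dot (y \o x).
Proof.
move=> lx ly cx cy xy; split; last first.
  move=> u; have -> : dot ((y \o x) u) u = dot (x u) (x u).
    by rewrite (dotC dot) /= -xy -(dotC dot).
  by rewrite (dotxx hdot) ler0c sqn_ge0.
split=> [a u v /=|u]; first by rewrite lx ly.
by apply: continuous_comp; [exact: cx|exact: cy].
Qed.

Lemma kyfan_adjoint (x : H -> H) n : bounded_op x ->
  kyfan (adjoint dot x \o x) n = kyfan (x \o adjoint dot x) n.
Proof.
move=> [lx cx]; rewrite /adjoint; case: xgetP => [y _ [[ly cy] xy]|_].
  have yx u v : dot (y u) v = dot u (x v) by rewrite (dotC dot) -xy -(dotC dot).
  apply/eqP; rewrite eq_le !kyfan_adjoint_le//;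
    exact: positive_op_self_adjoint_prod.
(* Without an adjoint, [adjoint dot x] is the default zero map, and both products are zero because
   [x] is linear. *)
by congr kyfan; apply/funext => u /=; rewrite lin_zero.
Qed.

(* Polarize <p u, u> >= 0 at u + v and u + i v. *)
Lemma positive_op_sym p u v : positive_op dot p -> dot (p u) v = dot u (p v).
Proof.
move=> pp; have lp := pp.1.1.
have im0 w : Im (dot (p w) w) = 0 by rewrite (quad_le w pp).
have := im0 (u + 'i%C *: v); have := im0 (u + v).
rewrite !(lin_add _ _ lp) !(lin_scale _ _ lp) !dotDl !dotDr !dotZl !dotZr.
rewrite (dotC dot u (p v)) !raddfD/=.
have := im0 u; have := im0 v.
case: (dot (p u) u) (dot (p v) v) (dot (p u) v) (dot (p v) u) =>
  [a a'] [b b'] [c c'] [d d'] /= -> -> h1 h2.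
by congr (_ +i* _); lra.
Qed.

(** A projection is its own adjoint and satisfies [quad p w = sqn (p w)], so [sum_sqn_adjoint] with
    [x = y = p] compares any family with an orthonormalized spanning family of the range. *)
Lemma kyfan_projection p : projection dot p -> finite_rank p ->
  exists m, forall n, kyfan p n <= kyfan p m.
Proof.
move=> [pp pid] [m [e0 hp]]; have sym := positive_op_sym _ _ pp.
pose e i := if insub i is Some j then e0 j else 0.
have [g [go _ gs _ _]] := gram_schmidt hdot e m.
exists m => n; apply: kyfan_le => f hf.
apply: le_trans (family_sum_le_kyfan m pp go).
have quadE w : quad p w = sqn (p w).
  have pw : p w = p (p w) by rewrite -[in LHS]pid.
  by rewrite /quad {1}pw sym.
rewrite /family_sum; under eq_bigr do rewrite quadE.
under [X in _ <= X]eq_bigr do rewrite quadE.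
apply: sum_sqn_adjoint (fun u v => sym u v) hf go _ => i _.
have [c ->] := hp (f i).
have -> : \sum_(i < m) c i *: e0 i =
    \sum_(i < m) (if insub (i : nat) is Some j then c j else 0) *: e i.
  by apply: eq_bigr => j _; rewrite /e valK.
exact: (inspan_comb (fun i => if insub i is Some j then c j else 0)).
Qed.

End KyFan.

(** * Singular traces from averaged functionals *)

Section TraceOfAverages.
Context {R : realType} {H : completeNormedModType R[i]}.
Variable dot : {dot H for Num.conj}.
Hypothesis hdot : induces_norm dot.

Lemma ultra_fmap (T V : Type) (f : T -> V) (F : set_system T) :
  UltraFilter F -> UltraFilter (f @ F).
Proof.
move=> FU; split; first exact: fmap_proper_filter.
move=> G GP FG; apply/seteqP; split=> A GA; last exact: FG.
have [//|nA] := in_ultra_setVsetC (f @^-1` A) FU.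
have /filterI/(_ GA) : G (~` A) by apply: FG.
by rewrite setIC setICr => /filter_not_empty.
Qed.

(** Compactness of [[a, b]] gives the limit; limits along an ultrafilter take the place of Banach
    limits. *)
Lemma ultra_bounded_cvg (T : Type) (F : set_system T) (u : T -> R) (a b : R) :
  UltraFilter F -> (\forall k \near F, a <= u k <= b) -> cvg (u @ F).
Proof.
move=> FU hu; have := @segment_compact R a b.
rewrite compact_ultra => /(_ _ (ultra_fmap u FU)) [].
  by apply: filterS hu => k h; rewrite /= in_itv.
by move=> x [_ ux]; apply/cvg_ex; exists x.
Qed.

(* Averaging over i < k makes the shift phi k i <-> phi k i.+1 immaterial in
   the limit, which turns near-additivity of phi into additivity. *)
Variables (phi : nat -> nat -> (H -> H) -> R) (D : (H -> H) -> Prop).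
Local Notation pos := (positive_op dot).

Hypothesis D_add : forall p q, pos p -> pos q -> D (p \+ q) <-> D p /\ D q.
Hypothesis D_scale : forall (c : R) p, 0 < c -> pos p ->
  D (fun x => c%:C *: p x) <-> D p.
Hypothesis D_adjoint : forall x, bounded_op x ->
  D (adjoint dot x \o x) <-> D (x \o adjoint dot x).
Hypothesis D_zero : D (fun=> 0).

Hypothesis phi_ge0 : forall k i p, pos p -> D p -> 0 <= phi k i p.
Hypothesis phi_mono : forall k i j p, pos p -> D p -> (i <= j)%N ->
  phi k i p <= phi k j p.
Hypothesis phi_sub : forall k i p q, pos p -> pos q -> D p -> D q ->
  (i < k.*2)%N -> phi k i (p \+ q) <= phi k i.+1 p + phi k i.+1 q.
Hypothesis phi_super : forall k i p q, pos p -> pos q -> D p -> D q ->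
  (i < k.*2)%N -> phi k i p + phi k i q <= phi k i.+1 (p \+ q).
Hypothesis phi_scale : forall k i (c : R) p, 0 <= c -> pos p -> D p ->
  phi k i (fun x => c%:C *: p x) = c * phi k i p.
Hypothesis phi_adjoint : forall k i x, bounded_op x ->
  phi k i (adjoint dot x \o x) = phi k i (x \o adjoint dot x).
Hypothesis phi_singular : forall p, projection dot p -> finite_rank p ->
  D p /\ forall e, 0 < e ->
    \forall k \near \oo, forall i, (i <= k.*2)%N -> phi k i p <= e.

Let avg (p : H -> H) (k : nat) : R := (\sum_(i < k) phi k i p) / k%:R.

(** The domain where the trace will be finite. Bounds are asked at [k + i] for every fixed [i],
    since [phi_sub] and [phi_super] each cost one step; only so is [J] stable under sums and under
    passing to summands. *)
Let J p := D p /\ exists C, forall i, \forall k \near \oo, phi k (k + i)%N p <= C.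

Lemma near_lt_double (i : nat) : \forall k \near \oo, (k + i < k.*2)%N.
Proof.
by exists i.+1 => // k /= ik; rewrite -addnn ltn_add2l.
Qed.

Lemma avg_ge0 p k : pos p -> D p -> 0 <= avg p k.
Proof.
move=> pp Dp; apply: divr_ge0; last by [].
by apply: sumr_ge0 => i _; exact: phi_ge0.
Qed.

Lemma avg_le p k C : (forall i, (i < k)%N -> phi k i p <= C) -> 0 <= C ->
  avg p k <= C.
Proof.
move=> h C0; rewrite /avg; case: k h => [|k] h; first by rewrite big_ord0 mul0r.
rewrite ler_pdivrMr// mulr_natr.
apply: (le_trans (y := \sum_(i < k.+1) C)); first by apply: ler_sum => i _; exact: h.
by rewrite sumr_const card_ord.
Qed.

Lemma J_bound p : pos p -> J p ->
  exists2 C, 0 <= C & \forall k \near \oo, phi k k p <= C /\ 0 <= avg p k <= C.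
Proof.
move=> pp [Dp [C hC]]; exists `|C| => //.
have := hC 0%N; apply: filterS => k; rewrite addn0 => hk.
have {}hk : phi k k p <= `|C| by exact: (le_trans hk (ler_norm _)).
split=> //; rewrite avg_ge0//= avg_le// => i ik.
exact: (le_trans (phi_mono _ pp Dp (ltnW ik)) hk).
Qed.

Lemma J_add p q : pos p -> pos q -> J (p \+ q) <-> J p /\ J q.
Proof.
move=> pp pq; split.
  move=> [/(D_add pp pq)[Dp Dq] [C hC]].
  split; (split=> //; exists C => i; have := near_lt_double i;
    apply: filterS2 (hC i.+1) => k; rewrite addnS => hk ik;
    apply: le_trans hk; apply: le_trans (phi_super pp pq Dp Dq ik)).
    by rewrite lerDl phi_ge0.
  by rewrite lerDr phi_ge0.
move=> [[Dp [C hC]] [Dq [C' hC']]]; split; first exact/D_add.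
exists (C + C') => i; have := near_lt_double i.
apply: filterS3 (hC i.+1) (hC' i.+1) => k; rewrite addnS => h h' ik.
by apply: (le_trans (phi_sub pp pq Dp Dq ik)); exact: lerD.
Qed.

(** The sums over [phi k i.+1] and over [phi k i] differ by the boundary terms [phi k k] and
    [phi k 0]. These are controlled by [C], and dividing by [k] makes the error vanish in the
    limit. *)
Lemma avg_diff p q k C : pos p -> pos q -> D p -> D q -> (0 < k)%N ->
  phi k k p + phi k k q <= C -> phi k k (p \+ q) <= C ->
  `|avg (p \+ q) k - (avg p k + avg q k)| <= C / k%:R.
Proof.
move=> pp pq Dp Dq k0 h1 h2.
have Dpq := (D_add pp pq).2 (conj Dp Dq); have ppq := positive_opD pp pq.
have k0' : 0 < k%:R :> R by rewrite ltr0n.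
have shift (u : nat -> R) : \sum_(i < k) u i.+1 = \sum_(i < k) u i + u k - u 0%N.
  by apply/eqP; rewrite -subr_eq opprK addrC -(big_ord_recl k u) big_ord_recr.
rewrite /avg -mulrDl -mulrBl normrM [`|_^-1|]gtr0_norm ?invr_gt0//.
rewrite ler_pM2r ?invr_gt0// ler_norml; apply/andP; split.
  rewrite lerNl opprB lerBlDr.
  apply: (le_trans (y := \sum_(i < k) phi k i.+1 (p \+ q))).
    rewrite -big_split; apply: ler_sum => i _; apply: phi_super => //.
    by rewrite -addnn ltn_addr.
  rewrite (shift (fun i => phi k i (p \+ q))).
  by have := phi_ge0 k 0 ppq Dpq; lra.
rewrite lerBlDr.
apply: (le_trans (y := \sum_(i < k) phi k i.+1 p + \sum_(i < k) phi k i.+1 q)).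
  rewrite -big_split; apply: ler_sum => i _; apply: phi_sub => //.
  by rewrite -addnn ltn_addr.
rewrite (shift (fun i => phi k i p)) (shift (fun i => phi k i q)).
by have := phi_ge0 k 0 pp Dp; have := phi_ge0 k 0 pq Dq; lra.
Qed.

Lemma near_div_le (C e : R) : 0 < e -> \forall k \near \oo, C / k%:R <= e.
Proof.
move=> e0; exists (Num.truncn (`|C| / e)).+1 => // k /= hk.
have k0 : 0 < k%:R :> R by rewrite ltr0n; exact: leq_trans hk.
rewrite ler_pdivrMr// -ler_pdivrMl// mulrC.
have : `|C| / e < k%:R.
  by apply: (lt_le_trans (truncnS_gt _)); rewrite ler_nat.
by move=> /ltW; apply: le_trans; rewrite ler_pM2r ?invr_gt0// ler_norm.
Qed.

(** The trace is the limit of [avg] along an ultrafilter on [J], and [+oo] elsewhere. The bounds [c]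
    and [C] carry over to the averages of [b], hence to its trace. *)
Lemma singular_trace_of_averages b c C : pos b -> D b -> 0 < c ->
  (forall k i, (i <= k.*2)%N -> c <= phi k i b <= C) ->
  exists tau, singular_trace dot tau /\ (0 < tau b < +oo)%E.
Proof.
move=> pb Db c0 hb.
have [U [UU oU]] := ultraFilterLemma eventually_filter.
have UP : ProperFilter U by exact: ultra_proper.
have cvgJ p : pos p -> J p -> cvg (avg p @ U).
  move=> pp /(J_bound pp)[B B0 hB]; apply: (@ultra_bounded_cvg _ _ _ 0 B) => //.
  by apply: oU; apply: filterS hB => k [].
pose L p := lim (avg p @ U).
pose tau p : \bar R := if `[<J p>] then (L p)%:E else +oo%E.
have tauJ p : J p -> tau p = (L p)%:E by move=> Jp; rewrite /tau asboolT.
have tauN p : ~ J p -> tau p = +oo%E by move=> Jp; rewrite /tau asboolF.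
have L0 p : pos p -> J p -> 0 <= L p.
  move=> pp Jp; apply: limr_ge; first exact: cvgJ.
  by apply: nearW => k; apply: avg_ge0 => //; exact: Jp.1.
have tau0 p : pos p -> (0 <= tau p)%E.
  move=> pp; have [Jp|Jp] := pselect (J p); last by rewrite tauN.
  by rewrite tauJ// lee_fin L0.
exists tau; split; last first.
  have Jb : J b.
    split=> //; exists C => i; apply: filterS (near_lt_double i) => k ik.
    by have /andP[] := hb k (k + i)%N (ltnW ik).
  rewrite tauJ// lte_fin ltry andbT; apply: (lt_le_trans c0).
  apply: limr_ge; first exact: cvgJ.
  (* [avg b 0] is 0 by the convention on division, so the lower bound starts at [k = 1]. *)
  apply: oU; exists 1%N => // k /= k0; rewrite ler_pdivlMr ?ltr0n// mulr_natr.
  apply: (le_trans (y := \sum_(i < k) c)); first by rewrite sumr_const card_ord.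
  apply: ler_sum => i _; have /andP[] // : c <= phi k i b <= C.
  by apply: hb; rewrite -addnn ltnW// ltn_addr.
split.
- exact: tau0.
- move=> p q pp pq; have ppq := positive_opD pp pq.
  (* By [J_add] a sum leaves [J] exactly when a summand does, which settles additivity at infinite
     values. *)
  have [Jpq|Jpq] := pselect (J (p \+ q)); last first.
    rewrite tauN//; have [Jp|Jp] := pselect (J p); last first.
      by rewrite tauN// addye// gt_eqF// (lt_le_trans _ (tau0 _ pq)).
    have [Jq|Jq] := pselect (J q); first by exfalso; apply/Jpq/J_add.
    by rewrite (tauN q)// addey// gt_eqF// (lt_le_trans _ (tau0 _ pp)).
  have [Jp Jq] := (J_add pp pq).1 Jpq.
  rewrite !tauJ// -EFinD; congr EFin.
  have [B B0 hB] := J_bound ppq Jpq.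
  have [B1 B10 hB1] := J_bound pp Jp.
  have [B2 B20 hB2] := J_bound pq Jq.
  apply/eqP; rewrite -subr_eq0; apply/eqP.
  have cD : avg p k + avg q k @[k --> U] --> L p + L q.
    by apply: cvgD; exact: cvgJ.
  have cB : avg (p \+ q) k - (avg p k + avg q k) @[k --> U] -->
      L (p \+ q) - (L p + L q).
    by apply: cvgB => //; exact: cvgJ.
  rewrite -(cvg_lim (@norm_hausdorff _ _) cB).
  apply: cvg_lim; first exact: norm_hausdorff.
  apply/cvgr0Pnorm_le => e e0; apply: oU.
  near=> k; have k0 : (0 < k)%N by near: k; exists 1%N.
  have [h _] : phi k k (p \+ q) <= B /\ 0 <= avg (p \+ q) k <= B by near: k.
  have [h1 _] : phi k k p <= B1 /\ 0 <= avg p k <= B1 by near: k.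
  have [h2 _] : phi k k q <= B2 /\ 0 <= avg q k <= B2 by near: k.
  apply: (le_trans (avg_diff (C := B + B1 + B2) pp pq Jp.1 Jq.1 k0 _ _)).
  + lra.
  + lra.
  + by near: k; exact: near_div_le.
- move=> r p; rewrite le_eqVlt => /orP[/eqP<-|r0] pp.
    (* A zero factor is treated apart: [p] may lie outside [J], where the right side is
       [0 * +oo = 0]. That [phi] vanishes at the zero operator is itself homogeneity with factor
       0. *)
    have -> : (fun x => 0%:C *: p x) = (fun=> 0).
      by apply/funext => x; rewrite scale0r.
    have z0 k i : phi k i (fun=> 0) = 0.
      have := @phi_scale k i 0 (fun=> 0) (lexx _).
      have -> : (fun x : H => 0%:C *: 0) = (fun=> 0) :> (H -> H).
        by apply/funext => x; rewrite scaler0.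
      rewrite mul0r; apply=> //.
      have -> : (fun=> 0) = (fun x => 0%:C *: p x).
        by apply/funext => x; rewrite scale0r.
      exact: positive_opZ.
    have Jz : J (fun=> 0).
      by split=> //; exists 0 => i; apply: nearW => k; rewrite z0.
    rewrite tauJ// mul0e; congr EFin.
    rewrite /L; have -> : avg (fun=> 0) = fun=> 0.
      by apply/funext => k; rewrite /avg big1 ?mul0r.
    by apply: cvg_lim; [exact: norm_hausdorff|exact: cvg_cst].
  have Jr : J (fun x => r%:C *: p x) <-> J p.
    split.
      move=> [/(D_scale r0 pp) Dp [B hB]]; split=> //; exists (r^-1 * B) => i.
      apply: filterS (hB i) => k; rewrite (phi_scale _ _ (ltW r0) pp Dp).
      by rewrite -ler_pdivlMl.
    move=> [Dp [B hB]]; split; first exact/D_scale.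
    exists (r * B) => i; apply: filterS (hB i) => k.
    by rewrite (phi_scale _ _ (ltW r0) pp Dp) ler_pM2l.
  have [Jp|Jp] := pselect (J p); last first.
    by rewrite !tauN// ?Jr// gt0_muley// lte_fin.
  rewrite !tauJ// ?Jr// -EFinM; congr EFin.
  rewrite /L; have -> : avg (fun x => r%:C *: p x) = (fun k => r * avg p k).
    apply/funext => k; rewrite /avg mulrA mulr_sumr; congr (_ / _).
    by apply: eq_bigr => i _; rewrite phi_scale// ?ltW//; exact: Jp.1.
  apply: cvg_lim; first exact: norm_hausdorff.
  by apply: cvgMr; exact: cvgJ.
- move=> x bx; rewrite /tau.
  have -> : J (adjoint dot x \o x) = J (x \o adjoint dot x).
    apply/propext; rewrite /J; split=> -[/(D_adjoint bx) Dx [B hB]]; split=> //;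
      exists B => i; apply: filterS (hB i) => k; by rewrite phi_adjoint.
  rewrite /L; have -> // : avg (adjoint dot x \o x) = avg (x \o adjoint dot x).
  apply/funext => k; rewrite /avg; congr (_ / _).
  by apply: eq_bigr => i _; rewrite phi_adjoint.
- move=> p pr fr; have [Dp hp] := phi_singular pr fr.
  have Jp : J p.
    split=> //; exists 1 => i.
    apply: filterS2 (hp 1 ltr01) (near_lt_double i) => k h ik.
    by apply: h; exact: ltnW.
  rewrite tauJ//; congr EFin; apply: cvg_lim; first exact: norm_hausdorff.
  apply/cvgr0Pnorm_le => e e0; apply: oU.
  apply: filterS (hp e e0) => k hk.
  rewrite ger0_norm; last by apply: avg_ge0 => //; exact: pr.1.
  apply: avg_le (ltW e0) => i ik; apply: hk.
  by rewrite -addnn ltnW// ltn_addr.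
Unshelve. all: by end_near. Qed.

End TraceOfAverages.

(** * Diagonal operators *)

Section DiagonalOperators.
Context {R : realType} {H : completeNormedModType R[i]}.
Variable dot : {dot H for Num.conj}.
Hypothesis hdot : induces_norm dot.
Local Notation sqn := (sqnorm dot).

Definition orthonormal_seq (e : nat -> H) :=
  forall i j, dot (e i) (e j) = (i == j)%:R.

Lemma orthonormal_orthosys e : orthonormal_seq e -> orthosys dot e.
Proof.
move=> he; split=> [i j ij|i]; rewrite he ?eqxx; last by right.
by rewrite (negbTE ij).
Qed.

Lemma orthonormal_sqn e i : orthonormal_seq e -> sqn (e i) = 1.
Proof. by move=> he; rewrite /sqnorm he eqxx. Qed.

Definition converges (u : nat -> H) (y : H) :=
  forall eps : R, 0 < eps -> exists N, forall n, (N <= n)%N -> nr (y - u n) < eps.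

Lemma converges_le u y (B : R) : converges u y -> (forall n, nr (u n) <= B) ->
  nr y <= B.
Proof.
move=> uy hB; apply/ler_addgt0Pr => e e0; have [N /(_ _ (leqnn N)) hN] := uy e e0.
rewrite -(subrK (u N) y); apply: (le_trans (nrD _ _)).
by rewrite addrC lerD// ltW.
Qed.

Lemma converges_unique u y z : converges u y -> converges u z -> y = z.
Proof.
move=> uy uz; apply/eqP; rewrite -subr_eq0; apply/eqP/(nr_eq0 hdot)/eqP.
rewrite eq_le nr_ge0 andbT; apply/ler_addgt0Pr => e e0; rewrite add0r.
have [N hN] := uy (e / 2) (divr_gt0 e0 (ltr0n _ 2)).
have [N' hN'] := uz (e / 2) (divr_gt0 e0 (ltr0n _ 2)).
pose m := maxn N N'.
have := hN m (leq_maxl _ _); have := hN' m (leq_maxr _ _) => h1 h2.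
have -> : y - z = (y - u m) + (u m - z) by rewrite addrA subrK.
by apply: (le_trans (nrD _ _)); rewrite (nrB (u m)); lra.
Qed.

Lemma converges_bounded_by (T : H -> H) M u y : linear T -> bounded_by T M ->
  converges u y -> converges (fun n => T (u n)) (T y).
Proof.
move=> lT bT uy e e0; have M0 : 0 < `|M| + 1 by rewrite ltr_wpDl.
have [N hN] := uy (e / (`|M| + 1)) (divr_gt0 e0 M0).
exists N => n /hN hn; rewrite -(lin_sub _ _ lT).
apply: (le_lt_trans (y := (`|M| + 1) * nr (y - u n))).
  apply: (le_trans (bT _)); apply: ler_wpM2r; first exact: nr_ge0.
  by apply: (le_trans (ler_norm _)); rewrite lerDl.
by rewrite mulrC -ltr_pdivlMr.
Qed.

Lemma csq_dot_le x y (r s : R) : nr x <= r -> nr y <= s ->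
  csq (dot x y) <= (r * s) ^+ 2.
Proof.
move=> xr ys; apply: (le_trans (cauchy_schwarz hdot _ _)).
rewrite !(sqnE hdot) -exprMn ler_sqr ?nnegrE ?mulr_ge0 ?nr_ge0//.
- by apply: ler_pM => //; exact: nr_ge0.
- exact: (le_trans (nr_ge0 x)).
- exact: (le_trans (nr_ge0 y)).
Qed.

Lemma csq_small (z : R[i]) : (forall e : R, 0 < e -> csq z <= e) -> z = 0.
Proof.
move=> h; apply: csq_eq0; apply/eqP; rewrite eq_le csq_ge0 andbT.
by apply/ler_addgt0Pr => e e0; rewrite add0r; exact: h.
Qed.

Lemma converges_dot u y z (c : R[i]) : converges u y ->
  (exists N, forall n, (N <= n)%N -> dot (u n) z = c) -> dot y z = c.
Proof.
move=> uy [N0 hN0]; apply/eqP; rewrite -subr_eq0; apply/eqP/csq_small => e e0.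
have e1 : 0 < Num.sqrt e / (nr z + 1).
  by rewrite divr_gt0 ?sqrtr_gt0// ltr_wpDl// nr_ge0.
have [N hN] := uy _ e1; pose m := maxn N N0.
rewrite -(hN0 m) ?leq_maxr// -dotBl.
apply: (le_trans (csq_dot_le (ltW (hN m (leq_maxl _ _))) (s := nr z + 1) _)).
  by rewrite lerDl.
rewrite divfK ?gt_eqF ?ltr_wpDl ?nr_ge0//.
by rewrite sqr_sqrtr// ltW.
Qed.

Definition partial (c : nat -> R[i]) (f : nat -> H) N := \sum_(n < N) c n *: f n.

Lemma sqn_partial (c : nat -> R[i]) f N : orthonormal_seq f ->
  sqn (partial c f N) = \sum_(n < N) csq (c n).
Proof.
move=> hf; rewrite /sqnorm {1}/partial dot_suml raddf_sum; apply: eq_bigr => i _ /=.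
rewrite dotZl dot_sumr (bigD1 i)//= big1 ?addr0.
  by rewrite dotZr hf eqxx mulr1 -csqE.
by move=> j; rewrite -val_eqE /= => ji; rewrite dotZr hf eq_sym (negbTE ji) mulr0.
Qed.

Lemma dot_partial c f N n : orthonormal_seq f -> (n < N)%N ->
  dot (partial c f N) (f n) = c n.
Proof.
move=> hf nN; rewrite dot_suml (bigD1 (Ordinal nN))//= big1 ?addr0.
  by rewrite dotZl hf eqxx mulr1.
by move=> j; rewrite -val_eqE /= => ji; rewrite dotZl hf (negbTE ji) mulr0.
Qed.

(** By Pythagoras the square distance of two partial sums is the difference of two terms of the
    bounded monotone sequence [S], so the partial sums are Cauchy. *)
Lemma partial_converges (c : nat -> R[i]) f (B : R) : orthonormal_seq f ->
  (forall N, \sum_(n < N) csq (c n) <= B) ->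
  exists y, converges (partial c f) y.
Proof.
move=> hf hB; pose S N := \sum_(n < N) csq (c n).
have Sm m n : (m <= n)%N -> S m <= S n.
  move=> /subnK <-; rewrite addnC /S big_split_ord/= lerDl.
  by apply: sumr_ge0 => i _; exact: csq_ge0.
have hs : has_sup (range S).
  by split; [exists (S 0%N), 0%N|exists B => _ [n _ <-]; exact: hB].
have diff m n : (m <= n)%N ->
    sqn (partial c f m - partial c f n) = S n - S m.
  move=> mn; pose c' i := if (i < m)%N then 0 else c i.
  have -> : partial c f m - partial c f n = - partial c' f n.
    rewrite -(subnK mn) addnC /partial !big_split_ord/=.
    rewrite opprD addrA subrr add0r; congr (- _).
    rewrite [X in _ = X + _]big1 ?add0r; last first.
      by move=> i _; rewrite /c' ltn_ord scale0r.
    by apply: eq_bigr => i _; rewrite /c' ltnNge leq_addr.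
  rewrite sqnN sqn_partial// /S -(subnK mn) addnC !big_split_ord/=.
  rewrite big1 ?add0r; last first.
    by move=> i _; rewrite /c' ltn_ord /csq/= expr0n addr0.
  rewrite addrAC subrr add0r.
  by apply: eq_bigr => i _; rewrite /c' ltnNge leq_addr.
have [y hy] : exists y : H, (partial c f n @[n --> \oo]) --> y.
  apply: cauchy_nr => e e0.
  have /(sup_adherent (exprn_gt0 2 e0))[_ [N _ <-] hN] := hs.
  exists (partial c f N); exists N => // n /= Nn.
  have : sqn (partial c f N - partial c f n) < e ^+ 2.
    rewrite diff// ltrBlDr; apply: (le_lt_trans (y := sup (range S))).
      by apply: ub_le_sup; [exact: hs.2|exists n].
    by rewrite addrC -ltrBlDr.
  by rewrite (sqnE hdot) ltr_sqr// nnegrE ?nr_ge0// ltW.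
exists y => e e0; have /cvg_nrP/(_ e e0)[N _ hN] := hy.
by exists N => n Nn; exact: hN.
Qed.

(** The closed span as a double orthogonal complement, which needs no limits of linear
    combinations. *)
Definition in_closed_span (f : nat -> H) y :=
  forall z, (forall n, dot z (f n) = 0) -> dot y z = 0.

(** Coordinates along [f] determine a vector of the closed span. Identities between diagonal
    operators thus reduce to coordinates, without any series. *)
Definition is_sdiag (w : nat -> R) e f x y :=
  (forall n, dot y (f n) = (w n)%:C * dot x (e n)) /\ in_closed_span f y.

(* The operator sum_n w_n <., e_n> f_n. *)
Definition sdiag (w : nat -> R) (e f : nat -> H) (x : H) : H :=
  xget 0 [set y | is_sdiag w e f x y].

Lemma is_sdiag_unique w e f x y z : is_sdiag w e f x y -> is_sdiag w e f x z ->
  y = z.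
Proof.
move=> [y1 y2] [z1 z2]; apply/eqP; rewrite -subr_eq0; apply/eqP/(sqn_eq0 hdot).
have h n : dot (y - z) (f n) = 0 by rewrite dotBl y1 z1 subrr.
by rewrite /sqnorm {1}dotBl y2// z2// subrr.
Qed.

Lemma sdiagE w e f x y : is_sdiag w e f x y -> sdiag w e f x = y.
Proof.
by move=> h; apply: xget_unique => // z /is_sdiag_unique; apply.
Qed.

Definition bounded_weight (w : nat -> R) M := forall n, `|w n| <= M.

Lemma sdiag_full w M e f x : orthonormal_seq e -> orthonormal_seq f ->
  bounded_weight w M ->
  [/\ is_sdiag w e f x (sdiag w e f x), nr (sdiag w e f x) <= M * nr x &
     converges (partial (fun n => (w n)%:C * dot x (e n)) f) (sdiag w e f x)].
Proof.
move=> he hf hw; pose c n := (w n)%:C * dot x (e n).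
have M0 : 0 <= M by exact: le_trans (hw 0%N).
have hB N : \sum_(n < N) csq (c n) <= (M * nr x) ^+ 2.
  apply: (le_trans (y := \sum_(n < N) M ^+ 2 * csq (dot x (e n)))).
    apply: ler_sum => i _; rewrite csqM csqr ler_wpM2r ?csq_ge0//.
    by rewrite -real_normK ?num_real// ler_sqr ?nnegrE.
  rewrite -mulr_sumr exprMn -(sqnE hdot) ler_wpM2l ?sqr_ge0//.
  by apply: bessel => //; exact: orthonormal_orthosys.
have [y hy] := partial_converges hf hB.
have ys : is_sdiag w e f x y.
  split=> [n|z hz].
    apply: (converges_dot hy); exists n.+1 => m nm; exact: dot_partial.
  apply: (converges_dot hy); exists 0%N => m _; rewrite dot_suml big1// => i _.
  by rewrite dotZl (dotC dot) hz conjc0 mulr0.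
rewrite (sdiagE ys); split=> //; apply: (converges_le hy) => n.
by rewrite -(sqn_le hdot) ?sqn_partial// mulr_ge0// nr_ge0.
Qed.

Section Fixed.
Variables (w : nat -> R) (M : R) (e f : nat -> H).
Hypotheses (he : orthonormal_seq e) (hf : orthonormal_seq f).
Hypothesis hw : bounded_weight w M.

Lemma sdiagP x : is_sdiag w e f x (sdiag w e f x).
Proof. by have [] := sdiag_full x he hf hw. Qed.

Lemma dot_sdiag x n : dot (sdiag w e f x) (f n) = (w n)%:C * dot x (e n).
Proof. exact: (sdiagP x).1. Qed.

Lemma sdiag_bounded_by : bounded_by (sdiag w e f) M.
Proof. by move=> x; have [] := sdiag_full x he hf hw. Qed.

Lemma sdiag_converges x :
  converges (partial (fun n => (w n)%:C * dot x (e n)) f) (sdiag w e f x).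
Proof. by have [] := sdiag_full x he hf hw. Qed.

Lemma sdiag_linear : linear (sdiag w e f).
Proof.
move=> a x y; apply: sdiagE; split=> [n|z hz].
  by rewrite dotDl dotZl !dot_sdiag dotDl dotZl mulrDr mulrCA.
by rewrite dotDl dotZl !(sdiagP _).2// mulr0 addr0.
Qed.

Lemma sdiag_bounded_op : bounded_op (sdiag w e f).
Proof. exact: linear_bounded_continuous sdiag_linear sdiag_bounded_by. Qed.

Lemma sdiag_basis n : sdiag w e f (e n) = (w n)%:C *: f n.
Proof.
apply: sdiagE; split=> [m|z hz]; last by rewrite dotZl (dotC dot) hz conjc0 mulr0.
by rewrite dotZl hf he; have [->|_] := eqVneq n m; rewrite ?mulr1 ?mulr0.
Qed.

Lemma sdiag_ker x : (forall n, dot x (e n) = 0) -> sdiag w e f x = 0.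
Proof.
move=> hx; apply: sdiagE; split=> [n|z _]; last by rewrite dot0l.
by rewrite dot0l hx mulr0.
Qed.

End Fixed.

Lemma sdiag_dot w M e f x y : orthonormal_seq e -> orthonormal_seq f ->
  bounded_weight w M -> dot (sdiag w e f x) y = dot x (sdiag w f e y).
Proof.
move=> he hf hw; apply/eqP; rewrite -subr_eq0; apply/eqP.
have hX := sdiag_converges he hf hw x; have hY := sdiag_converges hf he hw y.
set X := sdiag w e f x in hX *; set Y := sdiag w f e y in hY *.
have psum N : dot (partial (fun n => (w n)%:C * dot x (e n)) f N) y =
    dot x (partial (fun n => (w n)%:C * dot y (f n)) e N).
  rewrite dot_suml dot_sumr; apply: eq_bigr => i _.
  by rewrite dotZl dotZr conjcM conjc_real -(dotC dot) mulrAC.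
apply: csq_small => eps eps0.
pose K := nr x + nr y + 1.
have K0 : 0 < K by rewrite ltr_wpDl// addr_ge0// nr_ge0.
(* The identity is exact for partial sums, which leaves two error terms. This radius makes [csq] of
   each at most [eps / 4], and [csq] of a difference is at most twice the sum of the two. *)
have d0 : 0 < Num.sqrt (eps / 4) / K by rewrite divr_gt0// sqrtr_gt0 divr_gt0.
have [N1 h1] := hX _ d0; have [N2 h2] := hY _ d0; pose N := maxn N1 N2.
have {h1} := h1 N (leq_maxl _ _) => /ltW h1.
have {h2} := h2 N (leq_maxr _ _) => /ltW h2.
set XN := partial _ _ _ in h1; set YN := partial _ _ _ in h2.
have -> : dot X y - dot x Y = dot (X - XN) y - dot x (Y - YN).
  by rewrite dotBl dotBr psum; ring.
have xK : nr x <= K by rewrite /K; have := nr_ge0 y; lra.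
have yK : nr y <= K by rewrite /K; have := nr_ge0 x; lra.
have e4 : (Num.sqrt (eps / 4)) ^+ 2 = eps / 4 by rewrite sqr_sqrtr// divr_ge0// ltW.
have := csq_dot_le h1 yK; have := csq_dot_le xK h2.
rewrite [K * _]mulrC divfK ?gt_eqF// e4.
case: (dot (X - XN) y) (dot x (Y - YN)) => [a b] [c d]; rewrite /csq/=.
move=> ? ?; have := sqr_ge0 (a + c); have := sqr_ge0 (b + d); nra.
Qed.

Lemma adjoint_unique (T b : H -> H) : bounded_op b ->
  (forall x y, dot (T x) y = dot x (b y)) -> adjoint dot T = b.
Proof.
move=> bb hb; apply: xget_unique => // c [_ hc]; apply/funext => y.
by apply: dot_ext hdot _ _ _ => z; rewrite (dotC dot) -hc hb -(dotC dot).
Qed.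

Lemma adjoint_sdiag w M e f : orthonormal_seq e -> orthonormal_seq f ->
  bounded_weight w M -> adjoint dot (sdiag w e f) = sdiag w f e.
Proof.
move=> he hf hw; apply: adjoint_unique; first exact: sdiag_bounded_op hw.
by move=> x y; exact: sdiag_dot hw.
Qed.

Lemma sdiag_comp w v M M' e f g : orthonormal_seq e -> orthonormal_seq f ->
  orthonormal_seq g -> bounded_weight w M -> bounded_weight v M' ->
  sdiag w f g \o sdiag v e f = sdiag (fun n => w n * v n) e g.
Proof.
move=> he hf hg hw hv; apply/funext => x /=; apply/esym/sdiagE.
split; last exact: (sdiagP hf hg hw _).2.
by move=> n; rewrite (dot_sdiag hf hg hw) (dot_sdiag he hf hv) mulrA rmorphM.
Qed.

Lemma sdiag_add w v M M' e f : orthonormal_seq e -> orthonormal_seq f ->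
  bounded_weight w M -> bounded_weight v M' ->
  sdiag (fun n => w n + v n) e f = sdiag w e f \+ sdiag v e f.
Proof.
move=> he hf hw hv; apply/funext => x /=; apply: sdiagE; split=> [n|z hz].
  by rewrite dotDl (dot_sdiag he hf hw) (dot_sdiag he hf hv) rmorphD/= mulrDl.
by rewrite dotDl (sdiagP he hf hw _).2// (sdiagP he hf hv _).2// addr0.
Qed.

Lemma sdiag_scale w M (c : R) e f : orthonormal_seq e -> orthonormal_seq f ->
  bounded_weight w M ->
  sdiag (fun n => c * w n) e f = (fun x => c%:C *: sdiag w e f x).
Proof.
move=> he hf hw; apply/funext => x /=; apply: sdiagE; split=> [n|z hz].
  by rewrite dotZl (dot_sdiag he hf hw) rmorphM/= mulrA.
by rewrite dotZl (sdiagP he hf hw _).2// mulr0.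
Qed.

Lemma bounded_weight_sqrt w M : bounded_weight w M ->
  bounded_weight (fun n => Num.sqrt (w n)) (Num.sqrt M).
Proof.
move=> hw n; rewrite ger0_norm ?sqrtr_ge0// ler_wsqrtr//.
exact: (le_trans (ler_norm _)).
Qed.

(** The middle sequence [f] is free. With [f = e] this gives positivity; with another [f] it writes
    the operators along [e] and along [f] as the two products of one operator and its adjoint. *)
Lemma sdiag_sqrt w M e f : (forall n, 0 <= w n) -> orthonormal_seq e ->
  orthonormal_seq f -> bounded_weight w M ->
  sdiag w e e = sdiag (fun n => Num.sqrt (w n)) f e \o
                sdiag (fun n => Num.sqrt (w n)) e f.
Proof.
move=> w0 he hf hw; have hs := bounded_weight_sqrt hw.
rewrite (sdiag_comp he hf he hs hs); congr (sdiag _ _ _); apply/funext => n.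
by rewrite -expr2 sqr_sqrtr.
Qed.

Lemma sdiag_positive w M e : (forall n, 0 <= w n) -> orthonormal_seq e ->
  bounded_weight w M -> positive_op dot (sdiag w e e).
Proof.
move=> w0 he hw; split; first exact: sdiag_bounded_op hw.
have hs := bounded_weight_sqrt hw.
move=> x; rewrite (sdiag_sqrt w0 he he hw) /= (sdiag_dot _ _ he he hs).
by rewrite (dotxx hdot) ler0c sqn_ge0.
Qed.

Lemma sdiag_one_orth e x n : orthonormal_seq e ->
  dot (x - sdiag (fun=> 1) e e x) (e n) = 0.
Proof.
move=> he; rewrite dotBl (@dot_sdiag _ 1)// ?mul1r ?subrr//.
by move=> m; rewrite normr1.
Qed.

(** [T] does not see the part of [x] orthogonal to all [e n]; on the remaining part it acts termwise
    on the partial sums, by boundedness. *)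
Lemma bounded_op_eq_sdiag (T : H -> H) w M e f : bounded_op T ->
  orthonormal_seq e -> orthonormal_seq f -> bounded_weight w M ->
  (forall n, T (e n) = (w n)%:C *: f n) ->
  (forall x, (forall n, dot x (e n) = 0) -> T x = 0) ->
  T = sdiag w e f.
Proof.
move=> bT he hf hw Te Tk; apply/funext => x; have lT := bT.1.
have [B _ hB] := bounded_op_bound hdot bT.
have one : bounded_weight (fun=> 1) 1 by move=> m; rewrite normr1.
have -> : T x = T (sdiag (fun=> 1) e e x).
  apply/eqP; rewrite -subr_eq0 -(lin_sub _ _ lT); apply/eqP/Tk => n.
  exact: sdiag_one_orth.
have := converges_bounded_by lT hB (sdiag_converges he he one x).
have -> : (fun N => T (partial (fun n => 1%:C * dot x (e n)) e N)) =
          partial (fun n => (w n)%:C * dot x (e n)) f.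
  apply/funext => N; rewrite /partial (lin_sum _ _ _ lT); apply: eq_bigr => i _.
  by rewrite (lin_scale _ _ lT) Te scalerA mul1r mulrC.
by move=> /converges_unique; apply; exact: sdiag_converges hw _.
Qed.

Lemma sdiag_finite w M e n x : orthonormal_seq e -> bounded_weight w M ->
  (forall k, (n <= k)%N -> w k = 0) ->
  sdiag w e e x = partial (fun k => (w k)%:C * dot x (e k)) e n.
Proof.
move=> he hw w0; apply: sdiagE; split=> [m|z hz].
  have [mn|nm] := ltnP m n; first by rewrite dot_partial.
  rewrite w0// mul0r dot_suml big1// => i _; rewrite dotZl he.
  by rewrite (ltn_eqF (leq_trans (ltn_ord i) nm)) mulr0.
rewrite dot_suml big1// => i _.
by rewrite dotZl (dotC dot (e i)) hz conjc0 mulr0.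
Qed.

(* Upper bound: sdiag w <= w_n + sum_(k < n) (w_k - w_n) <., e_k> e_k. *)
Lemma kyfan_sdiag (w : nat -> R) e n : orthonormal_seq e -> (forall k, 0 <= w k) ->
  nonincreasing_seq w -> kyfan dot (sdiag w e e) n = \sum_(k < n) w k.
Proof.
move=> he w0 wd.
have hw : bounded_weight w (w 0%N) by move=> k; rewrite ger0_norm// wd.
have pp := sdiag_positive w0 he hw.
apply/eqP; rewrite eq_le; apply/andP; split; last first.
  apply: le_trans (family_sum_le_kyfan hdot n pp (orthonormal_orthosys he)).
  apply: ler_sum => i _.
  by rewrite /quad (sdiag_basis _ he he) dotZl he eqxx mulr1.
apply: kyfan_le => g hg.
pose u k := if (k < n)%N then w n else w k.
pose v k := if (k < n)%N then w k - w n else 0.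
have hu : bounded_weight u (w n).
  move=> k; rewrite /u; case: ltnP => nk; rewrite ger0_norm//.
  by rewrite wd.
have v0 k : 0 <= v k by rewrite /v; case: ltnP => // kn; rewrite subr_ge0 wd// ltnW.
have hv : bounded_weight v (w 0%N).
  move=> k; rewrite ger0_norm// /v; case: ltnP => // _.
  by rewrite lerBlDr -[leLHS]addr0 lerD// wd.
have wE : sdiag w e e = sdiag u e e \+ sdiag v e e.
  rewrite -(sdiag_add he he hu hv); congr (sdiag _ _ _); apply/funext => k.
  by rewrite /u /v; case: ltnP; rewrite ?addr0// addrC subrK.
rewrite wE family_sumD.
have vE x : quad dot (sdiag v e e) x = \sum_(k < n) v k * csq (dot x (e k)).
  rewrite /quad (@sdiag_finite _ _ _ n _ he hv) => [|k nk]; last first.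
    by rewrite /v ltnNge nk.
  rewrite dot_suml raddf_sum; apply: eq_bigr => k _ /=.
  rewrite dotZl (dotC dot (e k)) -mulrA -csqE.
  by rewrite -rmorphM.
have : family_sum dot (sdiag u e e) n g <= \sum_(k < n) w n.
  apply: ler_sum => i _.
  apply: (le_trans (quad_bound hdot _ (w0 n) (sdiag_bounded_by he he hu))).
  by rewrite ler_piMr// (orthosys_sqn_le1 _ hg).
have : family_sum dot (sdiag v e e) n g <= \sum_(k < n) v k.
  rewrite /family_sum; under eq_bigr do rewrite vE.
  rewrite exchange_big; apply: ler_sum => k _ /=.
  rewrite -mulr_sumr ler_piMr//.
  apply: (le_trans (y := \sum_(i < n) csq (dot (e k) (g i)))).
    by apply: ler_sum => i _; rewrite (dotC dot) csqJ.
  by rewrite -(orthonormal_sqn k he); exact: bessel.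
move=> h1 h2; rewrite addrC; apply: (le_trans (lerD h1 h2)).
rewrite -big_split; apply: ler_sum => k _ /=.
by rewrite /v ltn_ord subrK.
Qed.

(* (p + s_n)(p - s_n) kills e_n, and p + s_n is injective as p >= 0 < s_n. *)
Lemma sqrt_sdiag_unique p s M e : positive_op dot p -> orthonormal_seq e ->
  (forall n, 0 < s n) -> bounded_weight s M ->
  p \o p = sdiag s e e \o sdiag s e e -> p = sdiag s e e.
Proof.
move=> pp he s0 hs pE; have lp := pp.1.1; have sym := positive_op_sym _ _ pp.
have pE' x : p (p x) = sdiag s e e (sdiag s e e x).
  by have := congr1 (fun h => h x) pE.
have ls := sdiag_linear he he hs.
have pen n : p (e n) = (s n)%:C *: e n.
  pose v := p (e n) - (s n)%:C *: e n.
  have pv : p v = - ((s n)%:C *: v).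
    rewrite /v (lin_sub _ _ lp) (lin_scale _ _ lp) pE' (sdiag_basis _ he he).
    by rewrite (lin_scale _ _ ls) (sdiag_basis _ he he) scalerBr opprB.
  have := quad_ge0 v pp; rewrite /quad pv dotNl dotZl (dotxx hdot) -rmorphM/=.
  rewrite oppr_ge0 pmulr_rle0// => h.
  apply/eqP; rewrite -subr_eq0; apply/eqP/(sqn_eq0 hdot)/eqP.
  by rewrite eq_le h sqn_ge0.
apply/funext => x; apply/esym/sdiagE; split=> [n|z hz].
  by rewrite sym pen dotZr conjc_real.
rewrite sym; suff -> : p z = 0 by rewrite dot0r.
apply/(sqn_eq0 hdot); rewrite /sqnorm sym pE' !(sdiag_ker _ _ hz).
by rewrite (lin_zero ls) dot0r.
Qed.

Lemma modulus_sdiag s M e f : orthonormal_seq e -> orthonormal_seq f ->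
  (forall n, 0 < s n) -> bounded_weight s M ->
  modulus dot (sdiag s e f) = sdiag s e e.
Proof.
move=> he hf s0 hs.
have E : adjoint dot (sdiag s e f) \o sdiag s e f = sdiag s e e \o sdiag s e e.
  by rewrite (adjoint_sdiag he hf hs) (sdiag_comp he hf he hs hs)
     (sdiag_comp he he he hs hs).
apply: xget_unique; rewrite /= E.
  by split=> //; apply: sdiag_positive hs => // n; exact: ltW.
by move=> p [pp pE]; exact: sqrt_sdiag_unique hs pE.
Qed.

(** An eigenvector for [lambda] has coordinates only where [s n = lambda], and for [lambda <> 0] it
    lies in the closed span, being a multiple of its image. For [lambda = 0] one needs
    [0 ^ alpha = 0], hence [alpha > 0]. Uniqueness tests the [e n] and the vectors orthogonal to all
    of them. *)
Lemma op_power_sdiag s M e alpha : orthonormal_seq e -> (forall n, 0 < s n) ->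
  bounded_weight s M -> 0 < alpha ->
  op_power (sdiag s e e) alpha = sdiag (fun n => s n `^ alpha) e e.
Proof.
move=> he s0 hs a0.
have hsa : bounded_weight (fun n => s n `^ alpha) (M `^ alpha).
  move=> n; rewrite ger0_norm ?powR_ge0//; apply: ge0_ler_powR.
  - exact: ltW.
  - by rewrite nnegrE ltW.
  - by rewrite nnegrE; exact: (le_trans (normr_ge0 _) (hs n)).
  - exact: (le_trans (ler_norm _) (hs n)).
apply: xget_unique.
  split; first exact: sdiag_bounded_op hsa.
  move=> lambda v hv.
  have vn n : (s n - lambda)%:C * dot v (e n) = 0.
    by rewrite rmorphB mulrBl -(dot_sdiag he he hs) hv dotZl subrr.
  have vn' n : s n = lambda \/ dot v (e n) = 0.
    have /eqP := vn n; rewrite mulf_eq0 => /orP[/eqP|/eqP]; last by right.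
    by move=> /complexI/eqP; rewrite subr_eq0 => /eqP; left.
  apply: sdiagE; split=> [n|z hz].
    by rewrite dotZl; case: (vn' n) => [->//|->]; rewrite !mulr0.
  rewrite dotZl; have [l0|l0] := eqVneq lambda 0.
    by rewrite l0 powR0 ?mul0r// gt_eqF.
  suff -> : dot v z = 0 by rewrite mulr0.
  have /eqP : lambda%:C * dot v z = 0 by rewrite -dotZl -hv (sdiagP he he hs _).2.
  rewrite mulf_eq0 => /orP[/eqP/complexI l00|/eqP//].
  by rewrite l00 eqxx in l0.
move=> b [bb hb]; apply: (bounded_op_eq_sdiag bb he he hsa) => [n|x hx].
  by apply: hb; exact: (sdiag_basis _ he he).
have /hb -> : sdiag s e e x = 0%:C *: x by rewrite scale0r (sdiag_ker _ _ hx).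
by rewrite powR0 ?scale0r// gt_eqF.
Qed.

End DiagonalOperators.

(** * Singular value decomposition *)

Section CompactOperators.
Context {R : realType} {H : completeNormedModType R[i]}.
Variable dot : {dot H for Num.conj}.
Hypothesis hdot : induces_norm dot.
Local Notation sqn := (sqnorm dot).
Local Notation orthonormal_seq := (orthonormal_seq dot).
Local Notation sdiag := (sdiag dot).

(** An ultrafilter refining [\oo] replaces the extraction of a convergent subsequence. *)
Lemma compact_ultra_cluster (A : set H) (u : nat -> H) : compact A ->
  (forall n, A (u n)) -> exists U : set_system nat, UltraFilter U /\
    \oo `<=` U /\ exists y, forall eps, 0 < eps -> \forall n \near U, nr (y - u n) < eps.
Proof.
move=> cA uA; have [U [UU oU]] := ultraFilterLemma eventually_filter.
exists U; split=> //; split=> //; move: cA; rewrite compact_ultra.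
move=> /(_ _ (ultra_fmap u UU)) []; first by apply: (@filterS _ U _ setT) => [n _|]; [exact: uA|exact: filterT].
by move=> y [_ /cvg_nrP uy]; exists y => eps /uy.
Qed.

Variable a : H -> H.
Hypothesis ca : compact_op a.
Let la : linear a := ca.1.

Lemma compact_ultra_image (z : nat -> H) : (forall n, nr (z n) <= 1) ->
  exists U : set_system nat, UltraFilter U /\
    \oo `<=` U /\ exists y, forall eps, 0 < eps ->
      \forall n \near U, nr (y - a (z n)) < eps.
Proof.
move=> z1; apply: compact_ultra_cluster ca.2 _ => n.
by apply: subset_closure; exists (z n) => //=; rewrite normE lecR.
Qed.

Lemma compact_bounded_by : exists M, bounded_by a M.
Proof.
apply: contrapT => nb.
have /choice[z hz] : forall n : nat, exists z, nr z <= 1 /\ n%:R < nr (a z).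
  move=> n; apply: contrapT => hn; apply: nb; exists n%:R => x.
  rewrite leNgt; apply/negP => hx; apply: hn.
  have x0 : 0 < nr x.
    rewrite lt_def nr_ge0 andbT; apply/eqP => x0.
    by move: hx; rewrite (nr_eq0 hdot x0) (lin_zero la) !nr0 mulr0 ltxx.
  exists ((nr x)^-1%:C *: x); rewrite (lin_scale _ _ la) !(nrZ hdot) csqr.
  rewrite sqrtr_sqr ger0_norm ?invr_ge0 ?nr_ge0// mulVf ?gt_eqF//; split=> //.
  by rewrite mulrC ltr_pdivlMr.
have [U [UU [oU [y hy]]]] := compact_ultra_image (fun n => (hz n).1).
have UP : ProperFilter U by exact: ultra_proper.
have h2 : \forall n \near U, nr y + 1 < n%:R.
  apply: oU; exists (Num.truncn (nr y + 1)).+1 => // n /= hn.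
  by apply: (lt_le_trans (truncnS_gt _)); rewrite ler_nat.
have [n [h3 h4]] := filter_ex (filterI (hy 1 ltr01) h2).
have := (hz n).2; have := nrD (a (z n) - y) y; rewrite subrK nrB.
by move: h3 h4 => /=; lra.
Qed.

Lemma compact_op_bounded : bounded_op a.
Proof. by have [M hM] := compact_bounded_by; exact: linear_bounded_continuous hM. Qed.

Definition maximizes (V : set H) x :=
  [/\ V x, nr x = 1, 0 < nr (a x) & forall z, V z -> nr (a z) <= nr (a x) * nr z].

Definition perp (l : seq H) : set H := [set z | forall v, v \in l -> dot z v = 0].

Lemma perpD l x y : perp l x -> perp l y -> perp l (x + y).
Proof. by move=> hx hy v vl; rewrite dotDl hx// hy// addr0. Qed.

Lemma perpZ l (c : R[i]) x : perp l x -> perp l (c *: x).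
Proof. by move=> hx v vl; rewrite dotZl hx// mulr0. Qed.

(* A maximizing sequence z_n such that a z_n converges is Cauchy: z_n + z_m
   is nearly of norm 2 since a (z_n + z_m) is nearly of norm 2 |a|, so the
   parallelogram identity makes z_n - z_m small. *)
Lemma maximizer_exists l : (exists2 z, perp l z & a z <> 0) ->
  exists x, maximizes (perp l) x.
Proof.
move=> [z0 z0l az0]; have [M hM] := compact_bounded_by.
have nrZr (r : R) x : 0 <= r -> nr (r%:C *: x : H) = r * nr x.
  by move=> r0; rewrite (nrZ hdot) csqr sqrtr_sqr ger0_norm.
pose S := [set nr (a z) | z in [set z | perp l z /\ nr z <= 1]].
have S0 : S 0.
  exists 0; last by rewrite (lin_zero la) nr0.
  by split; [move=> v _; rewrite dot0l|rewrite nr0 ler01].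
have hS : has_sup S.
  split; first by exists 0.
  exists `|M| => _ [z [_ z1] <-]; apply: (le_trans (hM z)).
  apply: (le_trans (y := `|M| * nr z)); last by rewrite ler_piMr.
  by apply: ler_wpM2r; [exact: nr_ge0|exact: ler_norm].
pose c := sup S.
have c0' : 0 <= c by apply: ub_le_sup => //; exact: hS.2.
have cle z : perp l z -> nr (a z) <= c * nr z.
  move=> zl; have [z0'|z0'] := eqVneq (nr z) 0.
    by rewrite (nr_eq0 hdot z0') (lin_zero la) !nr0 mulr0.
  have zp : 0 < nr z by rewrite lt_def z0' nr_ge0.
  rewrite -ler_pdivrMr// mulrC -nrZr ?invr_ge0 ?nr_ge0// -(lin_scale _ _ la).
  apply: ub_le_sup; first exact: hS.2.
  exists ((nr z)^-1%:C *: z) => //; split; first exact: perpZ.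
  by rewrite nrZr ?invr_ge0 ?nr_ge0// mulVf.
have c0 : 0 < c.
  rewrite lt_def c0' andbT; apply/eqP => cz; apply: az0.
  apply: (nr_eq0 hdot); apply/eqP; rewrite eq_le nr_ge0 andbT.
  by have := cle _ z0l; rewrite cz mul0r.
have /choice[z hz] : forall n : nat, exists z,
    [/\ perp l z, nr z <= 1 & c - n.+1%:R^-1 < nr (a z)].
  move=> n; have n0 : 0 < n.+1%:R^-1 :> R by rewrite invr_gt0.
  have [_ [z [zl z1] <-] hz] := sup_adherent n0 hS.
  by exists z.
have z1 n : nr (z n) <= 1 by have [] := hz n.
have zl n : perp l (z n) by have [] := hz n.
have [U [UU [oU [y hy]]]] := compact_ultra_image z1.
have UP : ProperFilter U by exact: ultra_proper.
have hmax d : 0 < d -> \forall n \near U, c - d < nr (a (z n)).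
  move=> d0; apply: oU; exists (Num.truncn d^-1).+1 => // n /= hn.
  have [_ _] := hz n; apply: le_lt_trans; rewrite lerD2l lerN2.
  rewrite -[leRHS]invrK lef_pV2 ?posrE ?invr_gt0//.
  apply: ltW; apply: (lt_le_trans (truncnS_gt _)).
  by rewrite ler_nat; exact: (leq_trans hn).
have near_d d : 0 < d -> d < c / 2 -> \forall n \near U, forall m,
    (nr (y - a (z m)) < d) -> (c - d < nr (a (z m))) ->
    sqn (z m - z n) <= 16 * d / c.
  move=> d0 dc; apply: filterS2 (hmax d d0) (hy d d0) => n h1 h2 m h3 h4.
  have h5 : 2 * c - 4 * d <= nr (a (z m + z n)).
    have -> : a (z m + z n) = a (z m) + a (z m) - (a (z m) - a (z n)).
      by rewrite (lin_add _ _ la) opprB addrACA subrr addr0.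
    have t1 : nr (a (z m) - a (z n)) <= 2 * d.
      have -> : a (z m) - a (z n) = (a (z m) - y) + (y - a (z n)).
        by rewrite addrA subrK.
      by apply: (le_trans (nrD _ _)); rewrite (nrB (a (z m))); lra.
    have t2 : nr (a (z m) + a (z m)) = 2 * nr (a (z m)).
      have -> : a (z m) + a (z m) = 2%:R%:C *: a (z m).
        by rewrite rmorph_nat scaler_nat mulr2n.
      by rewrite nrZr.
    have := nrD (a (z m) + a (z m) - (a (z m) - a (z n))) (a (z m) - a (z n)).
    by rewrite subrK; lra.
  have h6 : 2 - 4 * d / c <= nr (z m + z n).
    have := le_trans h5 (cle _ (perpD (zl m) (zl n))).
    rewrite -ler_pdivrMl// => /(le_trans _); apply.
    by rewrite le_eqVlt; apply/orP; left; apply/eqP; field; rewrite gt_eqF.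
  have := parallelogram dot (z m) (z n); rewrite !(sqnE hdot) => par.
  have q1 : nr (z m) ^+ 2 <= 1 by rewrite expr_le1 ?nr_ge0.
  have q2 : nr (z n) ^+ 2 <= 1 by rewrite expr_le1 ?nr_ge0.
  have t0 : 0 <= 2 - 4 * d / c.
    by rewrite subr_ge0 ler_pdivrMr//; lra.
  have q3 : (2 - 4 * d / c) ^+ 2 <= nr (z m + z n) ^+ 2.
    by rewrite ler_sqr ?nnegrE ?nr_ge0.
  have -> : 16 * d / c = 4 * (4 * d / c) by field; rewrite gt_eqF.
  set k := 4 * d / c in q3 *.
  by have := sqr_ge0 k; move: q3; rewrite sqrrB; lra.
have [x hx] : exists x : H, z @ U --> x.
  apply: cauchy_nr => e e0.
  (* The first bound ensures [d < c / 2], the second [16 d / c <= e^2 / 2 < e^2]. *)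
  pose d := Num.min (c / 4) (e ^+ 2 * c / 32).
  have d0 : 0 < d by rewrite lt_min !divr_gt0// mulr_gt0// exprn_gt0.
  have dc : d < c / 2 by rewrite gt_min; apply/orP; left; lra.
  have [m [m1 m2]] := filter_ex (filterI (hy d d0) (hmax d d0)).
  exists (z m); apply: filterS (near_d d d0 dc) => n /(_ m m1 m2) hn.
  rewrite /= -(@ltr_sqr R) ?nnegrE ?nr_ge0 ?(ltW e0)// -(sqnE hdot).
  apply: (le_lt_trans hn).
  have : d <= e ^+ 2 * c / 32 by rewrite ge_min lexx orbT.
  rewrite ltr_pdivrMr// => hd; have : 0 < e ^+ 2 * c by rewrite mulr_gt0// exprn_gt0.
  by lra.
have {}hx e : 0 < e -> \forall n \near U, nr (x - z n) < e.
  by move=> e0; move/cvg_nrP : hx => /(_ e e0).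
have xl : perp l x.
  move=> v vl; apply: (csq_small) => e e0.
  have d0 : 0 < Num.sqrt e / (nr v + 1).
    by rewrite divr_gt0 ?sqrtr_gt0// ltr_wpDl// nr_ge0.
  have [n /= hn] := filter_ex (hx _ d0).
  have -> : dot x v = dot (x - z n) v by rewrite dotBl (zl n)// subr0.
  apply: (le_trans (csq_dot_le hdot (ltW hn) (s := nr v + 1) _)).
    by rewrite lerDl.
  by rewrite divfK ?gt_eqF ?ltr_wpDl ?nr_ge0// sqr_sqrtr// ltW.
have x1 : nr x <= 1.
  apply/ler_addgt0Pr => e e0; have [n /= hn] := filter_ex (hx e e0).
  have := nrD (x - z n) (z n); rewrite subrK; have := z1 n; lra.
have acx : c <= nr (a x).
  apply/ler_addgt0Pr => e e0.
  have M0 : 0 < `|M| + 1 by rewrite ltr_wpDl.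
  have d0 : 0 < e / 2 / (`|M| + 1) by rewrite !divr_gt0.
  have e2 : 0 < e / 2 by rewrite divr_gt0.
  have [n [/= n1 n2]] := filter_ex (filterI (hx _ d0) (hmax _ e2)).
  have := nrD (a (z n) - a x) (a x); rewrite subrK nrB -(lin_sub _ _ la).
  have : nr (a (x - z n)) <= e / 2.
    apply: (le_trans (hM _)).
    apply: (le_trans (y := (`|M| + 1) * nr (x - z n))).
      apply: ler_wpM2r; first exact: nr_ge0.
      by apply: (le_trans (ler_norm _)); rewrite lerDl.
    by rewrite mulrC -ler_pdivlMr// ltW.
  by lra.
have acE : nr (a x) = c.
  apply/eqP; rewrite eq_le acx andbT; apply: (le_trans (cle _ xl)).
  by rewrite ler_piMr// ltW.
exists x; split=> //; last by rewrite acE.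
- apply/eqP; rewrite eq_le x1/= -(ler_pM2l c0) mulr1.
  by apply: (le_trans acx); exact: cle.
- by rewrite acE.
Qed.

(** First variation at the maximum: moving [x] by [t z] with [t = r D^*] would increase the square
    norm of the image by [2 r csq D] to first order, while the allowed increase is of order [r^2].
    The orthogonality of the images is thus obtained without the adjoint of [a]. *)
Lemma maximizer_orth l x z : maximizes (perp l) x -> perp l z -> dot z x = 0 ->
  dot (a z) (a x) = 0.
Proof.
move=> [xl x1 ax xmax] zl zx; apply: csq_eq0.
set D := dot (a z) (a x).
have key (r : R) : 0 < r -> 2 * csq D <= r * csq D * (nr (a x) ^+ 2 * sqn z).
  move=> r0; pose t := r%:C * D^*%C.
  have := xmax (x + t *: z) (perpD xl (perpZ t zl)).
  rewrite -(@ler_sqr R) ?nnegrE ?mulr_ge0 ?nr_ge0// exprMn -!(sqnE hdot).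
  rewrite (lin_add _ _ la) (lin_scale _ _ la) !sqnD !sqnZ// !dotZr.
  rewrite (dotC dot x z) zx conjc0 mulr0 (dotC dot (a x)) -/D -conjcM.
  have -> : t * D = (r * csq D)%:C by rewrite -mulrA [_ * D]mulrC -csqE rmorphM.
  rewrite conjc_real /t csqM csqJ csqr (sqnE hdot (a z)) (sqnE hdot x) x1.
  rewrite (sqnE hdot (a x)) /= => h.
  have : 2 * csq D * r <= r * csq D * (nr (a x) ^+ 2 * sqn z) * r.
    have : 0 <= r ^+ 2 * csq D * nr (a z) ^+ 2.
      by rewrite mulr_ge0 ?sqr_ge0// mulr_ge0 ?sqr_ge0 ?csq_ge0.
    by move: h; nra.
  by rewrite ler_pM2r.
apply/eqP; rewrite eq_le csq_ge0 andbT leNgt; apply/negP => D0.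
pose K := nr (a x) ^+ 2 * sqn z.
have K0 : 0 <= K by rewrite mulr_ge0 ?sqr_ge0 ?sqn_ge0.
have := key (K + 1)^-1; rewrite invr_gt0 ltr_wpDl// => /(_ isT).
rewrite -/K mulrAC [_ * K]mulrC ler_pM2r// ler_pdivlMr ?ltr_wpDl//; lra.
Qed.

(** * Singular vectors and singular values of a compact operator of infinite rank *)

Hypothesis a_rank : ~ finite_rank a.

(** Each choice depends on all earlier vectors, so the recursion carries their list; [svec n] is the
    head of [svec_list n.+1]. *)
Fixpoint svec_list (n : nat) : seq H :=
  if n is m.+1 then
    xget 0 [set x | maximizes (perp (svec_list m)) x] :: svec_list m
  else [::].

Definition svec n := xget 0 [set x | maximizes (perp (svec_list n)) x].

Lemma mem_svec_list n v :
  reflect (exists2 i, (i < n)%N & v = svec i) (v \in svec_list n).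
Proof.
elim: n => [|n IH]; first by apply: (iffP idP) => // -[].
rewrite /= in_cons; apply: (iffP orP).
  case=> [/eqP->|/IH [i i_n ->]]; first by exists n.
  by exists i => //; exact: ltnW.
- case=> i; rewrite ltnS leq_eqVlt => /orP[/eqP-> ->|i_n vE]; first by left.
  by right; apply/IH; exists i.
Qed.

Lemma perp_svecP n z :
  perp (svec_list n) z <-> forall i, (i < n)%N -> dot z (svec i) = 0.
Proof.
split=> h; first by move=> i i_n; apply: h; apply/mem_svec_list; exists i.
by move=> v /mem_svec_list[i i_n ->]; exact: h.
Qed.

(** Infinite rank enters here: if [a] vanished on the complement of the first [n] vectors, then
    [a x] would always be a combination of their images. *)
Lemma svec_max n : maximizes (perp (svec_list n)) (svec n).
Proof.
elim/ltn_ind : n => n IH.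
have so i j : (i < n)%N -> (j < n)%N -> dot (svec i) (svec j) = (i == j)%:R.
  have lt_case u v : (u < n)%N -> (v < u)%N -> dot (svec u) (svec v) = 0.
    by move=> un vu; have [/perp_svecP h _ _ _] := IH u un; exact: h.
  move=> i_n jn; have [ij|ji|<-] := ltngtP i j.
  - by rewrite (dotC dot) lt_case// conjc0.
  - exact: lt_case.
  - by rewrite (dotxx hdot) (sqnE hdot); have [_ -> _ _] := IH i i_n; rewrite expr1n.
apply: xgetPex; apply: maximizer_exists; apply: contrapT => hn.
apply: a_rank; exists n, (fun i : 'I_n => a (svec i)) => x.
exists (fun i => dot x (svec i)); apply/eqP; rewrite -subr_eq0.
have -> : \sum_(i < n) dot x (svec i) *: a (svec i) =
    a (\sum_(i < n) dot x (svec i) *: svec i).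
  rewrite (lin_sum _ _ _ la); apply: eq_bigr => i _.
  by rewrite (lin_scale _ _ la).
rewrite -(lin_sub _ _ la); apply/eqP; apply: contrapT => h; apply: hn.
exists (x - \sum_(i < n) dot x (svec i) *: svec i) => //.
apply/perp_svecP => i i_n; rewrite dotBl dot_suml (bigD1 (Ordinal i_n))//=.
rewrite dotZl so// eqxx mulr1 big1 ?addr0 ?subrr// => j; rewrite -val_eqE /= => ji.
by rewrite dotZl so// (negbTE ji) mulr0.
Qed.

Definition singval n : R := nr (a (svec n)).

Definition svec_image n : H := (singval n)^-1%:C *: a (svec n).

Lemma singval_gt0 n : 0 < singval n.
Proof. by have [] := svec_max n. Qed.

Lemma svec_orthonormal : orthonormal_seq svec.
Proof.
move=> i j; have [ij|ji|<-] := ltngtP i j.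
- have [/perp_svecP h _ _ _] := svec_max j.
  by rewrite (dotC dot) h// conjc0.
- by have [/perp_svecP h _ _ _] := svec_max i; exact: h.
- by rewrite (dotxx hdot) (sqnE hdot); have [_ -> _ _] := svec_max i; rewrite expr1n.
Qed.

Lemma svec_image_orth i j : (i < j)%N -> dot (a (svec j)) (a (svec i)) = 0.
Proof.
move=> ij; apply: maximizer_orth (svec_max i) _ _.
  apply/perp_svecP => k ki; rewrite svec_orthonormal gtn_eqF//.
  exact: ltn_trans ij.
by rewrite svec_orthonormal gtn_eqF.
Qed.

Lemma svec_image_orthonormal : orthonormal_seq svec_image.
Proof.
move=> i j; rewrite /svec_image dotZl dotZr conjc_real.
have [ij|ji|<-] := ltngtP i j.
- by rewrite (dotC dot) svec_image_orth// conjc0 !mulr0.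
- by rewrite svec_image_orth// !mulr0.
- rewrite (dotxx hdot) (sqnE hdot) -/(singval i) -!rmorphM/= expr2 !mulrA.
  by rewrite divfK ?gt_eqF ?singval_gt0// mulVf// gt_eqF// singval_gt0.
Qed.

Lemma singval_nonincreasing : nonincreasing_seq singval.
Proof.
apply/nonincreasing_seqP => n; have [_ _ _ h] := svec_max n.
rewrite /singval; have [h1 h2 _ _] := svec_max n.+1.
rewrite -[leRHS]mulr1 -h2; apply: h => v vl; apply: h1.
by rewrite /= in_cons vl orbT.
Qed.

(** Otherwise the images of the [svec n] are orthogonal of norm at least [eps], hence at mutual
    distance at least [eps], and cannot cluster. *)
Lemma singval_small eps : 0 < eps -> exists n, singval n < eps.
Proof.
move=> e0; apply: contrapT => hn.
have big n : eps <= singval n by rewrite leNgt; apply/negP => h; apply: hn; exists n.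
have [] := @compact_ultra_image svec.
  by move=> n; have [_ -> _ _] := svec_max n.
move=> U [UU [oU [y hy]]]; have UP : ProperFilter U by exact: ultra_proper.
have e2 : 0 < eps / 2 by rewrite divr_gt0.
have [n /= hn1] := filter_ex (hy _ e2).
have nm : \forall m \near U, (n < m)%N by apply: oU; exists n.+1.
have [m [/= hm1 hm2]] := filter_ex (filterI (hy _ e2) nm).
have : nr (a (svec m) - a (svec n)) < eps.
  have -> : a (svec m) - a (svec n) = (a (svec m) - y) + (y - a (svec n)).
    by rewrite addrA subrK.
  by apply: (le_lt_trans (nrD _ _)); rewrite (nrB (a (svec m))); lra.
apply/negP; rewrite -leNgt -(@ler_sqr R) ?nnegrE ?nr_ge0 ?(ltW e0)//.
rewrite -(sqnE hdot) sqnB svec_image_orth// /= mulr0 subr0 !(sqnE hdot).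
rewrite -/(singval m) -/(singval n); apply: (le_trans (y := singval m ^+ 2)).
  by rewrite ler_sqr ?nnegrE ?(ltW e0) ?(ltW (singval_gt0 _)).
by rewrite lerDl sqr_ge0.
Qed.

Lemma singval_bounded : bounded_weight singval (singval 0%N).
Proof.
by move=> n; rewrite ger0_norm ?(ltW (singval_gt0 _))//; exact: singval_nonincreasing.
Qed.

(** A vector orthogonal to all [svec n] competes in every maximization, so its image has norm at
    most [singval n * nr x] for all [n] and is 0. *)
Lemma compact_svd : a = sdiag singval svec svec_image.
Proof.
apply: (bounded_op_eq_sdiag hdot compact_op_bounded svec_orthonormal
  svec_image_orthonormal singval_bounded) => [n|x hx].
  by rewrite scalerA -rmorphM mulfV ?scale1r// gt_eqF// singval_gt0.
apply: (nr_eq0 hdot); apply/eqP; rewrite eq_le nr_ge0 andbT.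
apply/ler_addgt0Pr => e e0; rewrite add0r.
have x1 : 0 < nr x + 1 by rewrite ltr_wpDl// nr_ge0.
have [n hn] := singval_small (divr_gt0 e0 x1).
have [_ _ _ h] := svec_max n.
apply: (le_trans (h x _)); first by apply/perp_svecP => i _.
rewrite -/(singval n); apply: (le_trans (y := singval n * (nr x + 1))).
  by rewrite ler_wpM2l ?(ltW (singval_gt0 _))// lerDl.
by rewrite -ler_pdivlMr// ltW.
Qed.

End CompactOperators.

(** * Eigenvalue sequences *)

Section EigenvalueSequence.
Context {R : realType} {H : completeNormedModType R[i]}.
Variable dot : {dot H for Num.conj}.
Hypothesis hdot : induces_norm dot.
Local Notation orthonormal_seq := (orthonormal_seq dot).
Local Notation sdiag := (sdiag dot).

Lemma nr_proj_compl e n x : orthosys dot e -> nr (x - proj dot e n x) <= nr x.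
Proof.
move=> he; rewrite -(sqn_le hdot) ?nr_ge0// -(sqnE hdot).
by rewrite (sqn_proj_split n x he) lerDr sqn_ge0.
Qed.

Lemma sdiag_tail w M e N eps x : orthonormal_seq e -> bounded_weight w M ->
  (forall n, (N <= n)%N -> `|w n| <= eps) -> 0 <= eps ->
  nr (sdiag w e e x - proj dot e N (sdiag w e e x)) <= eps * nr x.
Proof.
move=> he hw hN e0; pose w' n := if (n < N)%N then 0 else w n.
have hw' : bounded_weight w' eps.
  by move=> n; rewrite /w'; case: ltnP => nN; [rewrite normr0|exact: hN].
have ho := orthonormal_orthosys he.
have <- : sdiag w' e e x = sdiag w e e x - proj dot e N (sdiag w e e x).
  apply: sdiagE hdot _ _ _ _ _ _; split=> [n|z hz].
    rewrite dotBl /w'; case: ltnP => nN.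
      by rewrite dot_proj// subrr mul0r.
    rewrite (dot_sdiag hdot he he hw) dot_suml big1 ?subr0// => i _.
    by rewrite dotZl he ltn_eqF ?mulr0// (leq_trans _ nN).
  rewrite dotBl (sdiagP hdot he he hw _).2// dot_proj_sym.
  by rewrite /proj big1 ?dot0r ?subrr// => i _; rewrite hz scale0r.
exact: sdiag_bounded_by hw' x.
Qed.

Lemma complex_ultra_cvg (T : Type) (F : set_system T) (u : T -> R[i]) (B : R) :
  UltraFilter F -> (\forall t \near F, csq (u t) <= B ^+ 2) -> 0 <= B ->
  exists l, forall eps, 0 < eps -> \forall t \near F, csq (l - u t) < eps.
Proof.
move=> FU hB B0; have FP : ProperFilter F by exact: ultra_proper.
have bnd (g : T -> R) : (forall t, g t ^+ 2 <= csq (u t)) -> cvg (g @ F).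
  move=> hg; apply: (@ultra_bounded_cvg _ _ _ _ (- B) B) => //.
  apply: filterS hB => t ht; rewrite -ler_norml -(@ler_sqr R) ?nnegrE//.
  by rewrite real_normK ?num_real//; exact: (le_trans (hg t)).
have /cvg_ex[lr hr] : cvg ((fun t => Re (u t)) @ F).
  by apply: bnd => t; rewrite /csq lerDl sqr_ge0.
have /cvg_ex[li hi] : cvg ((fun t => Im (u t)) @ F).
  by apply: bnd => t; rewrite /csq lerDr sqr_ge0.
exists (lr +i* li) => eps e0.
have d0 : 0 < Num.sqrt (eps / 2) by rewrite sqrtr_gt0 divr_gt0.
move/cvgrPdist_lt : hr => /(_ _ d0) hr; move/cvgrPdist_lt : hi => /(_ _ d0) hi.
have sq (z : R) : `|z| < Num.sqrt (eps / 2) -> z ^+ 2 < eps / 2.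
  move=> hz; rewrite -(@real_normK _ z) ?num_real//.
  rewrite -[ltRHS]sqr_sqrtr ?ltr_sqr ?nnegrE ?normr_ge0// ?divr_ge0// ?ltW//.
apply: filterS2 hr hi => t /sq + /sq; rewrite /csq.
by case: (u t) => p q /=; lra.
Qed.

(** Along an ultrafilter on the closure every coordinate converges by boundedness, and the tails
    beyond [N] are uniformly small because the weights tend to 0. So the ultrafilter is Cauchy. *)
Lemma compact_sdiag w (M : R) e : orthonormal_seq e -> bounded_weight w M ->
  (forall eps : R, 0 < eps -> exists N, forall n, (N <= n)%N -> `|w n| <= eps) ->
  compact_op (sdiag w e e).
Proof.
move=> he hw hw0; have ho := orthonormal_orthosys he.
split; first exact: sdiag_linear hw.
have M0 : 0 <= M by exact: le_trans (hw 0%N).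
set K := _ @` _; rewrite compact_ultra => F FU FK.
have FP : ProperFilter F by exact: ultra_proper.
have clK y d : closure K y -> 0 < d ->
    exists2 z, nr z <= 1 & nr (y - sdiag w e e z) < d.
  move=> Ky d0; have dC : 0 < d%:C by rewrite ltcR.
  have [_ [[z /= z1 <-] hz]] := Ky _ (nbhsx_ballx y _ dC).
  exists z; first by rewrite -lecR -normE.
  by move: hz; rewrite -ball_normE/= normE ltcR.
have bK y : closure K y -> nr y <= M.
  move=> Ky; apply/ler_addgt0Pr => d d0; have [z z1 hz] := clK y d Ky d0.
  have h := sdiag_bounded_by hdot he he hw z.
  have : M * nr z <= M by rewrite ler_piMr.
  by have := nrD (y - sdiag w e e z) (sdiag w e e z); rewrite subrK; lra.
have tail eps : 0 < eps -> exists N, forall y, closure K y ->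
    nr (y - proj dot e N y) <= eps.
  move=> e0; have e2 : 0 < eps / 2 by rewrite divr_gt0.
  have [N hN] := hw0 _ e2; exists N => y Ky; have [z z1 hz] := clK y _ Ky e2.
  set t := sdiag w e e z in hz.
  have lp := proj_linear dot e N.
  have -> : y - proj dot e N y =
      (y - t - proj dot e N (y - t)) + (t - proj dot e N t).
    by rewrite (lin_sub _ _ lp) opprB [RHS]addrACA subrK addrAC subrr add0r.
  apply: (le_trans (nrD _ _)).
  have := nr_proj_compl N (y - t) ho.
  have := sdiag_tail z he hw hN (ltW e2).
  have : eps / 2 * nr z <= eps / 2 by rewrite ler_piMr// ltW.
  by rewrite -/t; lra.
have coord n : exists l, forall eps, 0 < eps ->
    \forall y \near F, csq (l - dot y (e n)) < eps.
  apply: complex_ultra_cvg FU _ M0; apply: filterS FK => y Ky.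
  rewrite -[M]mulr1; apply: csq_dot_le hdot _ _ _ _ (bK y Ky) _.
  by rewrite (nrE hdot) orthonormal_sqn// sqrtr1.
have /choice[l hl] := coord.
have [x Fx] : exists x : H, F --> x.
  apply: cauchy_nr => eps e0; have e2 : 0 < eps / 2 by rewrite divr_gt0.
  have [N hN] := tail _ e2.
  exists (\sum_(n < N) l n *: e n).
  (* The [N] coordinate errors together stay below [(eps / 2)^2]; [N.+1] covers [N = 0] and makes
     the bound strict. *)
  have d0 : 0 < (eps / 2) ^+ 2 / N.+1%:R by rewrite divr_gt0// exprn_gt0.
  have hF : \forall y \near F, forall n : 'I_N,
      csq (l n - dot y (e n)) < (eps / 2) ^+ 2 / N.+1%:R.
    by apply: filter_forall => n; exact: hl.
  apply: filterS2 FK hF => y Ky hy; set x0 := \sum_(n < N) _.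
  have -> : x0 - y = (x0 - proj dot e N y) - (y - proj dot e N y).
    by rewrite opprB addrA subrK.
  apply: (le_lt_trans (nrD _ _)); rewrite nrN.
  suff : nr (x0 - proj dot e N y) < eps / 2 by have := hN y Ky; lra.
  rewrite -(@ltr_sqr R) ?nnegrE ?nr_ge0 ?(ltW e2)// -(sqnE hdot).
  have -> : x0 - proj dot e N y = partial (fun n => l n - dot y (e n)) e N.
    by rewrite -sumrB; apply: eq_bigr => i _; rewrite scalerBl.
  rewrite sqn_partial//.
  apply: (le_lt_trans (y := \sum_(n < N) (eps / 2) ^+ 2 / N.+1%:R)).
    by apply: ler_sum => n _; exact: ltW.
  rewrite sumr_const card_ord -[_ *+ N]mulr_natr mulrAC ltr_pdivrMr// ltr_pM2l ?ltr_nat//.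
  exact: exprn_gt0.
exists x; split=> //; apply: closed_closure => B Bx.
by have [y] := filter_ex (filterI FK (Fx _ Bx)); exists y.
Qed.

Lemma card_ge_seqP (A : set nat) k :
  `I_k #<= A <-> exists s, [/\ uniq s, size s = k & forall i, i \in s -> A i].
Proof.
split=> [/card_subP[C CI CA]|[s [us sk sA]]].
  have fC : finite_set C by apply/finite_setP; exists k.
  exists (finmap.enum_fset (fset_set C)); split.
  - exact: finmap.fset_uniq.
  - exact: card_fset_set.
  - by move=> i hi; apply: CA; rewrite -(fset_setK fC); exact: hi.
have inj : {in `I_k &, injective (nth 0%N s)}.
  move=> i j; rewrite !inE /= => ik jk /eqP.
  by rewrite nth_uniq ?sk// => /eqP.
apply/card_subP; exists [set nth 0%N s i | i in `I_k].
  exact: inj_card_eq.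
by move=> _ [i /= ik <-]; apply: sA; rewrite mem_nth// sk.
Qed.

(** At the first disagreement, say [x n < y n], the value [y n] occurs in [y] at [n] and at some
    earlier places. In [x], which is nonincreasing, it can occur only before [n], at those same
    places: once too few. *)
Lemma eigenvalue_sequence_unique (T : H -> H) (u v : nat -> R) :
  eigenvalue_sequence T u -> eigenvalue_sequence T v -> u = v.
Proof.
have key (x y : nat -> R) n : eigenvalue_sequence T x -> eigenvalue_sequence T y ->
    (forall i, (i < n)%N -> x i = y i) -> x n < y n -> False.
  move=> [xd x0 xc] [yd y0 yc] xy xyn; pose s := [seq i <- iota 0 n | y i == y n].
  have l0 : 0 < y n by exact: le_lt_trans xyn.
  have hy : `I_(size s).+1 #<= [set i | y i = y n].
    apply/card_ge_seqP; exists (n :: s); split=> //.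
      by rewrite /= mem_filter mem_iota add0n ltnn !andbF /= filter_uniq ?iota_uniq.
    by move=> i; rewrite in_cons mem_filter => /orP[/eqP->//|/andP[/eqP]].
  have /card_ge_seqP[s' [us' ss' hs']] := (xc _ _ l0).1 ((yc _ _ l0).2 hy).
  suff : (size s' <= size s)%N by rewrite ss' ltnn.
  apply: uniq_leq_size => // i /hs' /= xi.
  have i_n : (i < n)%N.
    by rewrite ltnNge; apply/negP => /xd; rewrite xi leNgt xyn.
  by rewrite mem_filter mem_iota add0n i_n andbT -(xy _ i_n) xi eqxx.
move=> hu hv; apply/funext; elim/ltn_ind => n IH.
have [uv|vu|//] := ltgtP (u n) (v n).
- by have := key u v n hu hv IH uv.
- by have := key v u n hv hu (fun i h => esym (IH i h)) vu.
Qed.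

(** With more independent eigenvectors for [lambda] than indices in [L], the matrix [A] of their
    coordinates along [L] has a nonzero left kernel. The resulting combination has no coordinate
    along [L], and none elsewhere as an eigenvector, so [sdiag] kills it; since [lambda > 0] it is
    0, against independence. *)
Lemma sdiag_eigenvalue_sequence (s : nat -> R) e : orthonormal_seq e -> (forall n, 0 < s n) ->
  nonincreasing_seq s -> (forall eps : R, 0 < eps -> exists n, s n < eps) ->
  eigenvalue_sequence (sdiag s e e) s.
Proof.
move=> he s0 sd ss; split=> //; first by move=> n; exact: ltW.
have hw : bounded_weight s (s 0%N).
  by move=> k; rewrite ger0_norm ?sd// ltW.
have lT := sdiag_linear hdot he he hw.
move=> lambda k l0; split=> [[v [vi vE]]|/card_ge_seqP[l [ul lk hl]]]; last first.
  exists (fun i => e (nth 0%N l i)).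
  have ek (i : 'I_k) : s (nth 0%N l i) = lambda.
    by apply: hl; rewrite mem_nth// lk.
  split; last by move=> i; rewrite (sdiag_basis hdot _ he he) ek.
  move=> c hc i; have : dot (\sum_i c i *: e (nth 0%N l i)) (e (nth 0%N l i)) = 0.
    by rewrite hc dot0l.
  rewrite dot_suml (bigD1 i)//= dotZl he eqxx mulr1 big1 ?addr0// => j ji.
  by rewrite dotZl he nth_uniq ?lk// val_eqE (negbTE ji) mulr0.
have [N hN] := ss _ l0.
have sN n : s n = lambda -> (n < N)%N.
  by move=> sn; rewrite ltnNge; apply/negP => /sd; rewrite sn leNgt hN.
pose L := [seq n <- iota 0 N | s n == lambda].
have uL : uniq L by rewrite filter_uniq ?iota_uniq.
have hL n : n \in L = (s n == lambda).
  rewrite mem_filter mem_iota add0n /=; case: eqP => //= /sN ->//.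
suff kL : (k <= size L)%N.
  apply/card_ge_seqP; exists (take k L); split.
  - exact: take_uniq.
  - by rewrite size_takel.
  - by move=> i /mem_take; rewrite hL => /eqP.
rewrite leqNgt; apply/negP => Lk.
pose A := \matrix_(i < k, j < size L) dot (v i) (e (nth 0%N L j)).
have /eqP : kermx A != 0.
  by rewrite kermx_eq0 -row_leq_rank -ltnNge (leq_ltn_trans (rank_leq_col A)).
apply; apply/row_matrixP => r; rewrite row0.
pose c i := kermx A r i.
suff cE i : c i = 0 by apply/rowP => i; rewrite [LHS]mxE [RHS]mxE; exact: cE.
apply: vi i; set y := \sum_i c i *: v i.
have Ty : sdiag s e e y = lambda%:C *: y.
  rewrite (lin_sum _ _ _ lT) scaler_sumr; apply: eq_bigr => i _.
  by rewrite (lin_scale _ _ lT) vE !scalerA mulrC.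
have ye n : dot y (e n) = 0.
  have [sn|sn] := eqVneq (s n) lambda.
    have nL : n \in L by rewrite hL sn.
    have jL : (index n L < size L)%N by rewrite index_mem.
    have /matrixP/(_ r (Ordinal jL)) := mulmx_ker A; rewrite [LHS]mxE [RHS]mxE => <-.
    by rewrite dot_suml; apply: eq_bigr => i _; rewrite dotZl [A _ _]mxE /= nth_index.
  have /eqP : (s n - lambda)%:C * dot y (e n) = 0.
    by rewrite rmorphB mulrBl -(dot_sdiag hdot he he hw) Ty dotZl subrr.
  rewrite mulf_eq0 => /orP[/eqP/complexI/eqP|/eqP//].
  by rewrite subr_eq0 (negbTE sn).
have /eqP : lambda%:C *: y = 0 by rewrite -Ty (sdiag_ker hdot _ _ ye).
rewrite scaler_eq0 => /orP[/eqP/complexI l00|/eqP//].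
by rewrite l00 ltxx in l0.
Qed.

End EigenvalueSequence.

(** * Traces of diagonal operators *)

Section TracesOfDiagonalOperators.
Context {R : realType} {H : completeNormedModType R[i]}.
Variable dot : {dot H for Num.conj}.
Hypothesis hdot : induces_norm dot.
Local Notation orthonormal_seq := (orthonormal_seq dot).
Local Notation sdiag := (sdiag dot).
Variable e : nat -> H.
Hypothesis he : orthonormal_seq e.

(** * Constraints on an arbitrary singular trace *)

Section Necessity.
Variable tau : (H -> H) -> \bar R.
Hypothesis tr : singular_trace dot tau.

Lemma indicator_projection n : projection dot (sdiag (fun k => (k == n)%:R) e e).
Proof.
have hw : bounded_weight (fun k => (k == n)%:R : R) 1.
  by move=> k; case: (k == n); rewrite ?normr1 ?normr0.
split; first by apply: sdiag_positive hw => // k; exact: ler0n.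
rewrite (sdiag_comp hdot he he he hw hw); congr (sdiag _ _ _).
by apply/funext => k; case: (k == n); rewrite ?mulr1 ?mulr0.
Qed.

Lemma indicator_finite_rank n : finite_rank (sdiag (fun k => (k == n)%:R) e e).
Proof.
have hw : bounded_weight (fun k => (k == n)%:R : R) 1.
  by move=> k; case: (k == n); rewrite ?normr1 ?normr0.
exists 1%N, (fun=> e n) => x; exists (fun=> dot x (e n)); rewrite big_ord1.
apply: sdiagE hdot _ _ _ _ _ _; split=> [k|z hz].
  by rewrite dotZl he eq_sym; case: eqP => [->|_]; rewrite ?mulr1 ?mul1r ?mulr0 ?mul0r.
by rewrite dotZl (dotC dot (e n)) hz conjc0 mulr0.
Qed.

Lemma trace_finite_support n (w : nat -> R) M : (forall k, 0 <= w k) ->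
  bounded_weight w M -> (forall k, (n <= k)%N -> w k = 0) ->
  tau (sdiag w e e) = 0%E.
Proof.
elim: n w => [|n IH] w w0 hw wn.
  (* The zero operator is written as 0 times a projection, so that homogeneity gives trace 0. *)
  have -> : w = (fun k => 0 * (k == 0%N)%:R).
    by apply/funext => k; rewrite mul0r wn.
  have h1 : bounded_weight (fun k => (k == 0%N)%:R : R) 1.
    by move=> k; case: (k == 0%N); rewrite ?normr1 ?normr0.
  rewrite (sdiag_scale hdot _ he he h1) (trace_scale tr) ?mul0e//.
  exact: (indicator_projection 0).1.
pose u k := if (k < n)%N then w k else 0.
have h1 : bounded_weight (fun k => (k == n)%:R : R) 1.
  by move=> k; case: (k == n); rewrite ?normr1 ?normr0.
have h1' : bounded_weight (fun k => w n * (k == n)%:R) M.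
  move=> k; case: (k == n); rewrite ?mulr1 ?mulr0 ?normr0//.
  exact: le_trans (hw k).
have hu : bounded_weight u M.
  by move=> k; rewrite /u; case: ifP => // _; rewrite normr0 (le_trans _ (hw k)).
have u0 k : 0 <= u k by rewrite /u; case: ifP.
have -> : w = (fun k => u k + w n * (k == n)%:R).
  apply/funext => k; rewrite /u; have [kn|nk|->] := ltngtP k n.
  - by rewrite mulr0 addr0.
  - by rewrite mulr0 addr0 wn.
  - by rewrite mulr1 add0r.
have pI := (indicator_projection n).1.
rewrite (sdiag_add hdot he he hu h1') (trace_add tr); last 2 first.
- exact: sdiag_positive hu.
- by apply: sdiag_positive h1' => // k; rewrite mulr_ge0.
rewrite (IH u)// => [|k nk]; last by rewrite /u ltnNge nk.
rewrite add0e (sdiag_scale hdot _ he he h1) (trace_scale tr)//.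
rewrite (trace_singular tr) ?mule0//; first exact: indicator_projection.
exact: indicator_finite_rank.
Qed.

(** With the positive parts [P] of [u - w] and [F] of [w - u] one has [w + P = u + F]. As [F] has
    finite support, its trace is 0, and no subtraction of possibly infinite values occurs. *)
Lemma trace_eventually_le n0 (w u : nat -> R) M M' : (forall k, 0 <= w k) ->
  (forall k, 0 <= u k) -> bounded_weight w M -> bounded_weight u M' ->
  (forall k, (n0 <= k)%N -> w k <= u k) ->
  (tau (sdiag w e e) <= tau (sdiag u e e))%E.
Proof.
move=> w0 u0 hw hu wu.
pose P k := Num.max 0 (u k - w k); pose F k := Num.max 0 (w k - u k).
have P0 k : 0 <= P k by rewrite le_max lexx.
have F0 k : 0 <= F k by rewrite le_max lexx.
have hP : bounded_weight P M'.
  move=> k; rewrite ger0_norm// ge_max; have := hu k; have := u0 k; have := w0 k.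
  by move=> ? ?; rewrite ger0_norm// => ?; apply/andP; split; lra.
have hF : bounded_weight F M.
  move=> k; rewrite ger0_norm// ge_max; have := hw k; have := u0 k; have := w0 k.
  by move=> ? ?; rewrite ger0_norm// => ?; apply/andP; split; lra.
have pw := sdiag_positive hdot w0 he hw; have pu := sdiag_positive hdot u0 he hu.
have pP := sdiag_positive hdot P0 he hP; have pF := sdiag_positive hdot F0 he hF.
have E : sdiag w e e \+ sdiag P e e = sdiag u e e \+ sdiag F e e.
  rewrite -(sdiag_add hdot he he hw hP) -(sdiag_add hdot he he hu hF).
  congr (sdiag _ _ _); apply/funext => k; rewrite /P /F.
  by case: (lerP 0 (u k - w k)); case: (lerP 0 (w k - u k)); lra.
have : tau (sdiag u e e) = (tau (sdiag w e e) + tau (sdiag P e e))%E.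
  rewrite -(trace_add tr)// E (trace_add tr)// (trace_finite_support F0 hF (n := n0)).
    by rewrite adde0.
  by move=> k /wu wk; apply/max_idPl; lra.
by move=> ->; rewrite leeDl// (trace_ge0 tr).
Qed.

Variable v : nat -> R.
Hypothesis v0 : forall n, 0 <= v n.
Variable M : R.
Hypothesis hv : bounded_weight v M.

(** For [x = sdiag (sqrt v) e f] the two sides are the traces of [x] times its adjoint, in the two
    orders. *)
Lemma trace_reindex f : orthonormal_seq f -> tau (sdiag v f f) = tau (sdiag v e e).
Proof.
move=> hf; have hs := bounded_weight_sqrt hv.
rewrite (sdiag_sqrt hdot v0 hf he hv) (sdiag_sqrt hdot v0 he hf hv).
rewrite -(adjoint_sdiag hdot he hf hs) (trace_tracial tr)//.
exact: sdiag_bounded_op hs.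
Qed.

(* The dilation is the sum of N copies of sdiag v, carried by the
   subsequences e_(N n + r), r < N. *)
Lemma trace_dilation N : (0 < N)%N ->
  tau (sdiag (fun n => v (n %/ N)%N) e e) = (N%:R%:E * tau (sdiag v e e))%E.
Proof.
move=> N0; pose f r n := e (N * n + r)%N.
have hf r : orthonormal_seq (f r).
  by move=> i j; rewrite /f he eqn_add2r eqn_pmul2l.
pose w r n := if (n %% N < r)%N then v (n %/ N)%N else 0.
have w0 r n : 0 <= w r n by rewrite /w; case: ifP.
have hw r : bounded_weight (w r) M.
  move=> n; rewrite /w; case: ifP => // _; rewrite normr0.
  by apply: le_trans (hv 0%N).
have step r : (r < N)%N -> sdiag (w r.+1) e e = sdiag (w r) e e \+ sdiag v (f r) (f r).
  move=> rN; apply/funext => x /=; apply: sdiagE hdot _ _ _ _ _ _; split=> [n|z hz].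
    rewrite dotDl (dot_sdiag hdot he he (hw r)) /w ltnS [(n %% N <= r)%N]leq_eqVlt.
    have [nr|nr] := eqVneq (n %% N)%N r; last first.
      rewrite (sdiagP hdot (hf r) (hf r) hv x).2 ?addr0// => m.
      rewrite /f he; case: eqP => // nE; exfalso; move/eqP: nr; apply.
      by rewrite nE mulnC modnMDl modn_small.
    have -> : dot (sdiag v (f r) (f r) x) (e n) =
        dot (sdiag v (f r) (f r) x) (f r (n %/ N)%N).
      by rewrite /f -nr mulnC -divn_eq.
    rewrite (dot_sdiag hdot (hf r) (hf r) hv) /f -nr mulnC -divn_eq.
    by rewrite ltnn mul0r add0r.
  rewrite dotDl (sdiagP hdot he he (hw r) x).2// (sdiagP hdot (hf r) (hf r) hv x).2 ?addr0//.
  by move=> n; exact: hz.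
have tw r : (r <= N)%N -> tau (sdiag (w r) e e) = (r%:R%:E * tau (sdiag v e e))%E.
  elim: r => [_|r IH rN].
    by rewrite mul0e; apply: (trace_finite_support (n := 0%N) (w0 0%N) (hw 0%N)) => k _.
  rewrite step// (trace_add tr); last 2 first.
  - exact: sdiag_positive (hw r).
  - exact: sdiag_positive hv.
  rewrite (trace_reindex (hf r)) IH 1?ltnW// -natr1 EFinD.
  by rewrite ge0_muleDl ?mul1e// lee_fin.
rewrite -tw//; congr (tau (sdiag _ _ _)); apply/funext => n.
by rewrite /w ltn_pmod.
Qed.

Lemma trace_finite_gt0 : (0 < tau (sdiag v e e) < +oo)%E ->
  exists2 t, 0 < t & tau (sdiag v e e) = t%:E.
Proof.
case: (tau _) => [t| |] /andP[]; rewrite ?ltxx// ?lte_fin// => t0 _.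
by exists t.
Qed.

Lemma bounded_weight_dilation N : bounded_weight (fun n => v (n %/ N)%N) M.
Proof. by move=> n; exact: hv. Qed.

Lemma not_traceable_of_slow_decay N q n0 : (0 < N)%N -> 0 <= q -> q < N%:R ->
  (forall n, (n0 <= n)%N -> v (n %/ N)%N <= q * v n) ->
  ~ (0 < tau (sdiag v e e) < +oo)%E.
Proof.
move=> N0 q0 qN h /trace_finite_gt0[t t0 tE].
have hq : bounded_weight (fun n => q * v n) (q * M).
  by move=> n; rewrite normrM ger0_norm// ler_wpM2l.
have := trace_eventually_le (fun k => v0 _) (fun k => mulr_ge0 q0 (v0 k))
  (bounded_weight_dilation N) hq h.
rewrite trace_dilation// (sdiag_scale hdot _ he he hv) (trace_scale tr)//; last first.
  exact: sdiag_positive hv.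
by rewrite tE -!EFinM lee_fin ler_pM2r// leNgt qN.
Qed.

Lemma not_traceable_of_fast_decay N q n0 : (0 < N)%N -> N%:R < q ->
  (forall n, (n0 <= n)%N -> q * v n <= v (n %/ N)%N) ->
  ~ (0 < tau (sdiag v e e) < +oo)%E.
Proof.
move=> N0 qN h /trace_finite_gt0[t t0 tE].
have q0 : 0 <= q by apply: ltW; exact: le_lt_trans qN.
have hq : bounded_weight (fun n => q * v n) (q * M).
  by move=> n; rewrite normrM ger0_norm// ler_wpM2l.
have := trace_eventually_le (fun k => mulr_ge0 q0 (v0 k)) (fun k => v0 _)
  hq (bounded_weight_dilation N) h.
rewrite trace_dilation// (sdiag_scale hdot _ he he hv) (trace_scale tr)//; last first.
  exact: sdiag_positive hv.
by rewrite tE -!EFinM lee_fin ler_pM2r// leNgt qN.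
Qed.

End Necessity.

(** * Construction of singular traces from doubling scales *)

Section Sufficiency.
Variable v : nat -> R.
Hypothesis v0 : forall n, 0 < v n.
Hypothesis vd : nonincreasing_seq v.

Let S n := \sum_(k < n) v k.
Let b := sdiag v e e.

Let hv : bounded_weight v (v 0%N).
Proof. by move=> n; rewrite ger0_norm ?vd// ltW. Qed.

Let pb : positive_op dot b.
Proof. by apply: sdiag_positive hv => // n; exact: ltW. Qed.

Let kb n : kyfan dot b n = S n.
Proof. by apply: kyfan_sdiag => // k; exact: ltW. Qed.

Let S_mono m n : (m <= n)%N -> S m <= S n.
Proof. by move=> mn; rewrite -!kb; exact: kyfan_mono. Qed.

Let S_gt0 n : (0 < n)%N -> 0 < S n.
Proof.
move=> n0; apply: (lt_le_trans _ (S_mono n0)).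
by rewrite /S big_ord1.
Qed.

Lemma traceable_of_nonsummable : (forall A, exists n, A < S n) ->
  (forall j m0, exists2 m, (m0 <= m)%N & S (2 ^ j * m)%N <= 2 * S m) ->
  exists tau, singular_trace dot tau /\ (0 < tau b < +oo)%E.
Proof.
move=> Sinf hm.
(* The demand [k.+1 <= S m], available by nonsummability, sends the values of [phi] on finite rank
   projections to 0. *)
have /choice[m mP] : forall k : nat, exists m, [/\ (0 < m)%N, k.+1%:R <= S m &
    S (2 ^ k.*2 * m)%N <= 2 * S m].
  move=> k; have [n hn] := Sinf k.+1%:R; have [m nm hm'] := hm k.*2 n.+1.
  exists m; split=> //; first exact: leq_trans nm.
  by apply: (le_trans (ltW hn)); apply: S_mono; exact: ltnW.
have m0 k : (0 < m k)%N by have [] := mP k.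
have Sm0 k : 0 < S (m k) by exact: S_gt0.
pose phi k i p := kyfan dot p (2 ^ i * m k)%N / S (m k).
have le2 k i j : (i <= j)%N -> (2 ^ i * m k <= 2 ^ j * m k)%N.
  by move=> ij; rewrite leq_pmul2r// leq_pexp2l.
have double k i : (2 ^ i.+1 * m k = (2 ^ i * m k).*2)%N.
  by rewrite expnS -mulnA mul2n.
apply: (@singular_trace_of_averages _ _ dot phi (fun=> True) _ _ _ _ _ _ _ _ _ _ _ b 1 2) => //.
- by move=> k i p pp _; rewrite /phi divr_ge0 ?(ltW (Sm0 k))// kyfan_ge0.
- by move=> k i j p pp _ ij; rewrite /phi ler_pM2r ?invr_gt0// kyfan_mono// le2.
- move=> k i p q pp pq _ _ _; rewrite /phi -mulrDl ler_pM2r ?invr_gt0//.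
  apply: (le_trans (kyfanD_le hdot _ pp pq)).
  by apply: lerD; apply: kyfan_mono => //; exact: le2.
- move=> k i p q pp pq _ _ _; rewrite /phi -mulrDl ler_pM2r ?invr_gt0// double.
  exact: kyfanD_ge.
- by move=> k i c p c0 pp _; rewrite /phi kyfanZ// mulrA.
- by move=> k i x bx; rewrite /phi kyfan_adjoint.
- move=> p pr fr; split=> // eps e0; have [n hn] := kyfan_projection hdot pr fr.
  have pp := pr.1.
  apply: filterS2 (near_div_le (kyfan dot p n) e0) (nbhs_infty_gt 0) => k hk k0 i _.
  apply: (le_trans _ hk); rewrite /phi.
  have [_ Sk _] := mP k; have K0 := kyfan_ge0 hdot n pp.
  apply: ler_pM => //; first exact: kyfan_ge0.
    by rewrite invr_ge0 ltW.
  rewrite lef_pV2 ?posrE ?ltr0n//; apply: le_trans Sk.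
  by rewrite ler_nat.
- move=> k i ik; rewrite /phi kb ler_pdivlMr// mul1r ler_pdivrMr//.
  have [_ _ h] := mP k; rewrite S_mono ?leq_pmull ?expn_gt0//=.
  by apply: le_trans h; apply: S_mono; exact: le2.
Qed.

Let total := sup (range S).
Let rest n := total - S n.

(** For tails the two Ky Fan inequalities exchange roles: superadditivity with doubled index bounds
    the tail of a sum from above. This requires the full trace [T] to be finite and additive, hence
    the domain [D] of operators with bounded Ky Fan sums. *)
Lemma traceable_of_summable : has_ubound (range S) ->
  (forall j m0, exists2 m, (m0 <= m)%N & rest m <= 2 * rest (2 ^ j * m)%N) ->
  exists tau, singular_trace dot tau /\ (0 < tau b < +oo)%E.
Proof.
move=> Sub hm.
have hS : has_sup (range S) by split=> //; exists (S 0%N), 0%N.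
have S_le n : S n <= total by apply: ub_le_sup => //; exists n.
have rest_gt0 n : 0 < rest n.
  rewrite subr_gt0; apply: (lt_le_trans _ (S_le n.+1)).
  by rewrite /S big_ord_recr ltrDl.
have /choice[m mP] : forall k : nat, exists m, (k < m)%N /\
    rest m <= 2 * rest (2 ^ k.*2 * m)%N.
  by move=> k; have [m km h] := hm k.*2 k.+1; exists m.
pose D (p : H -> H) := has_ubound (range (kyfan dot p)).
pose T p := sup (range (kyfan dot p)).
have T_ge p n : D p -> kyfan dot p n <= T p.
  by move=> Dp; apply: ub_le_sup => //; exists n.
have T_le p c : (forall n, kyfan dot p n <= c) -> T p <= c.
  move=> h; apply: ge_sup; first by exists (kyfan dot p 0%N), 0%N.
  by move=> _ [n _ <-].
have D_le p c : (forall n, kyfan dot p n <= c) -> D p.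
  by move=> h; exists c => _ [n _ <-].
pose rem p n := T p - kyfan dot p n.
have rem_ge0 p n : D p -> 0 <= rem p n by move=> Dp; rewrite subr_ge0 T_ge.
have rem_anti p i j : positive_op dot p -> (i <= j)%N -> rem p j <= rem p i.
  by move=> pp ij; rewrite lerD2l lerN2 kyfan_mono.
have D_add p q : positive_op dot p -> positive_op dot q ->
    D (p \+ q) <-> D p /\ D q.
  move=> pp pq; split=> [Dpq|[Dp Dq]].
    split; apply: (@D_le _ (T (p \+ q))) => n;
      apply: (le_trans _ (T_ge _ n.*2 Dpq));
      apply: (le_trans _ (kyfanD_ge hdot n pp pq)).
      by rewrite lerDl kyfan_ge0.
    by rewrite lerDr kyfan_ge0.
  apply: (@D_le _ (T p + T q)) => n; apply: (le_trans (kyfanD_le hdot n pp pq)).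
  by apply: lerD; exact: T_ge.
have T_add p q : positive_op dot p -> positive_op dot q -> D p -> D q ->
    T (p \+ q) = T p + T q.
  move=> pp pq Dp Dq; have Dpq := (D_add p q pp pq).2 (conj Dp Dq).
  apply/eqP; rewrite eq_le; apply/andP; split.
    apply: T_le => n; apply: (le_trans (kyfanD_le hdot n pp pq)).
    by apply: lerD; exact: T_ge.
  rewrite -lerBrDr; apply: (T_le p) => n; rewrite lerBrDr addrC -lerBrDr.
  apply: (T_le q) => n'; rewrite lerBrDr addrC.
  apply: (le_trans _ (T_ge _ (maxn n n').*2 Dpq)).
  apply: (le_trans _ (kyfanD_ge hdot _ pp pq)).
  by apply: lerD; apply: kyfan_mono => //; [exact: leq_maxl|exact: leq_maxr].
have T_scale p c : 0 <= c -> positive_op dot p -> D p ->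
    T (fun x => c%:C *: p x) = c * T p.
  move=> c0 pp Dp; have Dc : D (fun x => c%:C *: p x).
    by apply: (@D_le _ (c * T p)) => n; rewrite kyfanZ// ler_wpM2l// T_ge.
  apply/eqP; rewrite eq_le; apply/andP; split.
    by apply: T_le => n; rewrite kyfanZ// ler_wpM2l// T_ge.
  have := c0; rewrite [0 <= c]le_eqVlt => /orP[/eqP c0'|{}c0].
    rewrite -{1}c0' mul0r; apply: (le_trans _ (T_ge _ 0%N Dc)).
    by apply: kyfan_ge0 => //; apply: positive_opZ.
  rewrite mulrC -ler_pdivlMr//; apply: T_le => n; rewrite ler_pdivlMr// mulrC.
  by rewrite -(kyfanZ hdot n (ltW c0) pp); exact: T_ge.
(* Tails decrease with the scale, so the exponent runs backwards from [2 k] to make [phi] increasing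
   in [i]. On [b] the values lie in [[1/2, 1]] by the choice of [m k]. On a finite rank projection
   they are 0 once [m k] passes the index where its Ky Fan sums become constant. *)
pose phi k i p := rem p (2 ^ (k.*2 - i) * m k)%N / rest (m k).
have inv0 k : 0 < (rest (m k))^-1 by rewrite invr_gt0.
have double k i : (i < k.*2)%N ->
    (2 ^ (k.*2 - i) * m k = (2 ^ (k.*2 - i.+1) * m k).*2)%N.
  by move=> ik; rewrite -[RHS]mul2n mulnA -expnS subnSK.
have m_gt0 k : (0 < m k)%N by apply: leq_ltn_trans (mP k).1.
have le2 k i j : (i <= j)%N -> (2 ^ (k.*2 - j) * m k <= 2 ^ (k.*2 - i) * m k)%N.
  by move=> ij; rewrite leq_pmul2r// leq_pexp2l// leq_sub2l.
apply: (@singular_trace_of_averages _ _ dot phi D _ _ _ _ _ _ _ _ _ _ _ b 2^-1 1) => //.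
- move=> c p c0 pp; split=> Dp.
    apply: (@D_le _ (c^-1 * T (fun x => c%:C *: p x))) => n.
    by rewrite ler_pdivlMl// -(kyfanZ hdot n (ltW c0) pp) T_ge.
  by apply: (@D_le _ (c * T p)) => n; rewrite kyfanZ ?(ltW c0)// ler_pM2l// T_ge.
- move=> x bx; rewrite /D; have -> // : kyfan dot (adjoint dot x \o x) =
    kyfan dot (x \o adjoint dot x).
  by apply/funext => n; exact: kyfan_adjoint.
- apply: (@D_le _ 0) => n; apply: kyfan_le => g _.
  by rewrite /family_sum big1// => i _; rewrite /quad dot0l.
- by move=> k i p pp Dp; rewrite /phi divr_ge0 ?rem_ge0 ?ltW.
- by move=> k i j p pp Dp ij; rewrite /phi ler_pM2r// rem_anti// le2.
- move=> k i p q pp pq Dp Dq ik; rewrite /phi -mulrDl ler_pM2r// double//.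
  rewrite /rem T_add//; have := kyfanD_ge hdot (2 ^ (k.*2 - i.+1) * m k) pp pq.
  by lra.
- move=> k i p q pp pq Dp Dq ik; rewrite /phi -mulrDl ler_pM2r//.
  apply: (le_trans (y := rem (p \+ q) (2 ^ (k.*2 - i) * m k)%N)); last first.
    exact: rem_anti (positive_opD pp pq) (le2 k _ _ (leqnSn i)).
  rewrite /rem T_add//; have := kyfanD_le hdot (2 ^ (k.*2 - i) * m k) pp pq.
  by lra.
- by move=> k i c p c0 pp Dp; rewrite /phi /rem kyfanZ// T_scale// -mulrBr mulrA.
- move=> k i x bx; rewrite /phi /rem /T; have -> // :
    kyfan dot (adjoint dot x \o x) = kyfan dot (x \o adjoint dot x).
  by apply/funext => n; exact: kyfan_adjoint.
- move=> p pr fr; have [n hn] := kyfan_projection hdot pr fr; have pp := pr.1.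
  split; first exact: D_le hn.
  move=> eps e0; apply: filterS (nbhs_infty_ge n) => k nk i _.
  rewrite /phi; apply: (le_trans (y := 0)); last exact: ltW.
  rewrite pmulr_lle0// subr_le0; apply: T_le => n'; apply: (le_trans (hn n')).
  apply: kyfan_mono => //; apply: (leq_trans nk).
  by apply: (leq_trans (ltnW (mP k).1)); rewrite leq_pmull// expn_gt0.
- by apply: (@D_le _ total) => n; rewrite kb.
- have TE : T b = total.
    by rewrite /T; have -> : kyfan dot b = S by apply/funext.
  have remE n : rem b n = rest n by rewrite /rem TE kb.
  move=> k i ik; rewrite /phi remE ler_pdivlMr// ler_pdivrMr// mul1r.
  apply/andP; split.
    rewrite ler_pdivrMl//; apply: (le_trans (mP k).2); rewrite ler_pM2l//.
    by rewrite lerD2l lerN2 S_mono// leq_pmul2r// leq_pexp2l// leq_subr.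
  by rewrite lerD2l lerN2 S_mono// leq_pmull// expn_gt0.
Qed.

End Sufficiency.
End TracesOfDiagonalOperators.

(** * Slope indices *)

Section SlopeIndices.
Context {R : realType}.
Local Open Scope ereal_scope.

Lemma cvg_ereal_bounds (F : R -> \bar R) (m : \bar R) : 0 <= m ->
  (forall c : R, c%:E < m -> \forall h \near +oo%R, c%:E <= F h) ->
  (forall c : R, m < c%:E -> \forall h \near +oo%R, F h <= c%:E) ->
  F h @[h --> +oo%R] --> m.
Proof.
case: m => [r| |] m0 lo up; last by [].
  have e1 (e : R) : (0 < e)%R -> \forall h \near +oo%R,
      (r - e)%:E <= F h <= (r + e)%:E.
    move=> e0; have h1 : (r - e)%:E < r%:E by rewrite lte_fin; lra.
    have h2 : r%:E < (r + e)%:E by rewrite lte_fin; lra.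
    by apply: filterS2 (lo _ h1) (up _ h2) => h -> ->.
  apply/fine_cvgP; split.
    apply: filterS (e1 1%R ltr01) => h /andP[]; case: (F h) => //.
  apply/cvgrPdist_le => e e0; apply: filterS (e1 e e0) => h /andP[].
  rewrite /comp; case: (F h) => [x| |]; rewrite ?leye_eq ?leeNy_eq// !lee_fin /=.
  move=> h1 h2.
  by rewrite ler_distl; apply/andP; split; lra.
by apply/cvgeyPge => A; apply: lo; exact: ltry.
Qed.

Lemma limf_esup_lt (g : R -> \bar R) (c : R) :
  limf_esup g (+oo%R : set_system R) < c%:E ->
  exists2 d : R, (d < c)%R & \forall t \near +oo%R, g t <= d%:E.
Proof.
rewrite limf_esupE => /ereal_inf_lt[_ [V FV <-] hV].
have [d dc hd] : exists2 d : R, (d < c)%R & ereal_sup (g @` V) <= d%:E.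
  move: hV; case: (ereal_sup _) => [r| |]//; last first.
    by move=> _; exists (c - 1)%R; [lra|exact: leNye].
  by rewrite lte_fin => rc; exists r.
exists d => //; apply: filterS FV => t Vt; apply: le_trans hd.
by apply: ereal_sup_ubound; exists t.
Qed.

Lemma limf_esup_le (g : R -> \bar R) (c : R) :
  (\forall t \near +oo%R, g t <= c%:E) ->
  limf_esup g (+oo%R : set_system R) <= c%:E.
Proof.
move=> h; rewrite limf_esupE; set V := [set t | g t <= c%:E].
apply: (le_trans (y := ereal_sup (g @` V))).
  by apply: ereal_inf_lbound; exists V.
by apply: ge_ereal_sup => _ [t Vt <-].
Qed.

Lemma limf_einf_gt (g : R -> \bar R) (c : R) :
  c%:E < limf_einf g (+oo%R : set_system R) ->
  exists2 d : R, (c < d)%R & \forall t \near +oo%R, d%:E <= g t.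
Proof.
rewrite /limf_einf lteNr -EFinN => /limf_esup_lt[d dc hd].
exists (- d)%R; first lra.
by apply: filterS hd => t; rewrite leeNl EFinN.
Qed.

Lemma limf_einf_ge (g : R -> \bar R) (c : R) :
  (\forall t \near +oo%R, c%:E <= g t) ->
  c%:E <= limf_einf g (+oo%R : set_system R).
Proof.
move=> h; rewrite /limf_einf leeNr -EFinN; apply: limf_esup_le.
by apply: filterS h => t; rewrite EFinN leeN2.
Qed.

Variable f : R -> R.
Hypothesis f_mono : {homo f : x y / (x <= y)%R}.

Definition diff_quotient h t : \bar R := ((f (t + h) - f t) / h)%:E.
Definition upper_slope h := limf_esup (diff_quotient h) (+oo%R : set_system R).
Definition lower_slope h := limf_einf (diff_quotient h) (+oo%R : set_system R).

Definition upper_index := lim (upper_slope h @[h --> +oo%R]).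
Definition lower_index := lim (lower_slope h @[h --> +oo%R]).

Lemma slope_le h t (c : R) : (0 < h)%R ->
  (diff_quotient h t <= c%:E) = (f (t + h) <= f t + c * h)%R.
Proof. by move=> h0; rewrite lee_fin ler_pdivrMr// lerBlDl. Qed.

Lemma slope_ge h t (c : R) : (0 < h)%R ->
  (c%:E <= diff_quotient h t) = (f t + c * h <= f (t + h))%R.
Proof. by move=> h0; rewrite lee_fin ler_pdivlMr// lerBrDl. Qed.

Local Open Scope ring_scope.

Lemma near_pinfty_shift (P : R -> Prop) : (\forall t \near +oo, P t) ->
  exists t0, forall t, t0 <= t -> P t.
Proof.
move=> [A [_ hA]]; exists (A + 1) => t tA; apply: hA; lra.
Qed.

Lemma f_steps (c h t0 : R) : 0 < h ->
  (forall t, t0 <= t -> f (t + h) <= f t + c * h) ->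
  forall n t, t0 <= t -> f (t + n%:R * h) <= f t + c * (n%:R * h).
Proof.
move=> h0 hc; elim=> [|n IH] t t0t; first by rewrite !mul0r mulr0 !addr0.
have -> : t + n.+1%:R * h = (t + n%:R * h) + h by rewrite -natr1; ring.
have tn : t0 <= t + n%:R * h.
  by have : 0 <= n%:R * h by [rewrite mulr_ge0// ltW]; lra.
by have := hc _ tn; have := IH t t0t; rewrite -natr1; lra.
Qed.

Lemma f_steps_ge (c h t0 : R) : 0 < h ->
  (forall t, t0 <= t -> f t + c * h <= f (t + h)) ->
  forall n t, t0 <= t -> f t + c * (n%:R * h) <= f (t + n%:R * h).
Proof.
move=> h0 hc; elim=> [|n IH] t t0t; first by rewrite !mul0r mulr0 !addr0.
have -> : t + n.+1%:R * h = (t + n%:R * h) + h by rewrite -natr1; ring.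
have tn : t0 <= t + n%:R * h.
  by have : 0 <= n%:R * h by [rewrite mulr_ge0// ltW]; lra.
by have := hc _ tn; have := IH t t0t; rewrite -natr1; lra.
Qed.

(** Round [r] up to a multiple of [h] and use monotonicity; the absolute value in the error [|c| h]
    allows for negative [c]. *)
Lemma f_linear_le (c h t0 : R) : 0 < h ->
  (forall t, t0 <= t -> f (t + h) <= f t + c * h) ->
  forall t r, t0 <= t -> 0 <= r -> f (t + r) <= f t + c * r + `|c| * h.
Proof.
move=> h0 hc t r t0t r0; pose n := (Num.truncn (r / h)).+1.
have rh0 : 0 <= r / h by rewrite divr_ge0// ltW.
have n1 : r < n%:R * h by rewrite -ltr_pdivrMr// truncnS_gt.
have n2 : n%:R * h <= r + h.
  have : (Num.truncn (r / h))%:R <= r / h by rewrite truncn_le.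
  by rewrite ler_pdivlMr// /n -natr1; lra.
apply: (le_trans (f_mono (y := t + n%:R * h) _)); first by lra.
apply: (le_trans (f_steps h0 hc n t0t)).
have : c * (n%:R * h - r) <= `|c| * h.
  apply: (le_trans (ler_norm _)); rewrite normrM ler_wpM2l//.
  by rewrite ger0_norm; lra.
lra.
Qed.

Lemma f_linear_ge (c h t0 : R) : 0 < h ->
  (forall t, t0 <= t -> f t + c * h <= f (t + h)) ->
  forall t r, t0 <= t -> 0 <= r -> f t + c * r - `|c| * h <= f (t + r).
Proof.
move=> h0 hc t r t0t r0; pose n := Num.truncn (r / h).
have rh0 : 0 <= r / h by rewrite divr_ge0// ltW.
have n1 : r < n%:R * h + h.
  by have := truncnS_gt (r / h); rewrite ltr_pdivrMr// /n -natr1; lra.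
have n2 : n%:R * h <= r.
  have : (Num.truncn (r / h))%:R <= r / h by rewrite truncn_le.
  by rewrite ler_pdivlMr.
apply: (le_trans _ (f_mono (x := t + n%:R * h) _)); last by lra.
apply: (le_trans _ (f_steps_ge h0 hc n t0t)).
have : c * (r - n%:R * h) <= `|c| * h.
  apply: (le_trans (ler_norm _)); rewrite normrM ler_wpM2l//.
  by rewrite ger0_norm; lra.
lra.
Qed.

Lemma upper_ge0 h : 0 < h -> (0 <= upper_slope h)%E.
Proof.
move=> h0; rewrite /upper_slope leNgt; apply/negP => /limf_esup_lt[d d0 hd].
have [t0 /(_ t0 (lexx _))] := near_pinfty_shift hd.
rewrite slope_le// => h1; have : f t0 <= f (t0 + h) by apply: f_mono; lra.
have : d * h < 0 by rewrite nmulr_rlt0.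
lra.
Qed.

Lemma lower_ge0 h : 0 < h -> (0 <= lower_slope h)%E.
Proof.
move=> h0; apply: limf_einf_ge; apply: nearW => t.
by rewrite slope_ge// mul0r addr0; apply: f_mono; lra.
Qed.

(* Subadditivity of h |-> limsup (f (t + h) - f t): one good h makes all
   larger steps nearly as good. *)
Lemma upper_near (c d h1 : R) : 0 < h1 -> d < c ->
  (\forall t \near +oo, (diff_quotient h1 t <= d%:E)%E) ->
  \forall h \near +oo, \forall t \near +oo, (diff_quotient h t <= c%:E)%E.
Proof.
move=> h10 dc /near_pinfty_shift[t0 ht0].
have hd t : t0 <= t -> f (t + h1) <= f t + d * h1.
  by move=> /ht0; rewrite slope_le.
(* Beyond this point the rounding error [|d| h1] of [f_linear_le] is at most [(c - d) h]. *)
exists (`|d| * h1 / (c - d) + 1); split; first exact: num_real.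
move=> h hh; have dcp : 0 < c - d by lra.
have q0 : 0 <= `|d| * h1 / (c - d) by rewrite divr_ge0 ?mulr_ge0 ?(ltW h10) ?(ltW dcp).
have h0 : 0 < h by lra.
exists t0; split; first exact: num_real.
move=> t /ltW t0t; rewrite slope_le//.
apply: (le_trans (f_linear_le h10 hd t0t (ltW h0))).
have : `|d| * h1 / (c - d) <= h by lra.
rewrite ler_pdivrMr//; lra.
Qed.

Lemma lower_near (c d h1 : R) : 0 < h1 -> c < d ->
  (\forall t \near +oo, (d%:E <= diff_quotient h1 t)%E) ->
  \forall h \near +oo, \forall t \near +oo, (c%:E <= diff_quotient h t)%E.
Proof.
move=> h10 dc /near_pinfty_shift[t0 ht0].
have hd t : t0 <= t -> f t + d * h1 <= f (t + h1).
  by move=> /ht0; rewrite slope_ge.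
exists (`|d| * h1 / (d - c) + 1); split; first exact: num_real.
move=> h hh; have dcp : 0 < d - c by lra.
have q0 : 0 <= `|d| * h1 / (d - c) by rewrite divr_ge0 ?mulr_ge0 ?(ltW h10) ?(ltW dcp).
have h0 : 0 < h by lra.
exists t0; split; first exact: num_real.
move=> t /ltW t0t; rewrite slope_ge//.
apply: (le_trans _ (f_linear_ge h10 hd t0t (ltW h0))).
have : `|d| * h1 / (d - c) <= h by lra.
rewrite ler_pdivrMr//; lra.
Qed.

(** A form of Fekete's lemma: the limit in [h] exists and is an infimum, so that a single step [h]
    suffices to bound the index from above. *)
Lemma upper_index_inf :
  upper_index = ereal_inf [set upper_slope h | h in [set h | 0 < h]].
Proof.
apply: cvg_lim; first exact: ereal_hausdorff.
apply: cvg_ereal_bounds.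
- by apply: le_ereal_inf_tmp => _ [h /= h0 <-]; exact: upper_ge0.
- move=> c cm; exists 0; split; first exact: num_real.
  move=> h h0; apply: (le_trans (ltW cm)).
  by apply: ereal_inf_lbound; exists h.
- move=> c /ereal_inf_lt[_ [h1 /= h10 <-]] /limf_esup_lt[d dc hd].
  by apply: filterS (upper_near h10 dc hd) => h; exact: limf_esup_le.
Qed.

Lemma lower_index_sup :
  lower_index = ereal_sup [set lower_slope h | h in [set h | 0 < h]].
Proof.
apply: cvg_lim; first exact: ereal_hausdorff.
apply: cvg_ereal_bounds.
- apply: (le_trans (lower_ge0 ltr01)).
  by apply: ereal_sup_ubound; exists 1 => //=; exact: ltr01.
- move=> c /ereal_sup_gt[_ [h1 /= h10 <-]] /limf_einf_gt[d dc hd].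
  by apply: filterS (lower_near h10 dc hd) => h; exact: limf_einf_ge.
- move=> c cm; exists 0; split; first exact: num_real.
  move=> h h0; apply: (le_trans _ (ltW cm)).
  by apply: ereal_sup_ubound; exists h.
Qed.

Lemma upper_index_ge0 : (0 <= upper_index)%E.
Proof.
rewrite upper_index_inf; apply: le_ereal_inf_tmp => _ [h /= h0 <-].
exact: upper_ge0.
Qed.

Lemma lower_index_ge0 : (0 <= lower_index)%E.
Proof.
rewrite lower_index_sup; apply: (le_trans (lower_ge0 ltr01)).
by apply: ereal_sup_ubound; exists 1 => //=; exact: ltr01.
Qed.

Lemma upper_index_lt (c : R) : (upper_index < c%:E)%E ->
  exists2 d, d < c & \forall h \near +oo, \forall t \near +oo,
    f (t + h) <= f t + d * h.
Proof.
rewrite upper_index_inf => /ereal_inf_lt[_ [h1 /= h10 <-]] /limf_esup_lt[d dc hd].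
exists ((c + d) / 2); first lra.
have dc' : d < (c + d) / 2 by lra.
have h0 : \forall h \near +oo, (0 : R) < h by exact: nbhs_pinfty_gt.
apply: filterS2 h0 (upper_near h10 dc' hd) => h h0.
by apply: filterS => t; rewrite slope_le.
Qed.

Lemma upper_index_le (c h : R) : 0 < h ->
  (\forall t \near +oo, f (t + h) <= f t + c * h) -> (upper_index <= c%:E)%E.
Proof.
move=> h0 hc; rewrite upper_index_inf; apply: (le_trans (y := upper_slope h)).
  by apply: ereal_inf_lbound; exists h.
by apply: limf_esup_le; apply: filterS hc => t; rewrite slope_le.
Qed.

Lemma lower_index_gt (c : R) : (c%:E < lower_index)%E ->
  exists2 d, c < d & \forall h \near +oo, \forall t \near +oo,
    f t + d * h <= f (t + h).
Proof.
rewrite lower_index_sup => /ereal_sup_gt[_ [h1 /= h10 <-]] /limf_einf_gt[d dc hd].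
exists ((c + d) / 2); first lra.
have dc' : (c + d) / 2 < d by lra.
have h0 : \forall h \near +oo, (0 : R) < h by exact: nbhs_pinfty_gt.
apply: filterS2 h0 (lower_near h10 dc' hd) => h h0.
by apply: filterS => t; rewrite slope_ge.
Qed.

Lemma lower_index_ge (c h : R) : 0 < h ->
  (\forall t \near +oo, f t + c * h <= f (t + h)) -> (c%:E <= lower_index)%E.
Proof.
move=> h0 hc; rewrite lower_index_sup; apply: (le_trans (y := lower_slope h)).
  by apply: limf_einf_ge; apply: filterS hc => t; rewrite slope_ge.
by apply: ereal_sup_ubound; exists h.
Qed.

(** * Comparison of the growth order with the two indices *)

Definition growth_order := limf_einf (fun t => (f t / t)%:E) (+oo : set_system R).

Lemma ereal_between (x y : \bar R) : (0 <= x)%E -> (x < y)%E ->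
  exists c : R, (x < c%:E)%E /\ (c%:E < y)%E.
Proof.
case: x => [x| |]//; last by move=> _; case: y.
case: y => [y| |]// _.
  by rewrite lte_fin => xy; exists ((x + y) / 2); rewrite !lte_fin; split; lra.
by move=> _; exists (x + 1); rewrite lte_fin ltry; split=> //; lra.
Qed.

(** Iterating from one base point [t0] gives [f t <= d t + K] with [d < c], hence [f t / t <= c]
    eventually. *)
Lemma growth_order_le_upper_index : (growth_order <= upper_index)%E.
Proof.
rewrite leNgt; apply/negP => /(ereal_between upper_index_ge0)[c [uc co]].
have [d dc hd] := upper_index_lt uc.
have [h [h0 /near_pinfty_shift[t0 ht0]]] :=
  filter_ex (filterI (nbhs_pinfty_gt (num_real (0 : R))) hd).
have [e ce he] := limf_einf_gt co.
pose K := f t0 - d * t0 + `|d| * h.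
have : \forall t \near +oo, f t / t <= c.
  exists (Num.max (Num.max t0 1) (K / (c - d))); split; first exact: num_real.
  move=> t; rewrite !gt_max => /andP[/andP[tt0 t1] tK].
  have t_gt0 : 0 < t by lra.
  rewrite ler_pdivrMr//.
  have := f_linear_le h0 ht0 (lexx t0) (r := t - t0) _.
  rewrite subr_ge0 (ltW tt0) [t0 + _]addrC subrK => /(_ isT).
  have dcp : 0 < c - d by lra.
  by move: tK; rewrite ltr_pdivrMr// /K; lra.
move=> /(filterI he) /filter_ex[t [/=]]; rewrite lee_fin; lra.
Qed.

Lemma lower_index_le_growth_order : (lower_index <= growth_order)%E.
Proof.
(* [ereal_between] starts from a non-negative bound, so a negative order is refuted apart:
   [f t >= f 1] for [t >= 1], and [f 1 / t] tends to 0. *)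
have [order0|order0] := ltP growth_order 0%E; last first.
  rewrite leNgt; apply/negP => /(ereal_between order0)[c [oc cl]].
  have [d dc hd] := lower_index_gt cl.
  have [h [h0 /near_pinfty_shift[t0 ht0]]] :=
    filter_ex (filterI (nbhs_pinfty_gt (num_real (0 : R))) hd).
  pose K := f t0 - d * t0 - `|d| * h.
  suff : (c%:E <= growth_order)%E by rewrite leNgt oc.
  apply: limf_einf_ge.
  exists (Num.max (Num.max t0 1) (- K / (d - c))); split; first exact: num_real.
  move=> t; rewrite !gt_max => /andP[/andP[tt0 t1] tK].
  have t_gt0 : 0 < t by lra.
  rewrite lee_fin ler_pdivlMr//.
  have := f_linear_ge h0 ht0 (lexx t0) (r := t - t0) _.
  rewrite subr_ge0 (ltW tt0) [t0 + _]addrC subrK => /(_ isT).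
  have dcp : 0 < d - c by lra.
  by move: tK; rewrite ltr_pdivrMr// /K; lra.
exfalso; move: order0; apply/negP; rewrite -leNgt.
apply/lee_addgt0Pr => e e0; rewrite -leeBlDr// sub0e -EFinN.
apply: limf_einf_ge.
exists (Num.max 1 (- f 1 / e)); split; first exact: num_real.
move=> t; rewrite gt_max => /andP[t1 te]; have t_gt0 : 0 < t by lra.
rewrite lee_fin ler_pdivlMr//; have := f_mono (ltW t1).
by move: te; rewrite ltr_pdivrMr//; lra.
Qed.

Lemma growth_order_ge0 : (0 <= growth_order)%E.
Proof. exact: le_trans lower_index_ge0 lower_index_le_growth_order. Qed.

End SlopeIndices.

(** * Decay and doubling of sequences *)

Section SequenceCriteria.
Context {R : realType}.
Variable u : nat -> R.
Hypothesis u0 : forall n, 0 < u n.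
Hypothesis ud : nonincreasing_seq u.

Definition log_profile (t : R) : R := - ln (u (Num.truncn (expR t))).

Lemma log_profile_mono : {homo log_profile : x y / x <= y}.
Proof.
move=> x y xy; rewrite lerN2 ler_ln ?posrE//; apply: ud.
by apply: le_truncn; rewrite ler_expR.
Qed.

Variable alpha : R.
Hypothesis alpha0 : 0 < alpha.

Let v n := u n `^ alpha.

Let v_gt0 n : 0 < v n.
Proof. exact: powR_gt0. Qed.

Let vd : nonincreasing_seq v.
Proof.
move=> m n mn; apply: ge0_ler_powR; first exact: ltW.
- by rewrite nnegrE ltW.
- by rewrite nnegrE ltW.
- exact: ud.
Qed.

Let ln_v n : ln (v n) = alpha * ln (u n).
Proof. by rewrite ln_powR. Qed.

Let profile_diff t h : log_profile (t + h) - log_profile t =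
  alpha^-1 * (ln (v (Num.truncn (expR t))) - ln (v (Num.truncn (expR t * expR h)))).
Proof.
rewrite /log_profile expRD !ln_v -mulrBr mulrA mulVf ?mul1r ?gt_eqF//.
by rewrite opprK addrC.
Qed.

Let truncn_divn (n N : nat) : (0 < N)%N -> Num.truncn (n%:R / N%:R : R) = (n %/ N)%N.
Proof.
move=> N0; apply/eqP; rewrite truncn_eq ?divr_ge0//.
by rewrite ler_pdivlMr ?ltr0n// ltr_pdivrMr ?ltr0n// -!natrM ler_nat ltr_nat
  leq_trunc_div ltn_ceil.
Qed.

(** With [t = ln (n / N)] and [h = ln N], the truncations of [e^t] and [e^(t + h)] are [n %/ N] and
    [n]: conditions on slopes become conditions on [v (n %/ N)] and [v n]. *)
Let near_profile (P : R -> Prop) (N : nat) : (1 < N)%N ->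
  (\forall t \near +oo, P t) -> exists n0, forall n, (n0 <= n)%N ->
    (0 < n)%N /\ P (ln (n%:R / N%:R)).
Proof.
move=> N1 /near_pinfty_shift[t0 ht0].
exists (Num.truncn (N%:R * expR t0)).+1 => n hn.
have n0 : (0 < n)%N by exact: leq_trans hn.
have N0 : (0 < N)%N by exact: ltnW.
split=> //; apply: ht0; rewrite -[leLHS]expRK ler_ln ?posrE ?expR_gt0 ?divr_gt0 ?ltr0n//.
rewrite ler_pdivlMr ?ltr0n// mulrC; apply: ltW; apply: (lt_le_trans (truncnS_gt _)).
by rewrite ler_nat.
Qed.

Let near_ln (P : R -> Prop) : (\forall h \near +oo, P h) ->
  exists2 N : nat, (1 < N)%N & P (ln N%:R).
Proof.
move=> /near_pinfty_shift[h0 hh0]; pose N := (Num.truncn (expR h0)).+2.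
exists N => //; apply: hh0; rewrite -[leLHS]expRK ler_ln ?posrE ?expR_gt0 ?ltr0n//.
apply: ltW; apply: (lt_le_trans (truncnS_gt _)).
by rewrite ler_nat.
Qed.

Let profile_at (N n : nat) : (1 < N)%N -> (0 < n)%N ->
  log_profile (ln (n%:R / N%:R) + ln N%:R) - log_profile (ln (n%:R / N%:R)) =
  alpha^-1 * (ln (v (n %/ N)) - ln (v n)).
Proof.
move=> N1 n0; have N0 : (0 < N)%N by exact: ltnW.
rewrite profile_diff !lnK ?posrE ?divr_gt0 ?ltr0n// truncn_divn//.
by rewrite divfK ?pnatr_eq0 -?lt0n// natrK.
Qed.

Lemma slow_decay : (upper_index log_profile < alpha^-1%:E)%E ->
  exists N q n0, [/\ (0 < N)%N, 0 <= q, q < N%:R &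
    forall n, (n0 <= n)%N -> v (n %/ N) <= q * v n].
Proof.
move=> /(upper_index_lt log_profile_mono)[d da /near_ln[N N1]].
move=> /(near_profile N1)[n0 hn0].
have N0 : (0 < N)%N by exact: ltnW.
have lN : 0 < ln N%:R :> R by rewrite ln_gt0// ltr1n.
(* This is [N ^ (alpha d)], which is below [N] because [d < alpha^-1] and [N > 1]. *)
exists N, (expR (alpha * d * ln N%:R)), n0; split=> //.
  rewrite -[ltRHS]lnK ?posrE ?ltr0n// ltr_expR gtr_pMl//.
  by rewrite mulrC -ltr_pdivlMr// mul1r.
move=> n /hn0[n_gt0]; rewrite -lerBlDl profile_at// ler_pdivrMl// => h.
rewrite -ler_ln ?posrE ?mulr_gt0 ?expR_gt0// lnM ?posrE ?expR_gt0//.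
by rewrite expRK -lerBlDr -mulrA.
Qed.

Lemma fast_decay : (alpha^-1%:E < lower_index log_profile)%E ->
  exists N q n0, [/\ (0 < N)%N, N%:R < q &
    forall n, (n0 <= n)%N -> q * v n <= v (n %/ N)].
Proof.
move=> /(lower_index_gt log_profile_mono)[d da /near_ln[N N1]].
move=> /(near_profile N1)[n0 hn0].
have N0 : (0 < N)%N by exact: ltnW.
have lN : 0 < ln N%:R :> R by rewrite ln_gt0// ltr1n.
exists N, (expR (alpha * d * ln N%:R)), n0; split=> //.
  rewrite -[ltLHS]lnK ?posrE ?ltr0n// ltr_expR ltr_pMl//.
  by rewrite mulrC -ltr_pdivrMr// mul1r.
move=> n /hn0[n_gt0]; rewrite -lerBrDl profile_at// ler_pdivlMl// => h.
rewrite -ler_ln ?posrE ?mulr_gt0 ?expR_gt0// lnM ?posrE ?expR_gt0//.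
by rewrite expRK -lerBrDr -mulrA.
Qed.

Let S n := \sum_(k < n) v k.

Let S_add m k : S (m + k)%N - S m = \sum_(i < k) v (m + i)%N.
Proof. by rewrite /S big_split_ord /= addrAC subrr add0r. Qed.

Let S_le m n : (m <= n)%N -> S n - S m <= (n - m)%:R * v m.
Proof.
move=> mn; have := S_add m (n - m); rewrite (subnKC mn) => ->.
rewrite mulr_natl; apply: (le_trans (y := \sum_(i < n - m) v m)).
  by apply: ler_sum => i _; apply: vd; exact: leq_addr.
by rewrite sumr_const card_ord.
Qed.

Let S_ge m n : (m <= n)%N -> (n - m)%:R * v n <= S n - S m.
Proof.
move=> mn; have := S_add m (n - m); rewrite (subnKC mn) => ->.
rewrite mulr_natl; apply: (le_trans (y := \sum_(i < n - m) v n)).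
  by rewrite sumr_const card_ord.
apply: ler_sum => i _; apply: vd.
by rewrite -[leqRHS](subnKC mn) leq_add2l ltnW.
Qed.

(** For real [t] truncation does not commute with multiplication by [K]; from [n + 1 <= 2 n] the
    defect is at most a factor 2. *)
Let scaled_truncn (t : R) (K : nat) : 0 <= t -> (0 < K)%N ->
  let n := Num.truncn (expR t) in
  [/\ (0 < n)%N, (K * n <= Num.truncn (expR t * K%:R))%N &
      (Num.truncn (expR t * K%:R) <= K * 2 * n)%N].
Proof.
move=> t0 K0 n; have t1 : 1 <= expR t by rewrite -expR0 ler_expR.
have K0' : 0 < K%:R :> R by rewrite ltr0n.
have n_gt0 : (0 < n)%N by rewrite truncn_gt0.
have nle : n%:R <= expR t by rewrite truncn_le// expR_ge0.
have nlt : expR t < n.+1%:R by exact: truncnS_gt.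
split=> //.
  rewrite -[leqLHS](@natrK R); apply: le_truncn.
  by rewrite natrM mulrC ler_pM2r.
rewrite -[leqRHS](@natrK R); apply: le_truncn; rewrite !natrM mulrC -mulrA.
rewrite ler_pM2l//; apply: (le_trans (ltW nlt)).
by rewrite -natrM ler_nat mul2n -addnn -addn1 leq_add2l.
Qed.

(** Suppose [S (N m) > 2 S m] for all [m >= m0]. Then [2^l m v_m <= 2^l S m <= S (N^l m)], while [S
    (N^l m) < S (N^(l+1) m) - S (N^l m) <= N^(l+1) m v_(N^l m)]. This is [vlow]: over a long step
    [v] decays too slowly for the upper index to reach [alpha^-1]. *)
Lemma nonsummable_doubling : (alpha^-1%:E <= upper_index log_profile)%E ->
  forall j m0, exists2 m, (m0 <= m)%N & S (2 ^ j * m)%N <= 2 * S m.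
Proof.
move=> ua j m0; apply: contrapT => hn.
have dbl m : (m0 <= m)%N -> 2 * S m < S (2 ^ j * m)%N.
  by move=> mm; rewrite ltNge; apply/negP => h; apply: hn; exists m.
pose N := (2 ^ j)%N; have N0 : (0 < N)%N by rewrite expn_gt0.
have iter l m : (m0 <= m)%N -> 2 ^+ l * S m <= S (N ^ l * m)%N.
  move=> mm; elim: l => [|l IH]; first by rewrite mul1r mul1n.
  have ml : (m0 <= N ^ l * m)%N.
    by apply: (leq_trans mm); rewrite leq_pmull// expn_gt0 N0.
  have := dbl _ ml; rewrite mulnA -expnS exprS -mulrA => /ltW; apply: le_trans.
  by rewrite ler_pM2l.
have Sv m : m%:R * v m <= S m.
  by have := @S_ge 0 m (leq0n _); rewrite subn0 /S big_ord0 subr0.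
have vlow l m : (m0 <= m)%N -> (0 < m)%N ->
    2 ^+ l * v m <= N%:R ^+ l.+1 * v (N ^ l * m)%N.
  move=> mm m_gt0; have ml : (m0 <= N ^ l * m)%N.
    by apply: (leq_trans mm); rewrite leq_pmull// expn_gt0 N0.
  have Sm0 : 0 <= S (N ^ l * m)%N by apply: sumr_ge0 => i _; exact: ltW.
  have mN : (N ^ l * m <= N * (N ^ l * m))%N by rewrite leq_pmull.
  have h1 := S_le mN; have h2 := dbl _ ml; have h3 := iter l m mm.
  have h4 := Sv m; rewrite -/N in h2.
  have h5 : (N * (N ^ l * m) - N ^ l * m)%:R * v (N ^ l * m)%N <=
      N%:R ^+ l.+1 * m%:R * v (N ^ l * m)%N.
    rewrite ler_pM2r// -natrX -natrM ler_nat mulnA -expnS.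
    exact: leq_subr.
  have m0' : 0 < m%:R :> R by rewrite ltr0n.
  rewrite -(ler_pM2r m0'); apply: (le_trans (y := S (N ^ l * m)%N)).
    apply: (le_trans _ h3); rewrite -mulrA ler_pM2l ?exprn_gt0//.
    by rewrite mulrC.
  by rewrite mulrAC; lra.
(* For [N = 1] the assumed growth reads [2 S m < S m], impossible for a non-negative sum. *)
have N1 : (1 < N)%N.
  rewrite ltnNge; apply/negP => N1; have N1' : N = 1%N by apply/eqP; rewrite eqn_leq N1.
  have := dbl (maxn m0 1) (leq_maxl _ _); rewrite -/N N1' mul1n.
  have : 0 <= S (maxn m0 1) by apply: sumr_ge0 => i _; exact: ltW.
  lra.
have j0 : (0 < j)%N by rewrite lt0n; apply: contraTneq N1 => j0; rewrite /N j0.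
(* l is large enough for 2 ln N < (l + 1) ln 2. *)
pose l := (2 * j)%N; pose K := (N ^ l)%N.
have l0 : (0 < l)%N by rewrite muln_gt0.
have K1 : (1 < K)%N by rewrite -{1}(expn0 N) ltn_exp2l.
have ln2 : 0 < ln 2 :> R by rewrite ln_gt0// ltr1n.
have lnN : ln N%:R = j%:R * ln 2 :> R by rewrite natrX lnXn// mulr_natl.
have lnKE : ln K%:R = l%:R * ln N%:R :> R by rewrite natrX lnXn ?ltr0n// mulr_natl.
have lnK0 : 0 < ln K%:R :> R by rewrite ln_gt0// ltr1n.
pose c := alpha^-1 * ((l.+2)%:R * ln N%:R - l.+1%:R * ln 2) / ln K%:R.
have ca : c < alpha^-1.
  rewrite ltr_pdivrMr// ltr_pM2l ?invr_gt0//; apply/eqP/eqP; rewrite lnKE lnN.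
  rewrite -(natr1 l.+1) -(natr1 l) /l natrM.
  suff : 0 < ln 2 :> R by nra.
  by [].
suff : (upper_index log_profile <= c%:E)%E.
  by move=> /(le_trans ua); rewrite lee_fin leNgt ca.
apply: (upper_index_le log_profile_mono lnK0).
exists (ln (m0.+1)%:R); split; first exact: num_real.
move=> t tm; have t0 : 0 <= t.
  by apply: ltW; apply: le_lt_trans tm; apply: ln_ge0; rewrite ler1n.
have [n_gt0 _ nK] := scaled_truncn t0 (ltnW K1).
set n := Num.truncn (expR t) in n_gt0 nK.
have m0n : (m0 <= n)%N.
  rewrite -[leqLHS](@natrK R); apply: le_truncn.
  apply: ltW; apply: (lt_trans (y := m0.+1%:R)); first by rewrite ltr_nat.
  by rewrite -ltr_ln ?posrE ?ltr0n ?expR_gt0// expRK.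
rewrite -lerBlDl profile_diff lnK ?posrE ?ltr0n ?(ltnW K1)// -/n.
set n' := Num.truncn _ in nK *.
rewrite /c divfK ?gt_eqF// ler_pM2l ?invr_gt0//.
(* The factor 2 lost to truncation is absorbed by one more factor [N]; hence [l.+1] in [vlow]
   although the step is [ln (N ^ l)]. *)
have nN : (n' <= N ^ l.+1 * n)%N.
  by apply: (leq_trans nK); rewrite leq_mul2r expnSr leq_mul2l N1 !orbT.
have h := le_trans (vlow l.+1 n m0n n_gt0)
  (ler_wpM2l (exprn_ge0 _ (ler0n _ _)) (vd nN)).
have N0' : 0 < N%:R :> R by rewrite ltr0n.
have p2 : 0 < 2 ^+ l.+1 :> R by rewrite exprn_gt0.
have pN : 0 < N%:R ^+ l.+2 :> R by rewrite exprn_gt0.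
move: h; rewrite -ler_ln ?posrE; [|exact: mulr_gt0|exact: mulr_gt0].
rewrite (@lnM _ _ (v n)) ?posrE// (@lnM _ _ (v n')) ?posrE//.
rewrite !lnXn// -[ln 2 *+ _]mulr_natl -[ln N%:R *+ _]mulr_natl; lra.
Qed.

Let total := sup (range S).
Let rest n := total - S n.

(** If [rest] more than halves from [m] to [N m] for all [m >= m0], then [rest m <= 2 (rest m - rest
    (N m)) <= 2 N m v_m], and [rest (N^l m) <= 2^-l rest m]. Since [k v_(2k) <= rest k], this is
    [vup]: over a long step [v] decays too fast for the lower index to stay below [alpha^-1]. *)
Lemma summable_doubling : has_ubound (range S) ->
  (lower_index log_profile <= alpha^-1%:E)%E ->
  forall j m0, exists2 m, (m0 <= m)%N & rest m <= 2 * rest (2 ^ j * m)%N.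
Proof.
move=> Sub la j m0; apply: contrapT => hn.
have dbl m : (m0 <= m)%N -> 2 * rest (2 ^ j * m)%N < rest m.
  by move=> mm; rewrite ltNge; apply/negP => h; apply: hn; exists m.
have hS : has_sup (range S) by split=> //; exists (S 0%N), 0%N.
have S_total n : S n <= total by apply: ub_le_sup => //; exists n.
have rest_ge0 n : 0 <= rest n by rewrite subr_ge0.
pose N := (2 ^ j)%N; have N0 : (0 < N)%N by rewrite expn_gt0.
have N0' : 0 < N%:R :> R by rewrite ltr0n.
have iter l m : (m0 <= m)%N -> 2 ^+ l * rest (N ^ l * m)%N <= rest m.
  move=> mm; elim: l => [|l IH]; first by rewrite mul1r mul1n.
  have ml : (m0 <= N ^ l * m)%N.
    by apply: (leq_trans mm); rewrite leq_pmull// expn_gt0 N0.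
  have := dbl _ ml; rewrite mulnA -expnS exprSr -mulrA => /ltW h.
  by apply: (le_trans _ IH); rewrite ler_pM2l// exprn_gt0.
have N1 : (1 < N)%N.
  rewrite ltnNge; apply/negP => N1; have N1' : N = 1%N by apply/eqP; rewrite eqn_leq N1.
  by have := dbl m0 (leqnn _); rewrite -/N N1' mul1n; have := rest_ge0 m0; lra.
have vup l m : (m0 <= m)%N -> (0 < m)%N ->
    2 ^+ l * N%:R ^+ l * v (N ^ l.+1 * m)%N <= 2 * N%:R * v m.
  move=> mm m_gt0; have m0' : 0 < m%:R :> R by rewrite ltr0n.
  have h1 := iter l m mm; have h2 := dbl m mm; rewrite -/N in h2.
  have mN : (m <= N * m)%N by rewrite leq_pmull.
  have h3 : rest m - rest (N * m)%N <= (N * m)%:R * v m.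
    have -> : rest m - rest (N * m)%N = S (N * m)%N - S m by rewrite /rest; ring.
    apply: (le_trans (S_le mN)); rewrite ler_pM2r// ler_nat; exact: leq_subr.
  have h4 : rest m <= 2 * (N%:R * m%:R * v m) by move: h3; rewrite natrM; lra.
  pose k := (N ^ l * m)%N.
  have kN : (2 * k <= N ^ l.+1 * m)%N by rewrite expnS -mulnA leq_pmul2r// muln_gt0 expn_gt0 N0.
  have h5 : k%:R * v (2 * k)%N <= rest k.
    have := @S_ge k (2 * k)%N (leq_pmull _ _); rewrite mul2n -addnn addnK => /(_ isT).
    by have := S_total (k + k)%N; rewrite /rest; lra.
  have h6 : k%:R * v (N ^ l.+1 * m)%N <= rest k.
    by apply: le_trans h5; rewrite ler_wpM2l//; exact: vd.
  rewrite -(ler_pM2r m0'); apply: (le_trans _ (le_trans h1 _)).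
    apply: (le_trans (y := 2 ^+ l * (k%:R * v (N ^ l.+1 * m)%N))).
      by rewrite le_eqVlt; apply/orP; left; apply/eqP; rewrite /k natrM natrX; ring.
    by rewrite ler_pM2l// exprn_gt0.
  by apply: (le_trans h4); rewrite le_eqVlt; apply/orP; left; apply/eqP; ring.
have j0 : (0 < j)%N by rewrite lt0n; apply: contraTneq N1 => j0; rewrite /N j0.
(* l is large enough for 2 ln N < (l - 1) ln 2. *)
pose l := (2 * j + 2)%N; pose K := (N ^ l.+1)%N.
have K1 : (1 < K)%N by rewrite -{1}(expn0 N) ltn_exp2l.
have ln2 : 0 < ln 2 :> R by rewrite ln_gt0// ltr1n.
have lnN : ln N%:R = j%:R * ln 2 :> R by rewrite natrX lnXn// mulr_natl.
have lnKE : ln K%:R = l.+1%:R * ln N%:R :> R.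
  by rewrite natrX lnXn ?ltr0n// mulr_natl.
have lnK0 : 0 < ln K%:R :> R by rewrite ln_gt0// ltr1n.
pose c := alpha^-1 * (l%:R * ln 2 + l%:R * ln N%:R - ln 2 - ln N%:R) / ln K%:R.
have ca : alpha^-1 < c.
  rewrite ltr_pdivlMr// ltr_pM2l ?invr_gt0// lnKE lnN -(natr1 l) /l natrD natrM.
  have : 0 < j%:R :> R by rewrite ltr0n.
  set J := j%:R; set L := ln 2 in ln2 *; move=> J0; nra.
suff : (c%:E <= lower_index log_profile)%E.
  by move=> /le_trans/(_ la); rewrite lee_fin leNgt ca.
apply: (lower_index_ge log_profile_mono lnK0).
exists (ln (m0.+1)%:R); split; first exact: num_real.
move=> t tm; have t0 : 0 <= t.
  by apply: ltW; apply: le_lt_trans tm; apply: ln_ge0; rewrite ler1n.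
have [n_gt0 nK _] := scaled_truncn t0 (ltnW K1).
set n := Num.truncn (expR t) in n_gt0 nK.
have m0n : (m0 <= n)%N.
  rewrite -[leqLHS](@natrK R); apply: le_truncn.
  apply: ltW; apply: (lt_trans (y := m0.+1%:R)); first by rewrite ltr_nat.
  by rewrite -ltr_ln ?posrE ?ltr0n ?expR_gt0// expRK.
rewrite -lerBrDl profile_diff lnK ?posrE ?ltr0n ?(ltnW K1)// -/n.
set n' := Num.truncn _ in nK *.
rewrite /c divfK ?gt_eqF// ler_pM2l ?invr_gt0//.
have c0 : 0 <= 2 ^+ l * N%:R ^+ l :> R by rewrite mulr_ge0 ?exprn_ge0.
have h := le_trans (ler_wpM2l c0 (vd nK)) (vup l n m0n n_gt0).
move: h; rewrite -ler_ln ?posrE ?mulr_gt0 ?exprn_gt0//.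
rewrite (@lnM _ _ (v n)) ?posrE ?mulr_gt0// (@lnM _ _ (v n')) ?posrE ?mulr_gt0 ?exprn_gt0//.
rewrite (@lnM _ (2 ^+ l)) ?posrE ?exprn_gt0// (@lnM _ 2 N%:R) ?posrE//.
rewrite !lnXn// -[ln 2 *+ _]mulr_natl -[ln N%:R *+ _]mulr_natl; lra.
Qed.

End SequenceCriteria.

(** Inversion reverses the order on all of [[0, +oo]]; the conventions at 0 and [+oo] cover
    degenerate indices. *)
Lemma inve_le_fin (R : realType) (x : \bar R) (alpha : R) : (0 <= x)%E ->
  0 < alpha -> (x^-1 <= alpha%:E)%E = (alpha^-1%:E <= x)%E.
Proof.
case: x => [x| |] //; rewrite ?lee_fin => x0 a0; last first.
  by rewrite leey; exact: ltW.
rewrite /inve; have [->|xn0] := eqVneq x 0.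
  by rewrite leye_eq/=; apply/esym/negbTE; rewrite -ltNge invr_gt0.
have xp : 0 < x by rewrite lt_def xn0.
by rewrite lee_fin -[X in _ = (_ <= X)]invrK lef_pV2 ?posrE ?invr_gt0.
Qed.

Lemma fin_le_inve (R : realType) (x : \bar R) (alpha : R) : (0 <= x)%E ->
  0 < alpha -> (alpha%:E <= x^-1)%E = (x <= alpha^-1%:E)%E.
Proof.
case: x => [x| |] //; rewrite ?lee_fin => x0 a0; last first.
  by rewrite leye_eq /=; apply/negbTE; rewrite -ltNge; exact: a0.
rewrite /inve; have [->|xn0] := eqVneq x 0.
  by rewrite leey; apply/esym; rewrite invr_ge0 ltW.
have xp : 0 < x by rewrite lt_def xn0.
by rewrite lee_fin -[X in _ = (X <= _)]invrK lef_pV2 ?posrE ?invr_gt0.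
Qed.

Theorem theorem2p3 (R : realType) (H : completeNormedModType R[i])
    (dot : {dot H for Num.conj}) (hdot : induces_norm dot)
    (a : H -> H) (ha : compact_op a) (ha_rank : ~ finite_rank a) :
  traceability_exponents dot a =
    [set alpha : R | 0 < alpha /\
       (delta_lower dot a <= alpha%:E <= delta_upper dot a)%E] /\
  (d_upper dot a \is a fin_num -> d_upper dot a <> 0%E ->
     traceability_exponents dot a (fine (d_upper dot a))).
Proof.
pose s := singval dot a; pose e := svec dot a; pose f := svec_image dot a.
have s0 n : 0 < s n by exact: singval_gt0.
have sd : nonincreasing_seq s by exact: singval_nonincreasing.
have hs : bounded_weight s (s 0%N) by exact: singval_bounded.
have he : orthonormal_seq dot e by exact: svec_orthonormal.
have hf : orthonormal_seq dot f by exact: svec_image_orthonormal.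
have ss eps : 0 < eps -> exists n, s n < eps by exact: singval_small.
have modE : modulus dot a = sdiag dot s e e.
  (* Only the left side is rewritten, since [s] and [e] depend on [a] themselves. *)
  by rewrite [in LHS](compact_svd hdot ha ha_rank); exact: modulus_sdiag hs.
have muE : mu_seq dot a = s.
  have ev : eigenvalue_sequence (modulus dot a) s.
    by rewrite modE; exact: sdiag_eigenvalue_sequence.
  by apply: xget_unique => // u hu; exact: eigenvalue_sequence_unique hu ev.
pose g := log_profile s; have g_mono := log_profile_mono s0 sd.
have gE : logmu dot a = g by apply/funext => t; rewrite /logmu /mu_fun muE.
have lowE : delta_lower dot a = ((upper_index g)^-1)%E.
  by rewrite /delta_lower /slope gE.
have upE : delta_upper dot a = ((lower_index g)^-1)%E.
  by rewrite /delta_upper /slope gE.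
have dE : d_upper dot a = ((growth_order g)^-1)%E by rewrite /d_upper gE.
have iu0 := upper_index_ge0 g_mono; have il0 := lower_index_ge0 g_mono.
have main alpha : 0 < alpha -> singularly_traceable dot (op_power (modulus dot a) alpha) <->
    (alpha^-1%:E <= upper_index g)%E /\ (lower_index g <= alpha^-1%:E)%E.
  move=> a0; pose v n := s n `^ alpha.
  have v0 n : 0 < v n by exact: powR_gt0.
  have vd : nonincreasing_seq v.
    move=> m n mn; apply: ge0_ler_powR; first exact: ltW.
    - by rewrite nnegrE ltW.
    - by rewrite nnegrE ltW.
    - exact: sd.
  have hv : bounded_weight v (v 0%N) by move=> n; rewrite ger0_norm ?vd// ltW.
  have -> : op_power (modulus dot a) alpha = sdiag dot v e e.
    by rewrite modE; exact: op_power_sdiag hs a0.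
  (* The definition of traceability takes the modulus once more; the power is its own modulus. *)
  have modv : modulus dot (sdiag dot v e e) = sdiag dot v e e.
    exact: modulus_sdiag hv.
  rewrite /singularly_traceable modv; split.
    move=> [_ [tau [tr tv]]]; split; rewrite leNgt; apply/negP.
      move=> /(slow_decay s0 sd a0)[N [q [n0 [N0 q0 qN h]]]].
      exact: (not_traceable_of_slow_decay hdot he tr (fun n => ltW (v0 n)) hv N0 q0 qN h tv).
    move=> /(fast_decay s0 sd a0)[N [q [n0 [N0 qN h]]]].
    exact: (not_traceable_of_fast_decay hdot he tr (fun n => ltW (v0 n)) hv N0 qN h tv).
  move=> [ua la]; split.
    apply: compact_sdiag hv _ => // eps eps0.
    (* The threshold is chosen so that its power [alpha] is [eps]. *)
    have [n hn] := ss (eps `^ alpha^-1) (powR_gt0 _ eps0).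
    exists n => k nk; rewrite ger0_norm ?(ltW (v0 k))//.
    apply: (le_trans (vd _ _ nk)); rewrite /v.
    have -> : eps = (eps `^ alpha^-1) `^ alpha.
      by rewrite -powRrM mulVf ?powRr1 ?gt_eqF// ltW.
    apply: ge0_ler_powR; first exact: ltW.
    - by rewrite nnegrE ltW.
    - by rewrite nnegrE powR_ge0.
    - exact: ltW.
  (* The summable case draws on the lower index [la], the other on the upper index [ua]. *)
  have [Sub|nSub] := pselect (has_ubound (range (fun n => \sum_(k < n) v k))).
    apply: (traceable_of_summable hdot he v0 vd Sub).
    exact: summable_doubling.
  apply: (traceable_of_nonsummable hdot he v0 vd) => [A|].
    apply: contrapT => hA; apply: nSub; exists A => _ [n _ <-].
    by rewrite leNgt; apply/negP => h; apply: hA; exists n.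
  exact: nonsummable_doubling.
have texp alpha : 0 < alpha -> traceability_exponents dot a alpha <->
    (delta_lower dot a <= alpha%:E <= delta_upper dot a)%E.
  move=> a0; rewrite lowE upE (inve_le_fin iu0 a0) (fin_le_inve il0 a0).
  split; first by move=> [_ /(main _ a0)[-> ->]].
  by move=> /andP h; split; [exact: a0|exact/(main _ a0)].
split.
  apply/seteqP; split=> alpha.
    by move=> h; split; [exact: h.1|apply/texp; [exact: h.1|exact: h]].
  by move=> /= [a0 h]; exact/texp.
(* The growth order lies between the two indices, so its inverse lies in the interval. The orders
   [+oo] and 0 correspond to [d_upper] equal to 0 and [+oo], which are excluded. *)
have o0 := growth_order_ge0 g_mono.
have ou := growth_order_le_upper_index g_mono; have lo := lower_index_le_growth_order g_mono.
rewrite dE; move: o0 ou lo; case: (growth_order g) => [r| |]; last 2 first.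
- by move=> _ _ _ _ h; exfalso; apply: h.
- by rewrite leeNy_eq.
rewrite lee_fin => r0 ou lo; rewrite /inve; have [//|rn0] := eqVneq r 0.
have rp : 0 < r by rewrite lt_def rn0.
have ri : 0 < r^-1 by rewrite invr_gt0.
move=> _ _ /=; apply/texp; first exact: ri.
by rewrite lowE upE (inve_le_fin iu0 ri) (fin_le_inve il0 ri) invrK ou.
Qed.
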